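(* For $a>0$ let $(Y_t)_{t\ge0}$ be the continuous-time Markov chain on $\{-1,1\}$ that changes sign at constant rate $a$, and let $X_t=\int_0^tY_s\,ds$ in $\mathbb T=\mathbb R/2\pi\mathbb Z$. Then the process $X^a=(X_{ta})_{t>0}$ converges in law to a standard Brownian motion on $\mathbb T$ as $a\to+\infty$.
   Context: Note that the law of $(X_t,Y_t)$ depends on $a$ through the jump rate of $Y$, and that in $X^a$ time is also accelerated by the factor $a$. A standard Brownian motion on $\mathbb T$ is the projection to $\mathbb R/2\pi\mathbb Z$ of a standard real Brownian motion started at $0$ (generator $\frac12\partial_x^2$). Convergence in law is convergence in law of continuous processes (weak convergence on path space with the topology of locally uniform convergence). *)

(* Defs.v *)
From HB Require Import structures.
From mathcomp Require Import all_boot all_order all_algebra.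
From mathcomp Require Import generic_quotient.
From mathcomp Require Import all_classical all_reals all_analysis.
Import Order.TTheory GRing.Theory Num.Theory.
Import numFieldNormedType.Exports.

Set Implicit Arguments.
Unset Strict Implicit.
Unset Printing Implicit Defensive.

Local Open Scope classical_set_scope.
Local Open Scope ring_scope.

Section circle.
Variable R : realType.

Definition circle_rel (x y : R) : bool := (x - y) / (2 * pi) \is a Num.int.

Lemma circle_rel_refl : reflexive circle_rel.
Proof. by move=> x; rewrite /circle_rel subrr mul0r rpred0. Qed.

Lemma circle_rel_sym : symmetric circle_rel.
Proof. by move=> x y; rewrite /circle_rel -opprB mulNr rpredN. Qed.

Lemma circle_rel_trans : transitive circle_rel.
Proof.
move=> y x z xy yz; rewrite /circle_rel.
by rewrite -(subrK y x) -addrA mulrDl; exact: rpredD.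
Qed.

Canonical circle_equiv :=
  EquivRel circle_rel circle_rel_refl circle_rel_sym circle_rel_trans.

Definition circle : Type := {eq_quot circle_equiv}%qT.
HB.instance Definition _ := Choice.on circle.
HB.instance Definition _ := Quotient.on circle.

Definition circle_proj (x : R) : circle := (\pi_circle x)%qT.

Lemma circle_projP x y : circle_proj x = circle_proj y <-> circle_rel x y.
Proof.
by split=> [/eqmodP|xy]; [|apply/eqmodP].
Qed.

(* The ball of the quotient metric
   [dist([x], [y]) = inf_(k : int) `|x - y + 2 * pi * k|]. *)
Definition circle_ball (u : circle) (e : R) (v : circle) : Prop :=
  exists x y : R, [/\ circle_proj x = u, circle_proj y = v & `|x - y| < e].

Let ent : set_system (circle * circle) := entourage_ circle_ball.
Let nbhs_circle (u : circle) : set_system circle := nbhs_ ent u.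
Let nbhs_circleE : nbhs_circle = nbhs_ ent. Proof. by []. Qed.

HB.instance Definition _ := hasNbhs.Build circle nbhs_circle.

Lemma circle_ball_center u e : 0 < e -> circle_ball u e u.
Proof.
move=> e0; exists (repr u), (repr u).
by rewrite /circle_proj reprK subrr normr0.
Qed.

Lemma circle_ball_sym u v e : circle_ball u e v -> circle_ball v e u.
Proof. by move=> [x [y [xu yv xy]]]; exists y, x; rewrite distrC. Qed.

Lemma circle_ball_triangle u v w e1 e2 :
  circle_ball u e1 v -> circle_ball v e2 w -> circle_ball u (e1 + e2) w.
Proof.
move=> [x [y [xu yv xy]]] [y' [z [y'v zw y'z]]].
exists x, (y + (z - y')); split=> //.
- rewrite -zw; apply/circle_projP; rewrite /circle_rel addrCA addrAC subrr add0r.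
  by apply/circle_projP; rewrite yv y'v.
- by rewrite opprD opprB addrA (le_lt_trans (ler_normD _ _))// ltrD.
Qed.

Let entE : ent = entourage_ circle_ball. Proof. by []. Qed.

HB.instance Definition _ := @Nbhs_isPseudoMetric.Build R circle ent nbhs_circleE
  circle_ball circle_ball_center circle_ball_sym circle_ball_triangle entE.

(* The topology induced by [circle_ball] is the quotient topology. *)
Lemma circle_proj_continuous : continuous circle_proj.
Proof.
move=> x; apply/cvg_ballP => e e0; apply/nbhs_ballP.
by exists e => // y xy; exists x, y.
Qed.

Lemma circle_proj_open (A : set R) : open A -> open (circle_proj @` A).
Proof.
rewrite !openE => Ao _ [x Ax <-].
have /nbhs_ballP[e e0 eA] := Ao _ Ax.
apply/nbhs_ballP; exists e => // v [x' [y' [xx' y'v x'y']]].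
exists (y' + (x - x')).
  by apply: eA; rewrite /ball/= opprD opprB addrCA [x + _]addrC subrK addrC.
rewrite -y'v; apply/circle_projP; rewrite /circle_rel addrAC subrr add0r.
by apply/circle_projP; rewrite xx'.
Qed.

End circle.

Section path_space.
Variable R : realType.

Definition pos_time : Type := [set t : R | 0 < t].
HB.instance Definition _ := Topological.on pos_time.

(* Continuous paths, with the topology of uniform convergence on the compact
   sets of times, that is, of locally uniform convergence. *)
Definition path_space : Type := continuousType pos_time (circle R).
HB.instance Definition _ := Choice.on path_space.
HB.instance Definition _ := Topological.copy path_space
  (initial_topology
     (fun f : path_space => f : {family compact, pos_time -> circle R})).

End path_space.

Section processes.
Context {R : realType} d (Om : measurableType d) (P : probability Om R).

Section markov_chain.
Variables (S : eqType) (E : seq S) (q : S -> S -> R).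

(* [p t] is the matrix of transition probabilities in time [t] and the rate
   matrix [q] is its derivative at time [0]. *)
Record transition_semigroup (p : R -> S -> S -> R) : Prop := {
  transition_ge0 : forall (t : R) x y, 0 <= t -> x \in E -> y \in E -> 0 <= p t x y ;
  transition_sum1 : forall (t : R) x, 0 <= t -> x \in E -> \sum_(y <- E) p t x y = 1 ;
  transition0 : forall x y, x \in E -> y \in E -> p 0 x y = (x == y)%:R ;
  transitionD : forall (s t : R) x z, 0 <= s -> 0 <= t -> x \in E -> z \in E ->
    p (s + t) x z = \sum_(y <- E) p s x y * p t y z ;
  transition_rate : forall x y, x \in E -> y \in E ->
    (p h x y - (x == y)%:R) / h @[h --> 0^'+] --> q x y
}.

(* Only times [0 <= t] are meaningful; the initial law is arbitrary. *)
Record markov_chain (Y : R -> Om -> S) : Prop := {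
  chain_mem : forall (t : R) w, 0 <= t -> Y t w \in E ;
  chain_measurable : forall (t : R) y, 0 <= t -> y \in E ->
    measurable [set w | Y t w = y] ;
  chain_right_continuous : forall (t : R) w, 0 <= t ->
    \forall s \near t^'+, Y s w = Y t w ;
  chain_markov : exists2 p, transition_semigroup p &
    forall (n : nat) (t : nat -> R) (y : nat -> S),
      0 <= t 0%N -> (forall i, t i <= t i.+1) -> (forall i, y i \in E) ->
      P (\bigcap_(i < n.+1) [set w | Y (t i) w = y i]) =
      (P [set w | Y (t 0%N) w = y 0%N] *
       (\prod_(i < n) p (t i.+1 - t i) (y i) (y i.+1))%:E)%E
}.

End markov_chain.

Definition sign_change_rate (a x y : R) : R := if y == - x then a else - a.

Definition sign_chain (a : R) (Y : R -> Om -> R) : Prop :=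
  markov_chain [:: -1; 1] (sign_change_rate a) Y.

Record standard_brownian_motion (W : R -> Om -> R) : Prop := {
  brownian_measurable : forall t : R, 0 <= t -> measurable_fun setT (W t) ;
  brownian0 : forall w, W 0 w = 0 ;
  brownian_continuous : forall w, {within `[0, +oo[, continuous (W ^~ w)} ;
  brownian_normal : forall (s t : R) (A : set R), 0 <= s -> s < t -> measurable A ->
    P [set w | A (W t w - W s w)] = normal_prob 0 (Num.sqrt (t - s)) A ;
  brownian_indep : forall (n : nat) (t : nat -> R) (A : nat -> set R),
    0 <= t 0%N -> (forall i, t i <= t i.+1) -> (forall i, measurable (A i)) ->
    P (\bigcap_(i < n) [set w | A i (W (t i.+1) w - W (t i) w)]) =
    (\prod_(i < n) P [set w | A i (W (t i.+1) w - W (t i) w)%R])%E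
}.

Definition circle_brownian_motion (B : Om -> path_space R) : Prop :=
  exists2 W, standard_brownian_motion W &
    forall w t, B w t = circle_proj (W (\val t) w).

Definition circle_integral (Y : R -> Om -> R) (t : R) (w : Om) : circle R :=
  circle_proj (\int[lebesgue_measure]_(s in `[0, t]) Y s w).

End processes.

(* Convergence in law as the parameter tends to [+oo].  The Borel sets of
   [path_space R] are generated by the coordinates, so the [F \o X a] below are
   measurable as soon as the coordinates of [X a] are. *)
Definition cvg_in_law (R : realType) (T : topologicalType)
    (d : R -> measure_display) (Om : forall a, measurableType (d a))
    (P : forall a, probability (Om a) R) (X : forall a, Om a -> T)
    (d' : measure_display) (Om' : measurableType d') (Q : probability Om' R)
    (Z : Om' -> T) : Prop :=
  forall F : T -> R, continuous F -> (exists M : R, forall x, `|F x| <= M) ->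
    ('E_(P a)[F \o X a] @[a --> +oo%R] --> 'E_Q[F \o Z])%E.

(* Main.v *)
Require Import Defs.
From mathcomp Require Import all_boot all_order all_algebra.
From mathcomp Require Import all_classical all_reals all_analysis.
From mathcomp Require Import measurable_realfun lebesgue_integral_under.
From mathcomp Require Import ring lra.
Import Order.TTheory GRing.Theory Num.Theory.
Import numFieldNormedType.Exports.
Set Implicit Arguments.
Unset Strict Implicit.
Unset Printing Implicit Defensive.
Local Open Scope classical_set_scope.
Local Open Scope ring_scope.


(** No tightness argument is needed.  A continuous functional [F] bounded by [M]
   is the limit, from below, of inf-convolutions [envelope F M k], which are
   Lipschitz for the uniform distance on the times between [1/(k+1)] and [k+1] and
   are defined for discontinuous paths too.  In [envelope F M k] the process
   [X^a] may be replaced by its values on the grid of mesh [2^-n]: the increments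
   [D] of [X^a] over time [delta] satisfy [E D^4 <= 7 delta^2] whatever [a], so
   that chaining bounds the error uniformly in [a].  A Lipschitz function of
   finitely many increments on the circle is approximated by trigonometric
   polynomials, and [E (f cos (k D))] is close to [exp (- k^2 delta / 2) E f] for
   [f] depending on the past, as one sees by cutting [D] into many pieces, each of
   which has mean almost [0] and variance almost equal to its duration.  Hence
   [liminf E F(X^a) >= E F(B)], and [- F] gives the other inequality. *)

(** * Bounded random variables *)

(** The chain enters only through one relation: tested against the past of [s], [Y t] is [r (t - s)]
    times [Y s], where [r] has values in [0, 1] on nonnegative times and (1 - r h) / h tends to 2a
    as h decreases to 0. The integral of [Y] over a time of length delta a then has second moment
    close to delta, whence the unit diffusivity of the limit. No filtration is available:
    conditioning means testing against functions of finitely many values of the chain and their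
    bounded limits. The fourth moment is chosen because the 2^l increments of level l, each of
    fourth moment of order 4^-l, have a summable total, which second moments would not give; it also
    controls the Taylor remainders. On the compact circle trigonometric polynomials approximate
    uniformly, without any estimate at infinity. The envelopes converge to [F] without control
    uniform in [a], but they lie below [F] under every law, which is why only an inequality is
    proved for each functional. A path sampled on a grid is a step function, outside the path space,
    so the envelopes must accept arbitrary functions. *)

Section bounded_random_variables.
Context {R : realType} d (T : measurableType d) (P : probability T R).

(** No measure occurs in this definition, so that the same class, taken on [R], also provides the
    bounded Borel test functions. *)
Definition bounded_rv (f : T -> R) :=
  measurable_fun setT f /\ exists M, forall w, `|f w| <= M.

Definition mean (f : T -> R) : R := \int[P]_w f w.

Lemma bounded_rv_measurable f : bounded_rv f -> measurable_fun setT f.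
Proof. by case. Qed.

Lemma eq_bounded_rv f g : f =1 g -> bounded_rv f -> bounded_rv g.
Proof. by move=> /funext ->. Qed.

Lemma bounded_rv_integrable f : bounded_rv f -> P.-integrable setT (EFin \o f).
Proof.
move=> [mf [M fM]]; apply: measurable_bounded_integrable => //.
- by apply: le_lt_trans (probability_le1 _ _) _ => //; rewrite ltry.
- exists M; split=> [|x Mx w _ /=]; first exact: num_real.
  by rewrite (le_trans (fM w))// ltW.
Qed.

Lemma bounded_rv_cst c : bounded_rv (fun=> c).
Proof. by split => //; exists `|c|. Qed.

Lemma bounded_rvD f g : bounded_rv f -> bounded_rv g ->
  bounded_rv (fun w => f w + g w).
Proof.
move=> [mf [M fM]] [mg [N gN]]; split; first exact: measurable_funD.
by exists (M + N) => w; rewrite (le_trans (ler_normD _ _))// lerD.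
Qed.

Lemma bounded_rvN f : bounded_rv f -> bounded_rv (fun w => - f w).
Proof.
move=> [mf [M fM]]; split; first exact: measurableT_comp.
by exists M => w; rewrite normrN.
Qed.

Lemma bounded_rvB f g : bounded_rv f -> bounded_rv g ->
  bounded_rv (fun w => f w - g w).
Proof. by move=> bf bg; apply: bounded_rvD => //; exact: bounded_rvN. Qed.

Lemma bounded_rvM f g : bounded_rv f -> bounded_rv g ->
  bounded_rv (fun w => f w * g w).
Proof.
move=> [mf [M fM]] [mg [N gN]]; split; first exact: measurable_funM.
by exists (M * N) => w; rewrite normrM ler_pM.
Qed.

Lemma bounded_rvX f n : bounded_rv f -> bounded_rv (fun w => f w ^+ n).
Proof.
move=> bf; elim: n => [|n IH]; first exact: bounded_rv_cst.
by under eq_fun do rewrite exprS; exact: bounded_rvM.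
Qed.

Lemma bounded_rv_sum (I : Type) (s : seq I) (p : pred I) (f : I -> T -> R) :
  (forall i, p i -> bounded_rv (f i)) ->
  bounded_rv (fun w => \sum_(i <- s | p i) f i w).
Proof.
move=> bf; elim: s => [|i s IH].
  by apply: (@eq_bounded_rv (fun=> 0)) => [w|];
    [rewrite big_nil|exact: bounded_rv_cst].
case: (boolP (p i)) => pi; last first.
  by apply: eq_bounded_rv IH => w; rewrite big_cons (negbTE pi).
apply: eq_bounded_rv (bounded_rvD (bf i pi) IH) => w.
by rewrite big_cons pi.
Qed.

Lemma bounded_rv_comp (h : R -> R) M f :
  measurable_fun setT h -> (forall x, `|h x| <= M) -> measurable_fun setT f ->
  bounded_rv (fun w => h (f w)).
Proof.
by move=> mh hM mf; split; [exact: measurableT_comp|exists M => w].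
Qed.

Lemma bounded_rv_cos f : measurable_fun setT f -> bounded_rv (fun w => cos (f w)).
Proof.
move=> mf; apply: (@bounded_rv_comp cos 1) => //.
- by apply: continuous_measurable_fun; exact: continuous_cos.
- by move=> x; rewrite ler_norml cos_geN1 cos_le1.
Qed.

Lemma bounded_rv_sin f : measurable_fun setT f -> bounded_rv (fun w => sin (f w)).
Proof.
move=> mf; apply: (@bounded_rv_comp sin 1) => //.
- by apply: continuous_measurable_fun; exact: continuous_sin.
- by move=> x; rewrite ler_norml sin_geN1 sin_le1.
Qed.

Lemma bounded_rv_indic (A : set T) : measurable A -> bounded_rv (\1_A).
Proof.
move=> mA; split; first exact: measurable_indic.
by exists 1 => w; rewrite indicE; case: (w \in A); rewrite ?normr1 ?normr0.
Qed.

Lemma eq_mean f g : f =1 g -> mean f = mean g.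
Proof. by move=> fg; rewrite /mean; apply: eq_Rintegral => w _. Qed.

Lemma mean_cst c : mean (fun=> c) = c.
Proof. by rewrite /mean Rintegral_cst //= probability_setT /= mulr1. Qed.

Lemma meanD f g : bounded_rv f -> bounded_rv g ->
  mean (fun w => f w + g w) = mean f + mean g.
Proof. by move=> bf bg; apply: RintegralD => //; exact: bounded_rv_integrable. Qed.

Lemma meanB f g : bounded_rv f -> bounded_rv g ->
  mean (fun w => f w - g w) = mean f - mean g.
Proof. by move=> bf bg; apply: RintegralB => //; exact: bounded_rv_integrable. Qed.

Lemma meanZ c f : bounded_rv f -> mean (fun w => c * f w) = c * mean f.
Proof. by move=> bf; apply: RintegralZl => //; exact: bounded_rv_integrable. Qed.

Lemma meanZr c f : bounded_rv f -> mean (fun w => f w * c) = mean f * c.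
Proof. by move=> bf; apply: RintegralZr => //; exact: bounded_rv_integrable. Qed.

Lemma meanN f : bounded_rv f -> mean (fun w => - f w) = - mean f.
Proof.
by move=> bf; rewrite -mulN1r -meanZ//; apply: eq_mean => w; rewrite mulN1r.
Qed.

Lemma mean_sum (I : Type) (s : seq I) (p : pred I) (f : I -> T -> R) :
  (forall i, p i -> bounded_rv (f i)) ->
  mean (fun w => \sum_(i <- s | p i) f i w) = \sum_(i <- s | p i) mean (f i).
Proof.
move=> bf; elim: s => [|i s IH].
  rewrite (@eq_mean _ (fun=> 0)) => [|w]; last by rewrite big_nil.
  by rewrite mean_cst big_nil.
rewrite big_cons; case: (boolP (p i)) => pi; last first.
  by rewrite -IH; apply: eq_mean => w; rewrite big_cons (negbTE pi).
rewrite -IH -meanD; first by apply: eq_mean => w; rewrite big_cons pi.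
- exact: bf.
- exact: bounded_rv_sum.
Qed.

Lemma le_mean f g : bounded_rv f -> bounded_rv g -> (forall w, f w <= g w) ->
  mean f <= mean g.
Proof.
by move=> bf bg fg; apply: le_Rintegral => //; exact: bounded_rv_integrable.
Qed.

Lemma normr_mean_le f g : bounded_rv f -> bounded_rv g ->
  (forall w, `|f w| <= g w) -> `|mean f| <= mean g.
Proof.
move=> bf bg fg; rewrite ler_norml -meanN//; apply/andP; split.
- apply: le_mean => //; first exact: bounded_rvN.
  by move=> w; have := fg w; rewrite ler_norml => /andP[].
- by apply: le_mean => // w; rewrite (le_trans (ler_norm _)).
Qed.

Lemma normr_mean_le_cst f M : bounded_rv f -> (forall w, `|f w| <= M) ->
  `|mean f| <= M.
Proof.
by move=> bf fM; rewrite -[leRHS]mean_cst; apply: normr_mean_le => //;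
  exact: bounded_rv_cst.
Qed.

Lemma mean_indic A : measurable A -> mean (\1_A) = fine (P A).
Proof.
by move=> mA; rewrite /mean /Rintegral integral_indic// setIT.
Qed.

Lemma EFin_mean f : bounded_rv f -> ((mean f)%:E = 'E_P[f])%E.
Proof.
move=> bf; rewrite unlock /mean /Rintegral fineK//.
by apply: integrable_fin_num => //; exact: bounded_rv_integrable.
Qed.

Lemma bounded_rv_cvg (u : nat -> T -> R) (f : T -> R) M :
  (forall n, measurable_fun setT (u n)) -> (forall n w, `|u n w| <= M) ->
  (forall w, u n w @[n --> \oo] --> f w) -> bounded_rv f.
Proof.
move=> mu uM uf; split.
  by apply: (@measurable_fun_cvg _ _ _ setT u) => // w _; exact: uf.
exists M => w; apply: (ler_cvg_to (cvg_norm (uf w)) (cvg_cst M)).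
by near=> n; exact: uM.
Unshelve. all: by end_near. Qed.

Lemma mean_cvg (u : nat -> T -> R) (f : T -> R) M :
  (forall n, measurable_fun setT (u n)) -> (forall n w, `|u n w| <= M) ->
  (forall w, u n w @[n --> \oo] --> f w) ->
  mean (u n) @[n --> \oo] --> mean f.
Proof.
move=> mu uM uf; have bf := bounded_rv_cvg mu uM uf.
have mEu n : measurable_fun setT (EFin \o u n) by exact/measurable_EFinP.
have mEf : measurable_fun setT (EFin \o f) by apply/measurable_EFinP; case: bf.
have uEf : {ae P, forall w, setT w -> (EFin \o u n) w @[n --> \oo] --> (EFin \o f) w}.
  by apply: aeW => w _; apply: cvg_EFin; [exact: nearW|exact: uf].
have uEM : {ae P, forall w n, setT w -> (`|(EFin \o u n) w| <= (EFin \o cst M) w)%E}.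
  by apply: aeW => w n _ /=; rewrite lee_fin.
have [_ _ dc] := dominated_convergence measurableT mEu mEf uEf
  (bounded_rv_integrable (bounded_rv_cst M)) uEM.
apply: fine_cvg => /=.
have -> : (fine (\int[P]_x (f x)%:E))%:E = (\int[P]_x (f x)%:E)%E.
  by have := EFin_mean bf; rewrite unlock.
exact: dc.
Qed.

End bounded_random_variables.

Ltac bounded_rv_tac := repeat first
  [ done | exact: bounded_rv_cst | apply: bounded_rvD | apply: bounded_rvB
  | apply: bounded_rvN | apply: bounded_rvM | apply: bounded_rvX ].

Lemma cvg_pow {R : realType} (I : Type) (F : set_system I) (FF : ProperFilter F)
    (f : I -> R) (l : R) n :
  f x @[x --> F] --> l -> f x ^+ n @[x --> F] --> l ^+ n.
Proof.
move=> fl; elim: n => [|n IH]; first exact: cvg_cst.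
rewrite exprS (_ : (fun x => _) = (fun x => f x * f x ^+ n)); first exact: cvgM.
by apply/funext => x; rewrite exprS.
Qed.

(** * Moments of the telegraph process *)

Section sign_chain_semigroup.
Context {R : realType}.

(* [r t] is the second eigenvalue of the transition matrix in time [t]. *)
Lemma sign_chain_eigenvalue (a : R) (p : R -> R -> R -> R) : 0 < a ->
  transition_semigroup [:: -1; 1] (sign_change_rate a) p ->
  exists r : R -> R, [/\ (forall t, 0 <= t -> 0 <= r t <= 1),
    (1 - r h) / h @[h --> 0^'+] --> 2 * a &
    forall t x, 0 <= t -> x \in [:: -1; 1] -> p t x 1 - p t x (-1) = x * r t].
Proof.
move=> a0 [pge0 psum p0 pD prate].
have m1 : (1 : R) \in [:: -1; 1 : R] by rewrite !inE eqxx orbT.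
have mN1 : (-1 : R) \in [:: -1; 1 : R] by rewrite !inE eqxx.
have neq : (1 == -1 :> R) = false by apply/eqP; lra.
have neq' : (-1 == 1 :> R) = false by apply/eqP; lra.
pose al t := p t 1 (-1); pose be t := p t (-1) 1; pose r t := 1 - al t - be t.
have p11 t : 0 <= t -> p t 1 1 = 1 - al t.
  by move=> t0; have := psum t 1 t0 m1; rewrite !big_cons big_nil /al; lra.
have pNN t : 0 <= t -> p t (-1) (-1) = 1 - be t.
  by move=> t0; have := psum t (-1) t0 mN1; rewrite !big_cons big_nil /be; lra.
have alD s t : 0 <= s -> 0 <= t -> al (s + t) = al t + al s * r t.
  move=> s0 t0; rewrite {1}/al pD// !big_cons big_nil p11// pNN//.
  by rewrite -/(al s) -/(al t) /r; ring.
have beD s t : 0 <= s -> 0 <= t -> be (s + t) = be t + be s * r t.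
  move=> s0 t0; rewrite {1}/be pD// !big_cons big_nil p11// pNN//.
  by rewrite -/(be s) -/(be t) /r; ring.
have rD s t : 0 <= s -> 0 <= t -> r (s + t) = r s * r t.
  by move=> s0 t0; rewrite {1}/r alD// beD// /r; ring.
have ral : al h / h @[h --> 0^'+] --> a.
  have := prate 1 (-1) m1 mN1; rewrite /sign_change_rate eqxx neq.
  by under eq_fun do rewrite subr0.
have rbe : be h / h @[h --> 0^'+] --> a.
  have := prate (-1) 1 mN1 m1; rewrite /sign_change_rate opprK eqxx neq'.
  by under eq_fun do rewrite subr0.
have rr : (1 - r h) / h @[h --> 0^'+] --> 2 * a.
  have -> : 2 * a = a + a by ring.
  rewrite (_ : (fun h => (1 - r h) / h) = (fun h => al h / h + be h / h)).
    exact: cvgD.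
  by apply/funext => h; rewrite /r -mulrDl; congr (_ / _); ring.
(* Exchanging [h] and [t] in the relation gives f t (1 - r h) = f h (1 - r t). Divided by [h], this
   determines [f t] in the limit, so both off-diagonal entries equal (1 - r t) / 2 without solving a
   differential equation. *)
have half (f : R -> R) : (forall s t, 0 <= s -> 0 <= t -> f (s + t) = f t + f s * r t) ->
    f h / h @[h --> 0^'+] --> a -> forall t, 0 <= t -> f t = (1 - r t) / 2.
  move=> fD rf t t0.
  suff : f t * (2 * a) = a * (1 - r t).
    move=> /(congr1 (fun x => x / (2 * a))).
    rewrite mulfK; last by lra.
    by move=> ->; field; lra.
  have h1 : f t * ((1 - r h) / h) @[h --> 0^'+] --> f t * (2 * a).
    by apply: cvgM => //; exact: cvg_cst.
  have h2 : f t * ((1 - r h) / h) @[h --> 0^'+] --> a * (1 - r t).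
    have h3 : (f h / h) * (1 - r t) @[h --> 0^'+] --> a * (1 - r t).
      by apply: cvgM => //; exact: cvg_cst.
    apply: cvg_trans h3; apply: near_eq_cvg; near=> h.
    have h0 : 0 < h by near: h; exact: nbhs_right_gt.
    have := fD h t (ltW h0) t0; rewrite [h + t]addrC (fD t h t0 (ltW h0)) => e.
    have e' : f t * (1 - r h) = f h * (1 - r t) by move: e; lra.
    by rewrite [RHS]mulrA e' mulrAC.
  exact: (cvg_unique _ h1 h2).
exists r; split => //.
- move=> t t0; apply/andP; split.
    (* Nonnegativity holds because [r t] is the square of [r (t / 2)]. *)
    have -> : t = t / 2 + t / 2 by field.
    by rewrite rD ?divr_ge0// -expr2 sqr_ge0.
  by have := pge0 t 1 (-1) t0 m1 mN1; have := pge0 t (-1) 1 t0 mN1 m1; rewrite /r /al /be; lra.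
- move=> t x t0; have hal := half al alD ral t t0; have hbe := half be beD rbe t t0.
  rewrite !inE => /orP[|] /eqP ->.
    by rewrite pNN// -/(be t) hbe; field.
  by rewrite p11// -/(al t) hal; field.
Unshelve. all: by end_near. Qed.

End sign_chain_semigroup.

(** * Functions of finitely many values of the chain *)

Section finite_past.
Context {R : realType} d (T : measurableType d) (P : probability T R).
Variable Y : R -> T -> R.
Implicit Types (s t u : R) (f g : T -> R).

(** Replaces measurability with respect to the sigma-algebra of the past. No regularity is asked of
    [phi]: for a chain with two states such a function is constant on each of finitely many
    cylinders. *)
Definition finite_past (s : R) (f : T -> R) :=
  exists (ts : seq R) (phi : (R -> R) -> R),
  [/\ {in ts, forall u, 0 <= u <= s},
      (forall y y', {in ts, y =1 y'} -> phi y = phi y') &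
      forall w, f w = phi (Y ^~ w)].

Lemma finite_past_eval s u : 0 <= u <= s -> finite_past s (Y u).
Proof.
move=> us; exists [:: u], (fun y => y u); split => //.
- by move=> v; rewrite inE => /eqP ->.
- by move=> y y' yy'; rewrite yy'// inE.
Qed.

Lemma finite_past_cst s c : finite_past s (fun=> c).
Proof. by exists [::], (fun=> c); split. Qed.

Lemma finite_past_le s s' f : s <= s' -> finite_past s f -> finite_past s' f.
Proof.
move=> ss' [ts [phi [ts0 phiE fE]]]; exists ts, phi; split=> // u /ts0/andP[u0 us].
by rewrite u0 (le_trans us).
Qed.

Lemma finite_past_comp2 (h : R -> R -> R) s f g :
  finite_past s f -> finite_past s g -> finite_past s (fun w => h (f w) (g w)).
Proof.
move=> [ts [phi [ts0 phiE fE]]] [ts' [phi' [ts0' phiE' fE']]].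
exists (ts ++ ts'), (fun y => h (phi y) (phi' y)); split.
- by move=> u; rewrite mem_cat => /orP[/ts0|/ts0'].
- move=> y y' yy'; rewrite (phiE y y') ?(phiE' y y')// => u uts; apply: yy'.
    by rewrite mem_cat uts orbT.
  by rewrite mem_cat uts.
- by move=> w; rewrite fE fE'.
Qed.

Lemma finite_past_comp (h : R -> R) s f :
  finite_past s f -> finite_past s (fun w => h (f w)).
Proof. by move=> pf; apply: (finite_past_comp2 (fun x _ => h x) pf pf). Qed.

Lemma finite_past_sum (I : Type) (l : seq I) s (f : I -> T -> R) :
  (forall i, finite_past s (f i)) ->
  finite_past s (fun w => \sum_(i <- l) f i w).
Proof.
move=> pf; elim: l => [|i l IH].
  have [ts [phi [ts0 phiE fE]]] := finite_past_cst s 0.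
  by exists ts, phi; split => // w; rewrite big_nil; exact: fE.
have [ts [phi [ts0 phiE fE]]] := finite_past_comp2 +%R (pf i) IH.
by exists ts, phi; split => // w; rewrite big_cons; exact: fE.
Qed.

Hypothesis Ysign : forall t w, 0 <= t -> Y t w \in [:: -1; 1].

Let sg (b : bool) : R := if b then 1 else -1.

Let sgE t w : 0 <= t -> Y t w = sg (Y t w == 1).
Proof.
move=> /(Ysign w); rewrite !inE /sg => /orP[|] /eqP ->.
  by case: eqP => // ?; lra.
by rewrite eqxx.
Qed.

Let cyl n (t : nat -> R) (c : {ffun 'I_n.+1 -> bool}) : set T :=
  \bigcap_(i < n.+1) [set w | Y (t i) w = sg (c (inord i))].

(** [f] is constant on each set where the signs of the chain at the relevant times are prescribed.
    The last time is forced to be [s], so that every cylinder also prescribes [Y s], the present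
    state in the Markov property. *)
Lemma finite_past_decomposition s f : 0 <= s -> finite_past s f ->
  exists n (t : nat -> R) (v : {ffun 'I_n.+1 -> bool} -> R),
  [/\ 0 <= t 0%N, (forall i, t i <= t i.+1), t n = s &
      forall w, f w = \sum_c v c * \1_(cyl t c) w].
Proof.
move=> s0 [ts [phi [ts0 phiE fE]]].
(* The default value [s] of [nth] continues the sorted times by the constant [s]: the sequence is
   nondecreasing at all indices, and its term of index [n = size l] is [s]. *)
pose l := sort <=%R ts; pose t i := nth s l i; pose n := size l.
have ln u : u \in l = (u \in ts) by rewrite mem_sort.
have ts_ i : 0 <= t i <= s.
  have [il|li] := ltnP i n; last by rewrite /t nth_default// lexx s0.
  by apply: ts0; rewrite -ln mem_nth.
have tmono i : t i <= t i.+1.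
  have [il|li] := ltnP i.+1 n; last first.
    by rewrite [t i.+1]/t nth_default//; case/andP: (ts_ i).
  have /(sortedP s) : sorted <=%R l by apply: sort_sorted; exact: le_total.
  exact.
exists n, t, (fun c => phi (fun u => sg (c (inord (index u l))))); split => //.
- by case/andP: (ts_ 0%N).
- by rewrite /t nth_default.
move=> w; pose cw : {ffun 'I_n.+1 -> bool} := [ffun i : 'I_n.+1 => Y (t i) w == 1].
have cylE c : \1_(cyl t c) w = (c == cw)%:R :> R.
  rewrite indicE; congr ((nat_of_bool _)%:R); apply/idP/idP => [|/eqP ->].
    rewrite inE => wc; apply/eqP/ffunP => i; rewrite ffunE.
    have /= -> := wc i (ltn_ord i); rewrite inord_val /sg.
    by case: (c i); [rewrite eqxx|apply/esym/eqP; lra].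
  rewrite inE => i /= ni; rewrite ffunE inordK//.
  by apply: sgE; case/andP: (ts_ i).
rewrite (bigD1 cw)//= cylE eqxx mulr1 big1 ?addr0; last first.
  by move=> c ccw; rewrite cylE (negbTE ccw) mulr0.
rewrite fE; apply: phiE => u uts.
have ul : (index u l < n)%N by rewrite index_mem ln.
rewrite ffunE inordK; last exact: ltnW.
rewrite /t nth_index ?ln//; apply: sgE.
by case/andP: (ts0 u uts).
Qed.

Hypothesis Ymeas : forall t y, 0 <= t -> y \in [:: -1; 1] -> measurable [set w | Y t w = y].

Let sg_mem b : sg b \in [:: -1; 1 : R].
Proof. by rewrite !inE /sg; case: b; rewrite eqxx ?orbT. Qed.

Lemma mono_ge0 (t : nat -> R) : 0 <= t 0%N -> (forall i, t i <= t i.+1) ->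
  forall i, 0 <= t i.
Proof. by move=> t0 tm; elim => // i IH; rewrite (le_trans IH). Qed.

Let measurable_cyl n (t : nat -> R) (c : {ffun 'I_n.+1 -> bool}) :
  0 <= t 0%N -> (forall i, t i <= t i.+1) -> measurable (cyl t c).
Proof.
move=> t0 tm; apply: bigcap_measurableType => i _.
by apply: Ymeas; [exact: mono_ge0|exact: sg_mem].
Qed.

Lemma finite_past_bounded_rv s f : 0 <= s -> finite_past s f -> bounded_rv f.
Proof.
move=> s0 /(finite_past_decomposition s0)[n [t [v [t0 tm tn fE]]]].
apply: (@eq_bounded_rv _ _ _ (fun w => \sum_c v c * \1_(cyl t c) w)) => //.
apply: bounded_rv_sum => c _; apply: bounded_rvM; first exact: bounded_rv_cst.
by apply: bounded_rv_indic; exact: measurable_cyl.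
Qed.

Variable p : R -> R -> R -> R.
Hypothesis Ymarkov : forall (n : nat) (t : nat -> R) (y : nat -> R),
      0 <= t 0%N -> (forall i, t i <= t i.+1) -> (forall i, y i \in [:: -1; 1]) ->
      P (\bigcap_(i < n.+1) [set w | Y (t i) w = y i]) =
      (P [set w | Y (t 0%N) w = y 0%N] *
       (\prod_(i < n) p (t i.+1 - t i) (y i) (y i.+1))%:E)%E.

(** [Ymarkov] speaks of infinite sequences, so times and states are continued by the constants [s]
    and [y] after rank [n]; the two products of transition probabilities then differ by their last
    factor. *)
Let markov_cyl n (t : nat -> R) (c : {ffun 'I_n.+1 -> bool}) s y :
  0 <= t 0%N -> (forall i, t i <= t i.+1) -> t n <= s -> y \in [:: -1; 1] ->
  fine (P (cyl t c `&` [set w | Y s w = y])) =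
  fine (P (cyl t c)) * p (s - t n) (sg (c (inord n))) y.
Proof.
move=> t0 tm tns yE.
pose t' i := if (i <= n)%N then t i else s.
pose y' i := if (i <= n)%N then sg (c (inord i)) else y.
have t'm i : t' i <= t' i.+1.
  rewrite /t'; have [ni|ni|->] := ltngtP i n.
  - exact: tm.
  - exact: lexx.
  - exact: tns.
have y'E i : y' i \in [:: -1; 1] by rewrite /y'; case: ifP.
have -> : cyl t c `&` [set w | Y s w = y] =
    \bigcap_(i < n.+2) [set w | Y (t' i) w = y' i].
  rewrite bigcap_mkord big_ord_recr/=; congr (_ `&` _).
    rewrite /cyl bigcap_mkord; apply: eq_bigr => i _.
    by rewrite /t' /y' -ltnS ltn_ord.
  by rewrite /t' /y' ltnn.
have -> : cyl t c = \bigcap_(i < n.+1) [set w | Y (t' i) w = y' i].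
  rewrite /cyl !bigcap_mkord; apply: eq_bigr => i _.
  by rewrite /t' /y' -ltnS ltn_ord.
rewrite !Ymarkov// big_ord_recr/= EFinM muleA.
have -> : p (t' n.+1 - t' n) (y' n) (y' n.+1) = p (s - t n) (sg (c (inord n))) y.
  by rewrite /t' /y' leqnn ltnn.
rewrite [LHS]fineM//.
rewrite fin_numM// fin_num_measure//.
by apply: Ymeas => //; rewrite /t'.
Qed.

Variable r : R -> R.
Hypothesis rE : forall t x, 0 <= t -> x \in [:: -1; 1] ->
  p t x 1 - p t x (-1) = x * r t.

(** A weak form of E[Y_t | past of s] = r(t - s) Y_s. On a cylinder the state [x] at time [s] is
    known, and the conditional mean of [Y t] is p x 1 - p x (-1) = x r(t - s). *)
Lemma finite_past_markov s t f : 0 <= s -> s <= t -> finite_past s f ->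
  mean P (fun w => f w * Y t w) = r (t - s) * mean P (fun w => f w * Y s w).
Proof.
move=> s0 st /(finite_past_decomposition s0)[n [u [v [u0 um un fE]]]].
have bc c : bounded_rv (\1_(cyl u c) : T -> R) by apply: bounded_rv_indic; exact: measurable_cyl.
have bY x : 0 <= x -> bounded_rv (Y x).
  by move=> x0; apply: (@finite_past_bounded_rv x) => //; apply: finite_past_eval; rewrite x0 lexx.
have meanE x : 0 <= x -> mean P (fun w => f w * Y x w) =
    \sum_c v c * mean P (fun w => \1_(cyl u c) w * Y x w).
  move=> x0; rewrite -(eq_mean P (f := fun w => \sum_c v c * (\1_(cyl u c) w * Y x w))).
    rewrite mean_sum; first by apply: eq_bigr => c _; rewrite meanZ//; apply: bounded_rvM; [exact: bc|exact: bY].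
    move=> c _; apply: bounded_rvM; first exact: bounded_rv_cst.
    apply: bounded_rvM; [exact: bc|exact: bY].
  by move=> w; rewrite fE mulr_suml; apply: eq_bigr => c _; rewrite mulrA.
have t0 : 0 <= t by rewrite (le_trans s0).
rewrite !meanE// mulr_sumr; apply: eq_bigr => c _; rewrite mulrCA; congr (_ * _).
rewrite -(eq_mean P (f := fun w => \1_(cyl u c `&` [set w | Y t w = 1]) w -
   \1_(cyl u c `&` [set w | Y t w = -1]) w)); last first.
  move=> w; rewrite !indicE !in_setI; case: (w \in cyl u c); rewrite /= ?mul0r ?subrr// mul1r.
  have := Ysign w t0; rewrite !inE => /orP[|] /eqP Yw.
    rewrite (_ : (w \in [set w | Y t w = 1]) = false); last first.
      by apply/negP; rewrite inE /= Yw; lra.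
    by rewrite mem_set//= Yw sub0r.
  rewrite (_ : (w \in [set w | Y t w = -1]) = false); last first.
    by apply/negP; rewrite inE /= Yw; lra.
  by rewrite mem_set//= Yw subr0.
have m1 : (1 : R) \in [:: -1; 1 : R] by rewrite !inE eqxx orbT.
have mN1 : (-1 : R) \in [:: -1; 1 : R] by rewrite !inE eqxx.
have mI y : y \in [:: -1; 1] -> measurable (cyl u c `&` [set w | Y t w = y]).
  by move=> yE; apply: measurableI; [exact: measurable_cyl|exact: Ymeas].
rewrite meanB ?mean_indic ?markov_cyl ?un//; first last.
- by apply: bounded_rv_indic; exact: mI.
- by apply: bounded_rv_indic; exact: mI.
- exact: mI.
- exact: mI.
rewrite -mulrBr rE ?subr_ge0//.
rewrite (eq_mean P (g := fun w => \1_(cyl u c) w * sg (c (inord n)))); last first.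
  move=> w; rewrite indicE; case: (boolP (w \in _)); rewrite ?mul0r//.
  by rewrite inE !mul1r => /(_ n); rewrite /= un => ->.
rewrite meanZr// mean_indic; last exact: measurable_cyl.
by ring.
Qed.

End finite_past.

(** * Moments of a persistent random walk *)

Section persistent_walk.
Context {R : realType} d (T : measurableType d) (P : probability T R).
Local Notation E := (mean P).
Variables (xi : nat -> T -> R) (f : T -> R) (r M : R).
Hypothesis bxi : forall n, bounded_rv (xi n).
Hypothesis xi2 : forall n w, xi n w ^+ 2 = 1.
Hypothesis bf : bounded_rv f.
Hypothesis r01 : 0 <= r < 1.

(** A correlated walk with steps 1 and -1, each step having conditional mean [r] times the preceding
    one. The sum starts at [xi 1]; [xi 0] is the initial sign, to which [markov] refers for
    [n = 0]. *)
Definition walk (n : nat) (w : T) : R := \sum_(i < n) xi i.+1 w.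
Local Notation S := walk.

Hypothesis markov : forall q n, E (fun w => f w * S n w ^+ q * xi n.+1 w) =
  r * E (fun w => f w * S n w ^+ q * xi n w).

Let SS n w : S n.+1 w = S n w + xi n.+1 w.
Proof. by rewrite /S big_ord_recr. Qed.

Let bS n : bounded_rv (S n).
Proof. by apply: bounded_rv_sum => i _; exact: bxi. Qed.

Let bfS q n : bounded_rv (fun w => f w * S n w ^+ q).
Proof. by apply: bounded_rvM => //; apply: bounded_rvX. Qed.

Let bfSx q n m : bounded_rv (fun w => f w * S n w ^+ q * xi m w).
Proof. by apply: bounded_rvM. Qed.

Let A := E (fun w => f w * xi 0%N w).

Let EfSx0 n : E (fun w => f w * S n w ^+ 0 * xi n w) = r ^+ n * A.
Proof.
elim: n => [|n IH]; first by rewrite mul1r; apply: eq_mean => w; rewrite mulr1.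
rewrite exprS -mulrA -IH -markov; apply: eq_mean => w; by rewrite !expr0.
Qed.

(** E(f xi_n) is r^n E(f xi_0), so the mean is a geometric sum, whose denominator is cleared by the
    factor 1 - r. *)
Lemma walk_mean1 n : (1 - r) * E (fun w => f w * S n w) = r * (1 - r ^+ n) * A.
Proof.
elim: n => [|n IH].
  rewrite (@eq_mean _ _ _ P _ (fun=> 0)) => [|w]; last by rewrite /S big_ord0 mulr0.
  by rewrite mean_cst expr0; ring.
have -> : E (fun w => f w * S n.+1 w) = E (fun w => f w * S n w) +
    E (fun w => f w * S n w ^+ 0 * xi n.+1 w).
  rewrite -meanD//; last by apply: bounded_rvM.
  by apply: eq_mean => w; rewrite SS expr0; ring.
by rewrite mulrDr IH markov EfSx0 exprS; ring.
Qed.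

(** Since the steps have square 1, expanding S n.+1 = S n + xi n.+1 closes on a few mixed moments:
    [B], [V], [D] and [Q], of degrees 1, 2, 3 and 4 in [S], satisfy a triangular linear
    recursion. *)
Let B n := E (fun w => f w * S n w ^+ 1 * xi n w).

Let BS n : B n.+1 = r * B n + E f.
Proof.
rewrite /B -markov -meanD//; apply: eq_mean => w; rewrite SS.
transitivity (f w * (S n w * xi n.+1 w + xi n.+1 w ^+ 2)).
  by ring.
by rewrite xi2; ring.
Qed.

Let B0 : B 0%N = 0.
Proof.
rewrite /B (@eq_mean _ _ _ P _ (fun=> 0)) => [|w]; first exact: mean_cst.
by rewrite /S big_ord0; ring.
Qed.

Let BE n : (1 - r) * B n = E f * (1 - r ^+ n).
Proof.
elim: n => [|n IH]; first by rewrite B0 expr0; ring.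
by rewrite BS mulrDr mulrCA IH exprS; ring.
Qed.

Let V n := E (fun w => f w * S n w ^+ 2).

Let VS n : V n.+1 = V n + 2 * r * B n + E f.
Proof.
rewrite /V -mulrA /B -markov -meanZ// -!meanD; try bounded_rv_tac.
apply: eq_mean => w; rewrite SS.
transitivity (f w * (S n w ^+ 2 + 2 * S n w * xi n.+1 w + xi n.+1 w ^+ 2)).
  by ring.
by rewrite xi2; ring.
Qed.

Let V0 : V 0%N = 0.
Proof.
rewrite /V (@eq_mean _ _ _ P _ (fun=> 0)) => [|w]; first exact: mean_cst.
by rewrite /S big_ord0; ring.
Qed.

Lemma walk_mean2 n : (1 - r) ^+ 2 * E (fun w => f w * S n w ^+ 2) =
  E f * (n%:R * (1 - r ^+ 2) - 2 * r * (1 - r ^+ n)).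
Proof.
rewrite -/(V n); elim: n => [|n IH]; first by rewrite V0 expr0; ring.
rewrite VS [LHS]mulrDr [X in X + _]mulrDr IH.
have -> : (1 - r) ^+ 2 * (2 * r * B n) = 2 * r * (1 - r) * (E f * (1 - r ^+ n)).
  by rewrite -BE; ring.
by rewrite [r ^+ n.+1]exprS -natr1; ring.
Qed.

Let D n := E (fun w => f w * S n w ^+ 3 * xi n w).

Let DS n : D n.+1 = r * D n + 3 * V n + 3 * r * B n + E f.
Proof.
rewrite /D /V -[3 * r * _]mulrA /B -!markov -!meanZ -?meanD; try bounded_rv_tac.
apply: eq_mean => w; rewrite SS.
  transitivity (f w * (S n w ^+ 3 * xi n.+1 w + 3 * S n w ^+ 2 * (xi n.+1 w ^+ 2) +
    3 * S n w * xi n.+1 w * (xi n.+1 w ^+ 2) + (xi n.+1 w ^+ 2) ^+ 2)); first by ring.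
by rewrite xi2; ring.
Qed.

Let Q n := E (fun w => f w * S n w ^+ 4).

Let QS n : Q n.+1 = Q n + 4 * r * D n + 6 * V n + 4 * r * B n + E f.
Proof.
rewrite /Q -[4 * r * D n]mulrA /D /V -[4 * r * _]mulrA /B -!markov -!meanZ -?meanD; try bounded_rv_tac.
apply: eq_mean => w; rewrite SS.
  transitivity (f w * (S n w ^+ 4 + 4 * (S n w ^+ 3 * xi n.+1 w) + 6 * S n w ^+ 2 * (xi n.+1 w ^+ 2) +
    4 * S n w * xi n.+1 w * (xi n.+1 w ^+ 2) + (xi n.+1 w ^+ 2) ^+ 2)); first by ring.
by rewrite xi2; ring.
Qed.

(** With K = 1 / (1 - r), the moments [B], [V], [D], [Q] are bounded in turn by K, 3nK, 9nK^2 and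
    27n^2K^2. The increment of [Q] is at most 36nK^2 + 18nK + 4K + 1, which 27((n + 1)^2 - n^2)K^2 =
    (54n + 27)K^2 absorbs. *)
Lemma walk_mean4 n : E f = 1 ->
  (1 - r) ^+ 2 * E (fun w => f w * S n w ^+ 4) <= 27 * n%:R ^+ 2.
Proof.
move=> Ef1; pose K := (1 - r)^-1.
have r1 : 0 < 1 - r by case/andP: r01; lra.
have K1 : 1 <= K.
  by rewrite /K -[leLHS]invr1 lef_pV2 ?posrE//; case/andP: r01; lra.
have rK : r * K = K - 1 by rewrite /K; field; apply/eqP; lra.
have r0 : 0 <= r by case/andP: r01.
have rn m : 0 <= r ^+ m <= 1.
  by rewrite exprn_ge0//= exprn_ile1//; case/andP: r01; lra.
have BK m : 0 <= B m <= K.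
  have -> : B m = K * (1 - r ^+ m).
    have := BE m; rewrite Ef1 mul1r => <-; rewrite /K mulrA mulVf ?mul1r//.
    by apply/eqP; lra.
  have /andP[? ?] := rn m; apply/andP; split; nra.
have r1' : r < 1 by case/andP: r01.
have VK m : V m <= 3 * m%:R * K.
  elim: m => [|m IH]; first by rewrite V0; nra.
  rewrite VS Ef1 -[m.+1%:R]natr1; have /andP[? ?] := BK m; nra.
have DK m : D m <= 9 * m%:R * K ^+ 2.
  elim: m => [|m IH].
    rewrite /D (@eq_mean _ _ _ P _ (fun=> 0)) => [|w]; last by rewrite /S big_ord0; ring.
    by rewrite mean_cst; nra.
  rewrite DS Ef1 -[m.+1%:R]natr1; have /andP[? ?] := BK m; have := VK m.
  have m0 : 0 <= m%:R :> R by [].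
  have : r * D m <= 9 * m%:R * K * (K - 1).
    have -> : 9 * m%:R * K * (K - 1) = r * (9 * m%:R * K ^+ 2) by rewrite -rK; ring.
    exact: ler_wpM2l.
  have : r * B m <= B m by nra.
  nra.
have QK m : Q m <= 27 * m%:R ^+ 2 * K ^+ 2.
  elim: m => [|m IH].
    rewrite /Q (@eq_mean _ _ _ P _ (fun=> 0)) => [|w]; last by rewrite /S big_ord0; ring.
    by rewrite mean_cst; nra.
  rewrite QS Ef1 -[m.+1%:R]natr1; have /andP[? ?] := BK m; have := VK m.
  have m0 : 0 <= m%:R :> R by [].
  have rD : r * D m <= 9 * m%:R * K ^+ 2.
    apply: (le_trans (ler_wpM2l r0 (DK m))).
    apply: ler_piMl; last exact: ltW.
    by rewrite mulr_ge0 ?sqr_ge0// mulr_ge0.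
  have rB : r * B m <= B m by nra.
  have KK : K <= K ^+ 2 by nra.
  have mK : m%:R * K <= m%:R * K ^+ 2 by rewrite ler_wpM2l.
  have -> : 27 * (m%:R + 1) ^+ 2 * K ^+ 2 = 27 * m%:R ^+ 2 * K ^+ 2 +
    54 * (m%:R * K ^+ 2) + 27 * K ^+ 2 by ring.
  move: IH rD rB mK KK; lra.
have := QK n; rewrite -/(Q n) => h.
have -> : 27 * n%:R ^+ 2 = (1 - r) ^+ 2 * (27 * n%:R ^+ 2 * K ^+ 2).
  by rewrite /K; field; apply/eqP; lra.
by rewrite ler_wpM2l// sqr_ge0.
Qed.

End persistent_walk.

(** * Riemann sums of right-continuous functions *)

Section right_riemann_sum.
Context {R : realType}.
Notation mu := (@lebesgue_measure R).
Variables (y : R -> R) (s t M : R).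
Hypothesis st : s < t.
Hypothesis yM : forall u, s <= u -> `|y u| <= M.
Hypothesis y_right : forall u, s <= u -> y v @[v --> u^'+] --> y u.

Let h (N : nat) : R := (t - s) / N.+1%:R.
Let grid N (i : nat) : R := s + i%:R * h N.
Let step N (u : R) : R :=
  \sum_(i < N.+1) y (grid N i.+1) * \1_`]grid N i, grid N i.+1] u.

Let h_gt0 N : 0 < h N.
Proof. by rewrite divr_gt0// subr_gt0. Qed.

Let gridM N i j : (i <= j)%N -> grid N i <= grid N j.
Proof. by move=> ij; rewrite lerD2l ler_wpM2r ?ler_nat// ltW. Qed.

Let gridN N : grid N N.+1 = t.
Proof. by rewrite /grid /h mulrC divfK ?pnatr_eq0// addrC subrK. Qed.

Let grid_ge N i : s <= grid N i.
Proof. by rewrite lerDl mulr_ge0// ltW. Qed.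

Let step_eval N u : s < u <= t -> exists2 v, u <= v <= u + h N & step N u = y v.
Proof.
move=> /andP[su ut].
have ex : exists i, u <= grid N i.+1 by exists N; rewrite gridN.
case: (ex_minnP ex) => i ui imin.
have iN : (i < N.+1)%N by rewrite ltnS; apply: imin; rewrite gridN.
have iu : grid N i < u.
  case: i ui imin iN => [|i] ui imin iN; first by rewrite /grid mul0r addr0.
  by rewrite ltNge; apply/negP => /imin; rewrite ltnn.
exists (grid N i.+1).
  by rewrite ui/= /grid -natr1 mulrDl mul1r addrA lerD2r ltW.
rewrite /step (bigD1 (Ordinal iN))//= big1 ?addr0.
  by rewrite indicE mem_set ?mulr1//= in_itv/= iu ui.
move=> j; rewrite -val_eqE/= => ji; rewrite indicE memNset ?mulr0//=.
rewrite in_itv/= => /andP[ju uj].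
have [ij|ij|/eqP ij] := ltngtP j i; last by rewrite (negbTE ji) in ij.
  by have := le_lt_trans uj (le_lt_trans (gridM N ij) iu); rewrite ltxx.
by have := lt_le_trans ju (le_trans ui (gridM N ij)); rewrite ltxx.
Qed.

Let step_measurable N D : measurable_fun D (step N).
Proof.
apply: measurable_sum => i; apply: measurable_funM => //; exact: measurable_indic.
Qed.

Let step_cvg u : s < u <= t -> step N u @[N --> \oo] --> y u.
Proof.
move=> sut; have su : s <= u by case/andP: sut => /ltW.
apply/cvgrPdist_lt => e e0.
have /cvgrPdist_lt/(_ e e0)[/= de de0 ye] := y_right su.
near=> N; have [v /andP[uv vu] ->] := step_eval N sut.
(* A right neighbourhood of [u] leaves out [u] itself, which is the value taken when [u] is a grid
   point. *)
move: uv; rewrite le_eqVlt => /predU1P[<-|uv]; first by rewrite subrr normr0.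
apply: ye => //=; rewrite ltr0_norm ?subr_lt0// opprB ltrBlDl.
apply: (le_lt_trans vu); rewrite ltrD2l /h.
rewrite ltr_pdivrMr// -ltr_pdivrMl//.
have Nd : de^-1 * (t - s) < N%:R by near: N; exact: nbhs_infty_gtr.
by rewrite (lt_trans Nd)// ltr_nat.
Unshelve. all: by end_near. Qed.

Let step_le N u : s < u <= t -> `|step N u| <= M.
Proof.
move=> sut; have [v /andP[uv _] ->] := step_eval N sut; apply: yM.
by case/andP: sut => su _; rewrite (le_trans (ltW su)).
Qed.

Let mu_fin : (mu `]s, t] < +oo)%E.
Proof. by rewrite lebesgue_measure_itv/= lte_fin st -EFinB ltry. Qed.

Let integral_step N : (\int[mu]_(u in `]s, t]) (step N u)%:E =
  (h N * \sum_(i < N.+1) y (grid N i.+1))%:E)%E.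
Proof.
rewrite mulr_sumr.
have intI i : mu.-integrable `]s, t] (fun u => (y (grid N i.+1) * \1_`]grid N i, grid N i.+1] u)%:E).
  apply: measurable_bounded_integrable => //.
  - by apply: measurable_funM => //; exact: measurable_indic.
  - exists `|y (grid N i.+1)|; split=> [|x Mx u _ /=]; first exact: num_real.
    rewrite normrM (le_trans _ (ltW Mx))// ler_piMr// indicE.
    by case: (_ \in _); rewrite ?normr1 ?normr0.
under eq_integral do rewrite -sumEFin.
rewrite integral_sum// -sumEFin; apply: eq_bigr => i _.
under eq_integral do rewrite EFinM.
rewrite integralZl//; last first.
  apply: measurable_bounded_integrable => //.
  - exists 1; split=> [|x Mx u _ /=]; first exact: num_real.
    rewrite (le_trans _ (ltW Mx))// indicE.
    by case: (_ \in _); rewrite ?normr1 ?normr0.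
rewrite integral_indic// setIidl; last first.
  apply: subset_itv; rewrite bnd_simp ?grid_ge//.
  by rewrite -(gridN N) gridM.
rewrite [X in (_ * X)%E]lebesgue_measure_itv/= lte_fin ifT.
  rewrite -EFinB -EFinM mulrC; congr (_ * _)%:E.
  by rewrite /grid -natr1; ring.
by rewrite /grid ltrD2l ltr_pM2r// ltr_nat.
Qed.

(** The sums use right endpoints: the one chosen for [u] lies in [u, u + h], so right continuity
    suffices for the step functions to converge pointwise. This also yields the measurability of
    [y], and boundedness allows dominated convergence. *)
Lemma right_riemann_sum_cvg :
  mu.-integrable `[s, t] (EFin \o y) /\
  (t - s) / N.+1%:R * \sum_(i < N.+1) y (s + i.+1%:R * ((t - s) / N.+1%:R))
    @[N --> \oo] --> \int[mu]_(u in `[s, t]) y u.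
Proof.
have my : measurable_fun `]s, t] y.
  apply: (@measurable_fun_cvg _ _ _ _ step) => [N|u]; first exact: step_measurable.
  by rewrite /= in_itv/=; exact: step_cvg.
have mst N : measurable_fun `]s, t] (EFin \o step N).
  by apply/measurable_EFinP; exact: step_measurable.
have mEy : measurable_fun `]s, t] (EFin \o y) by exact/measurable_EFinP.
have cv : {ae mu, forall u, `]s, t]%classic u -> (EFin \o step N) u @[N --> \oo] --> (EFin \o y) u}.
  apply: aeW => u /=; rewrite in_itv/= => su.
  by apply: cvg_EFin; [exact: nearW|exact: step_cvg].
have iM : mu.-integrable `]s, t] (EFin \o cst M).
  apply: measurable_bounded_integrable => //.
  - exists `|M|; split=> [|x Mx u _ /=]; first exact: num_real.
    exact: ltW.
have bd : {ae mu, forall u N, `]s, t]%classic u -> (`|(EFin \o step N) u| <= (EFin \o cst M) u)%E}.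
  apply: aeW => u N /=; rewrite in_itv/= => su.
  by rewrite lee_fin; exact: step_le.
have [iy _ dc] := @dominated_convergence _ _ R mu _ (measurable_itv `]s, t])
  _ _ _ mst mEy cv iM bd.
split.
  apply: measurable_bounded_integrable => //.
  - by rewrite /= lebesgue_measure_itv/= lte_fin st -EFinB ltry.
  - by apply/measurable_fun_itv_obnd_cbndP.
  - exists M; split=> [|x Mx u /=]; first exact: num_real.
    by rewrite in_itv/= => /andP[su _]; rewrite (le_trans (yM su))// ltW.
rewrite -Rintegral_itv_obnd_cbnd//.
have -> : (fun N => (t - s) / N.+1%:R *
    \sum_(i < N.+1) y (s + i.+1%:R * ((t - s) / N.+1%:R))) =
    (fun N => fine (\int[mu]_(u in `]s, t]) (step N u)%:E)%E).
  by apply/funext => N; rewrite integral_step.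
apply: fine_cvg.
rewrite /Rintegral fineK; first exact: dc.
exact: integrable_fin_num.
Qed.

End right_riemann_sum.

(** * Functions of the past and moments of the integrated chain *)

Section past.
Context {R : realType} d (T : measurableType d) (P : probability T R).
Variables (a : R) (Y : R -> T -> R).
Hypotheses (a0 : 0 < a) (chainY : sign_chain P a Y).
Local Notation E := (mean P).
Implicit Types (s t M : R) (f g : T -> R).

(* Bounded pointwise limits of functions of finitely many [Y u] with [u <= s]:
   a substitute for measurability with respect to the past of [s]. *)
Definition past (s : R) (f : T -> R) :=
  exists (u : nat -> T -> R) (M : R),
  [/\ forall n, finite_past Y s (u n), forall n w, `|u n w| <= M &
      forall w, u n w @[n --> \oo] --> f w].

Lemma chain_sign t w : 0 <= t -> Y t w \in [:: -1; 1].
Proof. by case: chainY => + _ _ _ => /[apply]. Qed.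

Lemma chain_sqr t w : 0 <= t -> Y t w ^+ 2 = 1.
Proof.
by move=> /(chain_sign w); rewrite !inE => /orP[|] /eqP ->; rewrite ?sqrrN expr1n.
Qed.

Lemma chain_norm t w : 0 <= t -> `|Y t w| = 1.
Proof.
by move=> /(chain_sign w); rewrite !inE => /orP[|] /eqP ->; rewrite ?normrN normr1.
Qed.

Lemma finite_past_rv s f : 0 <= s -> finite_past Y s f -> bounded_rv f.
Proof.
by case: chainY => Ymem Ymeas _ _ s0; apply: finite_past_bounded_rv.
Qed.

Lemma sign_chain_markov : exists r : R -> R,
  [/\ forall t, 0 <= t -> 0 <= r t <= 1,
      (1 - r h) / h @[h --> 0^'+] --> 2 * a &
      forall s t f, 0 <= s -> s <= t -> finite_past Y s f ->
        E (fun w => f w * Y t w) = r (t - s) * E (fun w => f w * Y s w)].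
Proof.
case: chainY => Ymem Ymeas _ [p sp pE].
have [r [r01 rr rE]] := sign_chain_eigenvalue a0 sp.
by exists r; split => // s t f; apply: (@finite_past_markov _ _ _ _ _ _ _ p).
Qed.

Lemma past_rv s f : 0 <= s -> past s f -> bounded_rv f.
Proof.
move=> s0 [u [M [fu uM uf]]]; apply: (bounded_rv_cvg _ uM uf) => n.
by apply: bounded_rv_measurable; exact: (finite_past_rv s0).
Qed.

Lemma past_finite s f : 0 <= s -> finite_past Y s f -> past s f.
Proof.
move=> s0 pf; have [_ [M fM]] := finite_past_rv s0 pf.
by exists (fun=> f), M; split => // w; exact: cvg_cst.
Qed.

Lemma past_le s s' f : s <= s' -> past s f -> past s' f.
Proof.
move=> ss' [u [M [fu uM uf]]]; exists u, M; split => // n.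
exact: (finite_past_le ss').
Qed.

Lemma pastM s f g : past s f -> past s g -> past s (fun w => f w * g w).
Proof.
move=> [u [M [fu uM uf]]] [v [N [gv vN vg]]].
exists (fun n w => u n w * v n w), (M * N); split.
- by move=> n; apply: (finite_past_comp2 *%R).
- by move=> n w; rewrite normrM ler_pM.
- by move=> w; apply: cvgM.
Qed.

Lemma pastX s f n : past s f -> past s (fun w => f w ^+ n).
Proof.
move=> [u [M [fu uM uf]]]; exists (fun k w => u k w ^+ n), (M ^+ n); split.
- by move=> k; apply: (finite_past_comp (fun x => x ^+ n)).
- by move=> k w; rewrite normrX lerXn2r// nnegrE// (le_trans _ (uM k w)).
- by move=> w; exact: cvg_pow.
Qed.

Lemma past_comp (h : R -> R) (M s : R) (u : nat -> T -> R) (f : T -> R) :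
  continuous h -> (forall x, `|h x| <= M) ->
  (forall n, finite_past Y s (u n)) ->
  (forall w, u n w @[n --> \oo] --> f w) -> past s (fun w => h (f w)).
Proof.
move=> ch hM fu uf; exists (fun n w => h (u n w)), M; split => //.
- by move=> n; apply: finite_past_comp.
- by move=> w; apply: continuous_cvg; [exact: ch|exact: uf].
Qed.

Lemma past_markov (r : R -> R) s t f : 0 <= s -> s <= t ->
  (forall g, finite_past Y s g ->
     E (fun w => g w * Y t w) = r (t - s) * E (fun w => g w * Y s w)) ->
  past s f ->
  E (fun w => f w * Y t w) = r (t - s) * E (fun w => f w * Y s w).
Proof.
move=> s0 st rE [u [M [fu uM uf]]].
have t0 : 0 <= t by rewrite (le_trans s0).
have bY x : 0 <= x -> bounded_rv (Y x).
  by move=> x0; apply: (@finite_past_rv x) => //; apply: finite_past_eval; rewrite x0 lexx.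
have bu n : bounded_rv (u n) by apply: (finite_past_rv s0).
have cv x : 0 <= x -> E (fun w => u n w * Y x w) @[n --> \oo] --> E (fun w => f w * Y x w).
  move=> x0; apply: (@mean_cvg _ _ _ _ (fun n w => u n w * Y x w) _ M).
  - by move=> n; apply: bounded_rv_measurable; apply: bounded_rvM => //; exact: bY.
  - by move=> n w; rewrite normrM chain_norm// mulr1.
  - by move=> w; apply: cvgM => //; exact: cvg_cst.
have ct := cv t t0.
have e : (fun n => E (fun w => u n w * Y t w)) =
    (fun n => r (t - s) * E (fun w => u n w * Y s w)).
  by apply/funext => n; exact: rE.
rewrite e in ct; apply: (cvg_unique _ ct) => //.
by apply: cvgM; [exact: cvg_cst|exact: cv].
Qed.

Definition Yint (s t : R) (w : T) : R := \int[lebesgue_measure]_(u in `[s, t]) Y u w.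

Definition Yriemann (s t : R) (N : nat) (w : T) : R :=
  (t - s) / N.+1%:R * \sum_(i < N.+1) Y (s + i.+1%:R * ((t - s) / N.+1%:R)) w.

Let Y_right w u : 0 <= u -> Y v w @[v --> u^'+] --> Y u w.
Proof.
case: chainY => _ _ + _ u0 => /(_ u w u0) Yu.
apply/cvgrPdist_lt => e e0; near=> v.
rewrite (_ : Y v w = Y u w) ?subrr ?normr0//; near: v; exact: Yu.
Unshelve. all: by end_near. Qed.

Lemma Yriemann_cvg s t w : 0 <= s -> s < t ->
  Yriemann s t N w @[N --> \oo] --> Yint s t w.
Proof.
move=> s0 st.
have yM u : s <= u -> `|Y u w| <= 1.
  by move=> su; rewrite chain_norm// (le_trans s0).
have yr u : s <= u -> Y v w @[v --> u^'+] --> Y u w.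
  by move=> su; apply: Y_right; rewrite (le_trans s0).
by case: (right_riemann_sum_cvg st yM yr).
Qed.

Lemma Yint_integrable s t w : 0 <= s -> s < t ->
  lebesgue_measure.-integrable `[s, t] (EFin \o Y ^~ w).
Proof.
move=> s0 st.
have yM u : s <= u -> `|Y u w| <= 1.
  by move=> su; rewrite chain_norm// (le_trans s0).
have yr u : s <= u -> Y v w @[v --> u^'+] --> Y u w.
  by move=> su; apply: Y_right; rewrite (le_trans s0).
by case: (right_riemann_sum_cvg st yM yr).
Qed.

Lemma Yriemann_past s t N : 0 <= s -> s <= t -> finite_past Y t (Yriemann s t N).
Proof.
move=> s0 st; apply: (finite_past_comp (fun x => _ * x)).
apply: finite_past_sum => i; apply: finite_past_eval; apply/andP; split.
  by rewrite addr_ge0// mulr_ge0// divr_ge0// subr_ge0.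
rewrite -lerBrDl mulrA ler_pdivrMr ?ltr0n// mulrC.
by rewrite ler_wpM2l ?subr_ge0// ler_nat.
Qed.

Lemma Yriemann_bound s t N w : 0 <= s -> s <= t -> `|Yriemann s t N w| <= t - s.
Proof.
move=> s0 st; rewrite normrM ger0_norm ?divr_ge0 ?subr_ge0//.
rewrite mulrAC ler_pdivrMr ?ltr0n//; apply: ler_wpM2l; first by rewrite subr_ge0.
apply: (le_trans (ler_norm_sum _ _ _)).
rewrite (eq_bigr (fun=> 1)).
  by rewrite sumr_const card_ord.
by move=> i _; rewrite chain_norm// addr_ge0// mulr_ge0// divr_ge0// subr_ge0.
Qed.

Lemma Yint_bound s t w : 0 <= s -> s < t -> `|Yint s t w| <= t - s.
Proof.
move=> s0 st.
have h : `|Yriemann s t N w| @[N --> \oo] --> `|Yint s t w|.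
  by apply: cvg_norm; exact: Yriemann_cvg.
apply: (cvgr_to_le h).
by near=> N; apply: Yriemann_bound => //; exact: ltW.
Unshelve. all: by end_near. Qed.

Lemma Yint_past s t : 0 <= s -> s < t -> past t (Yint s t).
Proof.
move=> s0 st; exists (Yriemann s t), (t - s); split.
- by move=> n; apply: Yriemann_past => //; exact: ltW.
- by move=> n w; apply: Yriemann_bound => //; exact: ltW.
- by move=> w; exact: Yriemann_cvg.
Qed.

Lemma Yint_rv s t : 0 <= s -> s < t -> bounded_rv (Yint s t).
Proof.
by move=> s0 st; apply: (@past_rv t); [rewrite (le_trans s0)// ltW|exact: Yint_past].
Qed.

(** The Riemann sums of the integral are [h] times persistent walks of correlation r(h), and (1 - r
    h) / h tends to 2a, so the exact moments of the walks pass to the limit. In conditional terms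
    the integral over [s, t] has mean O(1/a), second moment (t - s)/a + O(1/a^2) and fourth moment
    O((t - s)^2/a^2). *)
Lemma Yint_moments s t f M : 0 <= s -> s < t -> past s f -> (forall w, `|f w| <= M) ->
  [/\ 2 * a * `|E (fun w => f w * Yint s t w)| <= M,
      `|4 * a ^+ 2 * E (fun w => f w * Yint s t w ^+ 2) - 4 * a * (t - s) * E f|
        <= 2 * M &
      4 * a ^+ 2 * E (fun w => Yint s t w ^+ 4) <= 27 * (t - s) ^+ 2].
Proof.
move=> s0 st pf fM.
have [r [r01 rr rm]] := sign_chain_markov.
have ts0 : 0 < t - s by rewrite subr_gt0.
have bf : bounded_rv f := past_rv s0 pf.
pose h N : R := (t - s) / N.+1%:R.
have h0 N : 0 < h N by rewrite divr_gt0.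
have hcvg : h N @[N --> \oo] --> 0.
  rewrite -(mulr0 (t - s)); apply: cvgM; first exact: cvg_cst.
  by apply: (@cvg_harmonic R).
have hr : (1 - r (h N)) / h N @[N --> \oo] --> 2 * a.
  have : h N @[N --> \oo] --> 0^'+.
    apply: (cvg_trans _ _) => //.
    move=> A [e /= e0 eA]; have /cvgrPdist_lt/(_ e e0) := hcvg.
    by apply: filterS => N he; apply: eA.
  by move=> h'; apply: (cvg_comp _ _ h' rr).
have r1 : r (h N) @[N --> \oo] --> (1 : R).
  rewrite (_ : (fun N => r (h N)) = (fun N => 1 - (1 - r (h N)) / h N * h N)).
    by rewrite -[X in _ --> X]subr0 -(mulr0 (2 * a)); apply: cvgB; [exact: cvg_cst|exact: cvgM].
  by apply/funext => N; rewrite divfK ?gt_eqF// opprB addrC subrK.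
pose xi N i := Y (s + i%:R * h N).
have pos N i : 0 <= s + i%:R * h N by rewrite addr_ge0// mulr_ge0// ltW.
have pastY x : 0 <= x -> past x (Y x).
  by move=> x0; apply: past_finite => //; apply: finite_past_eval; rewrite x0 lexx.
have bxi N i : bounded_rv (xi N i) by apply: (past_rv (pos N i)); exact: pastY.
have xi2 N i w : xi N i w ^+ 2 = 1 by exact: chain_sqr.
have pastS N n : past (s + n%:R * h N) (walk (xi N) n).
  apply: past_finite => //; apply: finite_past_sum => i; apply: finite_past_eval.
  by rewrite pos/= lerD2l ler_wpM2r ?ler_nat// ltW.
have step N i : s + i.+1%:R * h N - (s + i%:R * h N) = h N.
  by rewrite -natr1; ring.
have mk (g : T -> R) N : past s g -> forall q n,
    E (fun w => g w * walk (xi N) n w ^+ q * xi N n.+1 w) =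
    r (h N) * E (fun w => g w * walk (xi N) n w ^+ q * xi N n w).
  move=> pg q n.
  have -> : r (h N) = r (s + n.+1%:R * h N - (s + n%:R * h N)) by rewrite step.
  apply: past_markov => //.
  - by rewrite lerD2l ler_wpM2r ?ler_nat// ltW.
  - by move=> g' pg'; apply: rm => //; rewrite lerD2l ler_wpM2r ?ler_nat// ltW.
  apply: pastM; last exact: pastX.
  by apply: past_le pg; rewrite lerDl mulr_ge0// ltW.
have RE N w : Yriemann s t N w = h N * walk (xi N) N.+1 w by [].
have mR N : measurable_fun setT (Yriemann s t N).
  apply: bounded_rv_measurable; apply: (@finite_past_rv t).
    by rewrite (le_trans s0)// ltW.
  by apply: Yriemann_past => //; exact: ltW.
have bR N : bounded_rv (Yriemann s t N).
  by split=> //; exists (t - s) => w; apply: Yriemann_bound => //; exact: ltW.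
have cvR (g : T -> R) q : bounded_rv g ->
    E (fun w => g w * Yriemann s t N w ^+ q) @[N --> \oo] --> E (fun w => g w * Yint s t w ^+ q).
  move=> bg; have [mg [B gB]] := bg.
  apply: (@mean_cvg _ _ _ _ (fun N w => g w * Yriemann s t N w ^+ q) _ (B * (t - s) ^+ q)).
  - by move=> N; apply: bounded_rv_measurable; bounded_rv_tac.
  - move=> N w; rewrite normrM normrX ler_pM ?exprn_ge0// lerXn2r ?nnegrE ?subr_ge0//; last first.
      by apply: Yriemann_bound => //; exact: ltW.
    exact: ltW.
  - move=> w; apply: cvgM; first exact: cvg_cst.
    by apply: cvg_pow; exact: Yriemann_cvg.
have bSq N n q : bounded_rv (fun w => f w * walk (xi N) n w ^+ q).
  apply: bounded_rvM => //; apply: bounded_rvX; apply: (past_rv (pos N n)); exact: pastS.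
have Eq (g : T -> R) N q : bounded_rv g ->
    E (fun w => g w * Yriemann s t N w ^+ q) = h N ^+ q * E (fun w => g w * walk (xi N) N.+1 w ^+ q).
  move=> bg; rewrite -meanZ.
    by apply: eq_mean => w; rewrite RE exprMn mulrCA.
  apply: bounded_rvM => //; apply: bounded_rvX; apply: (past_rv (pos N N.+1)); exact: pastS.
have nh N : N.+1%:R * h N = t - s by rewrite /h mulrC divfK// pnatr_eq0.
have rh0 N : 0 <= r (h N) <= 1 by apply: r01; exact: ltW.
have rn N n : 0 <= r (h N) ^+ n <= 1.
  by have /andP[? ?] := rh0 N; rewrite exprn_ge0//= exprn_ile1.
(* A Riemann sum is h times the walk, so the factor (1 - r h) / h becomes the 1 - r of the walk
   identity. What remains, r (1 - r^n) E(f xi_0), is at most [M] in absolute value. The other two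
   moments follow the same pattern. *)
have lim1 : 2 * a * `|E (fun w => f w * Yint s t w ^+ 1)| <= M.
  have c : `|(1 - r (h N)) / h N * E (fun w => f w * Yriemann s t N w ^+ 1)| @[N --> \oo]
      --> `|2 * a * E (fun w => f w * Yint s t w ^+ 1)|.
    by apply: cvg_norm; apply: cvgM => //; exact: cvR.
  have -> : 2 * a * `|E (fun w => f w * Yint s t w ^+ 1)| = `|2 * a * E (fun w => f w * Yint s t w ^+ 1)|.
    by rewrite normrM (ger0_norm (x := 2 * a))// mulr_ge0// ltW.
  apply: (cvgr_to_le c).
  near=> N; rewrite Eq// expr1 mulrA divfK ?gt_eqF//.
  rewrite (eq_mean P (g := fun w => f w * walk (xi N) N.+1 w)) => [|w]; last by rewrite expr1.
  rewrite (walk_mean1 (bxi N) bf (mk f N pf)) normrM.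
  rewrite -[leRHS]mul1r ler_pM//; last first.
    apply: normr_mean_le_cst => [|w]; first exact: bounded_rvM.
    by rewrite normrM chain_norm// mulr1.
  have /andP[? ?] := rh0 N; have /andP[? ?] := rn N N.+1.
  by rewrite ger0_norm; nra.
have lim2 : `|4 * a ^+ 2 * E (fun w => f w * Yint s t w ^+ 2) - 4 * a * (t - s) * E f| <= 2 * M.
  pose q N := (1 - r (h N)) / h N.
  have c : `|q N ^+ 2 * E (fun w => f w * Yriemann s t N w ^+ 2) - q N * (1 + r (h N)) * (t - s) * E f| @[N --> \oo]
      --> `|(2 * a) ^+ 2 * E (fun w => f w * Yint s t w ^+ 2) - 2 * a * (1 + 1) * (t - s) * E f|.
    apply: cvg_norm; apply: cvgB.
      apply: cvgM; last exact: cvR.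
      exact: cvg_pow.
    apply: cvgM; last exact: cvg_cst.
    apply: cvgM; last exact: cvg_cst.
    by apply: cvgM => //; apply: cvgD => //; exact: cvg_cst.
  have -> : 4 * a ^+ 2 * E (fun w => f w * Yint s t w ^+ 2) - 4 * a * (t - s) * E f =
     (2 * a) ^+ 2 * E (fun w => f w * Yint s t w ^+ 2) - 2 * a * (1 + 1) * (t - s) * E f by ring.
  apply: (cvgr_to_le c).
  near=> N; rewrite Eq// mulrA -exprMn /q divfK ?gt_eqF//.
  rewrite (walk_mean2 (bxi N) (xi2 N) bf (mk f N pf)) -(nh N).
  have -> : E f * (N.+1%:R * (1 - r (h N) ^+ 2) - 2 * r (h N) * (1 - r (h N) ^+ N.+1)) -
      (1 - r (h N)) / h N * (1 + r (h N)) * (N.+1%:R * h N) * E f =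
      E f * (- (2 * (r (h N) * (1 - r (h N) ^+ N.+1)))).
    set rN := r (h N) ^+ N.+1; field; exact: lt0r_neq0.
  rewrite normrM normrN mulrC ler_pM//; last exact: normr_mean_le_cst.
  have /andP[? ?] := rh0 N; have /andP[? ?] := rn N N.+1.
  by rewrite ger0_norm; nra.
split => //.
pose q N := (1 - r (h N)) / h N.
have p1 : past s (fun=> 1 : R) by apply: past_finite => //; exact: finite_past_cst.
have b1 : bounded_rv ((fun=> 1) : T -> R) by exact: bounded_rv_cst.
have c : q N ^+ 2 * E (fun w => 1 * Yriemann s t N w ^+ 4) @[N --> \oo]
    --> (2 * a) ^+ 2 * E (fun w => 1 * Yint s t w ^+ 4).
  apply: cvgM; last exact: cvR.
  exact: cvg_pow.
have -> : 4 * a ^+ 2 * E (fun w => Yint s t w ^+ 4) = (2 * a) ^+ 2 * E (fun w => 1 * Yint s t w ^+ 4).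
  rewrite exprMn; congr (_ * _ * _); first by ring.
  by apply: eq_mean => w; rewrite mul1r.
apply: (cvgr_to_le c).
(* The bound on the fourth moment requires r(h) < 1, which holds for large [N] because (1 - r h) / h
   has the positive limit 2a. *)
have q0 : \forall N \near \oo, 0 < q N.
  by apply: (cvgr_gt (2 * a)) => //; rewrite mulr_gt0.
near=> N; rewrite Eq//.
have r1N : r (h N) < 1.
  have : 0 < q N by near: N; exact: q0.
  by rewrite /q pmulr_lgt0 ?invr_gt0// subr_gt0.
have rN01 : 0 <= r (h N) < 1 by rewrite r1N; case/andP: (rh0 N) => ->.
have := walk_mean4 (bxi N) (xi2 N) b1 rN01 (mk _ N p1) N.+1 (mean_cst P 1).
have hN2 : 0 <= h N ^+ 2 by rewrite sqr_ge0.
move=> /(ler_wpM2l hN2).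
have -> : h N ^+ 2 * (27 * N.+1%:R ^+ 2) = 27 * (t - s) ^+ 2 by rewrite -(nh N); ring.
apply: le_trans; rewrite le_eqVlt; apply/orP; left; apply/eqP.
by rewrite /q; field; exact: lt0r_neq0.
Unshelve. all: by end_near. Qed.

End past.

(** * Trigonometric moments of the increments *)

Section sine_bounds.
Context {R : realType}.
Implicit Types x u z : R.

Lemma is_derive_ge0_le (f df : R -> R) x : (forall y : R, is_derive y (1 : R) f (df y)) ->
  (forall y, 0 < y -> 0 <= df y) -> 0 <= x -> f 0 <= f x.
Proof.
move=> fd df0 x0.
have fE (y : R) : derive1 f y = df y by rewrite derive1E; apply: derive_val.
apply: (@ger0_derive1_le_cc _ f 0 x) => //.
- by move=> y; rewrite in_itv/= => /andP[y0 _]; rewrite fE df0.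
- apply: continuous_subspaceT => y; apply: differentiable_continuous.
  exact/derivable1_diffP.
- by rewrite in_itv/= lexx.
- by rewrite in_itv/= lexx andbT.
Qed.

Lemma sin_le x : 0 <= x -> sin x <= x.
Proof.
move=> x0; rewrite -subr_ge0.
have := @is_derive_ge0_le (fun x => x - sin x) (fun x => 1 - cos x) x _ _ x0.
rewrite sin0 subr0; apply=> y.
by move=> _; rewrite subr_ge0 cos_le1.
Qed.

Lemma cos_ge x : 1 - x ^+ 2 / 2 <= cos x.
Proof.
have sinu u : sin u ^+ 2 <= u ^+ 2.
  wlog u0 : u / 0 <= u.
    by move=> h; have [/h//|/ltW u0] := leP 0 u; rewrite -sqrrN -sinN -(sqrrN u) h// oppr_ge0.
  have [u1|u1] := ltP u 1.
    rewrite lerXn2r// ?nnegrE ?sin_le//.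
    have [->|un0] := eqVneq u 0; first by rewrite sin0.
    apply/ltW/sin_gt0_pihalf; rewrite lt_neqAle eq_sym un0 u0/=.
    exact: (lt_le_trans u1 (@pihalf_ge1 R)).
  apply: (@le_trans _ _ 1); first by rewrite sin2cos2 gerBl sqr_ge0.
  by nra.
have -> : cos x = 1 - 2 * sin (x / 2) ^+ 2.
  rewrite -{1}(divfK (x := 2) _ x)// mulr_natr cos_mulr2n cos2sin2.
  by rewrite -mulr_natr; ring.
have := sinu (x / 2); set v := sin _ ^+ 2.
have -> : (x / 2) ^+ 2 = x ^+ 2 / 4 by field.
lra.
Qed.

Lemma sin_ge x : 0 <= x -> x - x ^+ 3 / 6 <= sin x.
Proof.
move=> x0; rewrite -subr_ge0.
have := @is_derive_ge0_le (fun x => sin x - (x - x ^+ 3 / 6)) (fun x => cos x - (1 - x ^+ 2 / 2)) x _ _ x0.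
rewrite sin0 expr0n/= mul0r !subr0; apply=> y; last first.
  by move=> _; rewrite subr_ge0; exact: cos_ge.
apply: is_derive_eq.
by rewrite /GRing.scale/=; field.
Qed.

Lemma cos_half x : cos x = 1 - 2 * sin (x / 2) ^+ 2.
Proof.
rewrite -{1}(divfK (x := 2) _ x)// mulr_natr cos_mulr2n cos2sin2.
by rewrite -mulr_natr; ring.
Qed.

Lemma sin_taylor x : `|sin x - x| <= `|x| ^+ 3 / 6.
Proof.
wlog x0 : x / 0 <= x.
  move=> h; have [/h//|/ltW x0] := leP 0 x.
  have := h (- x); rewrite oppr_ge0 sinN -opprD !normrN; exact.
rewrite distrC ger0_norm ?subr_ge0 ?sin_le// (ger0_norm x0).
by have := sin_ge x0; lra.
Qed.

Lemma cos_taylor x : `|cos x - (1 - x ^+ 2 / 2)| <= x ^+ 4 / 24.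
Proof.
rewrite ger0_norm ?subr_ge0 ?cos_ge// cos_half.
wlog x0 : x / 0 <= x.
  move=> h; have [/h//|/ltW x0] := leP 0 x.
  by have := h (- x); rewrite oppr_ge0 mulNr sinN !sqrrN (exprM (- x) 2 2) sqrrN -exprM; exact.
have u0 : 0 <= x / 2 by lra.
have s1 := sin_le u0; have s2 := sin_ge u0.
have -> : x ^+ 4 / 24 = 2 * ((x / 2) ^+ 3 / 6 * (2 * (x / 2))) by field.
move: s1 s2 u0; set u := x / 2; set v := sin u => s1 s2 u0.
have -> : 1 - 2 * v ^+ 2 - (1 - x ^+ 2 / 2) = 2 * ((u - v) * (u + v)).
  by rewrite /u; field.
rewrite ler_pM2l//; have [v0|v0] := leP (- u) v; first by rewrite ler_pM//; lra.
apply: (@le_trans _ _ 0); first by rewrite mulr_ge0_le0//; lra.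
by rewrite !mulr_ge0// ?exprn_ge0.
Qed.

(** 2 - 2 cos z is the squared chord of the angle [z]. For z >= 0 and u = z/2 < 2, sin u >= u -
    u^3/6 >= u/3 since u^2 <= 4, so the squared chord 4 sin^2 u is at least z^2/9. *)
Lemma chord_ge z : `|z| <= pi -> z ^+ 2 <= 9 * (2 - 2 * cos z).
Proof.
wlog z0 : z / 0 <= z.
  move=> h; have [/h//|/ltW z0] := leP 0 z.
  by have := h (- z); rewrite oppr_ge0 normrN cosN sqrrN; exact.
rewrite ger0_norm// => zpi; rewrite cos_half.
have u0 : 0 <= z / 2 by lra.
have u2 : z / 2 < 2 by have := @pihalf_lt2 R; lra.
have := sin_ge u0; move: u0 u2; set u := z / 2; set v := sin u => u0 u2 uv.
have -> : z ^+ 2 = 4 * u ^+ 2 by rewrite /u; field.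
have : u / 3 <= v.
  apply: le_trans uv; rewrite -subr_ge0.
  have -> : u - u ^+ 3 / 6 - u / 3 = u * (4 - u ^+ 2) / 6 :> R by field.
  by nra.
by nra.
Qed.

End sine_bounds.

Section trigonometric_moments.
Context {R : realType} d (T : measurableType d) (P : probability T R).
Local Notation E := (mean P).

(** Bounds the third absolute moment, which the remainder of [sin] requires, by the fourth; [eta] is
    left free to balance the two terms. *)
Lemma cube_le (x eta : R) : 0 < eta -> `|x| ^+ 3 <= eta ^+ 3 + x ^+ 4 / eta.
Proof.
move=> eta0; have [xe|xe] := leP `|x| eta.
  apply: ler_wpDr; first by rewrite divr_ge0 ?exprn_even_ge0// ltW.
  by rewrite lerXn2r ?nnegrE// ltW.
apply: ler_wpDl; first by rewrite exprn_ge0// ltW.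
rewrite ler_pdivlMr//.
have -> : x ^+ 4 = `|x| ^+ 4 by rewrite -normrX ger0_norm// exprn_even_ge0.
by rewrite [X in _ <= X]exprSr ler_wpM2l ?exprn_ge0// ltW.
Qed.

(** [cos] is expanded to order 2 and [sin] to order 1: the hypotheses on the mean and the second
    moment give the main terms, the fourth moment gives the remainders. *)
Lemma trig_step (f D : T -> R) (delta e1 e2 Q eta k : R) :
  bounded_rv f -> bounded_rv D -> (forall w, `|f w| <= 1) -> 0 < eta ->
  `|E (fun w => f w * D w)| <= e1 ->
  `|E (fun w => f w * D w ^+ 2) - delta * E f| <= e2 ->
  E (fun w => D w ^+ 4) <= Q ->
  `|E (fun w => f w * cos (k * D w)) - (1 - k ^+ 2 * delta / 2) * E f|
     <= k ^+ 2 * e2 / 2 + k ^+ 4 * Q / 24 /\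
  `|E (fun w => f w * sin (k * D w))| <= `|k| * e1 + `|k| ^+ 3 * (eta ^+ 3 + Q / eta) / 6.
Proof.
move=> bf bD f1 eta0 m1 m2 m4.
have mkD : measurable_fun setT (fun w => k * D w).
  by apply: bounded_rv_measurable; bounded_rv_tac.
have bc := bounded_rv_cos mkD; have bs := bounded_rv_sin mkD.
split.
  have -> : E (fun w => f w * cos (k * D w)) - (1 - k ^+ 2 * delta / 2) * E f =
     E (fun w => f w * (cos (k * D w) - (1 - (k * D w) ^+ 2 / 2))) -
     k ^+ 2 / 2 * (E (fun w => f w * D w ^+ 2) - delta * E f).
    rewrite (eq_mean P (f := fun w => f w * (cos (k * D w) - (1 - (k * D w) ^+ 2 / 2)))
      (g := fun w => f w * cos (k * D w) - f w + k ^+ 2 / 2 * (f w * D w ^+ 2))); last first.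
      by move=> w; field.
    rewrite meanD ?meanB ?meanZ; try bounded_rv_tac.
    by field.
  apply: (le_trans (ler_normB _ _)); rewrite addrC lerD//.
    rewrite normrM ger0_norm; last by rewrite divr_ge0// sqr_ge0.
    by rewrite [leRHS]mulrAC ler_wpM2l// divr_ge0// sqr_ge0.
  apply: (@le_trans _ _ (E (fun w => k ^+ 4 / 24 * D w ^+ 4))).
    apply: normr_mean_le; try bounded_rv_tac.
    move=> w; rewrite normrM -[leRHS]mul1r ler_pM//.
    apply: (le_trans (cos_taylor _)).
    by rewrite le_eqVlt; apply/orP; left; apply/eqP; field.
  rewrite meanZ; try bounded_rv_tac.
  rewrite [leRHS]mulrAC ler_wpM2l// divr_ge0// exprn_even_ge0//.
have -> : E (fun w => f w * sin (k * D w)) =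
    E (fun w => f w * (sin (k * D w) - k * D w)) + k * E (fun w => f w * D w).
  rewrite -meanZ -?meanD; try bounded_rv_tac.
  by apply: eq_mean => w; ring.
apply: (le_trans (ler_normD _ _)); rewrite addrC lerD//.
  by rewrite normrM ler_wpM2l.
apply: (@le_trans _ _ (E (fun w => `|k| ^+ 3 / 6 * (eta ^+ 3 + D w ^+ 4 * eta^-1)))).
  apply: normr_mean_le; try bounded_rv_tac.
  move=> w; rewrite normrM -[leRHS]mul1r ler_pM//.
  apply: (le_trans (sin_taylor _)).
  rewrite normrM exprMn mulrAC ler_wpM2l ?divr_ge0 ?exprn_ge0//.
  exact: cube_le.
rewrite meanZ ?meanD ?mean_cst ?meanZr; try bounded_rv_tac.
rewrite [leRHS]mulrAC ler_wpM2l ?divr_ge0 ?exprn_ge0//.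
by rewrite lerD2l ler_wpM2r// invr_ge0 ltW.
Qed.

(** The real form of multiplying characteristic functions. The addition formulas couple [cos] and
    [sin], so both statements are carried together; each step adds at most 2e, and |rho| <= 1 keeps
    earlier errors from growing. *)
Lemma trig_recursion (Z : nat -> T -> R) (f : T -> R) (rho e : R) (n : nat) :
  (forall i, measurable_fun setT (Z i)) -> bounded_rv f -> (forall w, Z 0%N w = 0) ->
  `|rho| <= 1 ->
  (forall i, (i < n)%N -> forall g,
     g = (fun w => f w * cos (Z i w)) \/ g = (fun w => f w * sin (Z i w)) ->
     `|E (fun w => g w * cos (Z i.+1 w - Z i w)) - rho * E g| <= e /\
     `|E (fun w => g w * sin (Z i.+1 w - Z i w))| <= e) ->
  `|E (fun w => f w * cos (Z n w)) - rho ^+ n * E f| <= 2 * n%:R * e /\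
  `|E (fun w => f w * sin (Z n w))| <= 2 * n%:R * e.
Proof.
move=> mZ bf Z0 rho1; elim: n => [|n IH] H.
  rewrite mulr0 mul0r; split.
    rewrite (eq_mean P (g := f)); first by rewrite mul1r subrr normr0.
    by move=> w; rewrite Z0 cos0 mulr1.
  rewrite (eq_mean P (g := fun=> 0)); first by rewrite mean_cst normr0.
  by move=> w; rewrite Z0 sin0 mulr0.
have [IHc IHs] := IH (fun i ni => H i (ltnW ni)).
have mD : measurable_fun setT (fun w => Z n.+1 w - Z n w).
  exact: measurable_funB.
have bcD := bounded_rv_cos mD; have bsD := bounded_rv_sin mD.
have bc := bounded_rv_cos (mZ n); have bs := bounded_rv_sin (mZ n).
have [cc cs] := H n (ltnSn n) _ (or_introl erefl).
have [sc ss] := H n (ltnSn n) _ (or_intror erefl).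
have ZE w : Z n.+1 w = Z n w + (Z n.+1 w - Z n w) by rewrite addrC subrK.
set C := E (fun w => f w * cos (Z n w) * cos _) in cc.
set U := E (fun w => f w * cos (Z n w) * sin _) in cs.
set V := E (fun w => f w * sin (Z n w) * cos _) in sc.
set X := E (fun w => f w * sin (Z n w) * sin _) in ss.
have -> : E (fun w => f w * cos (Z n.+1 w)) = C - X.
  rewrite -meanB; try bounded_rv_tac.
  by apply: eq_mean => w; rewrite {1}ZE cosD; ring.
have -> : E (fun w => f w * sin (Z n.+1 w)) = V + U.
  rewrite -meanD; try bounded_rv_tac.
  by apply: eq_mean => w; rewrite {1}ZE sinD; ring.
have tri (A B c : R) (hA : `|A - rho * B| <= e) (hB : `|B - c| <= 2 * n%:R * e) :
    `|A - rho * c| <= e + 2 * n%:R * e.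
  have -> : A - rho * c = (A - rho * B) + rho * (B - c) by ring.
  apply: (le_trans (ler_normD _ _)); rewrite lerD// normrM.
  by rewrite -[leRHS]mul1r ler_pM.
split.
  have := tri _ _ _ cc IHc; rewrite mulrA -exprS => h.
  have -> : C - X - rho ^+ n.+1 * E f = (C - rho ^+ n.+1 * E f) - X by ring.
  apply: (le_trans (ler_normB _ _)); rewrite -[n.+1%:R]natr1; lra.
have hs := tri _ _ 0 sc; rewrite !subr0 mulr0 subr0 in hs.
have := hs IHs => h.
apply: (le_trans (ler_normD _ _)); rewrite -[n.+1%:R]natr1; lra.
Qed.

End trigonometric_moments.

(** * Trigonometric moments of the integrated chain *)

Section sign_chain_trig.
Context {R : realType} d (T : measurableType d) (P : probability T R).
Variables (a : R) (Y : R -> T -> R).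
Hypotheses (a0 : 0 < a) (chainY : sign_chain P a Y).
Local Notation E := (mean P).
Implicit Types (s t u k : R) (f : T -> R).

Lemma Yint_refl s w : Yint Y s s w = 0.
Proof. by rewrite /Yint set_itv1 Rintegral_set1. Qed.

Lemma Yint_add s t u w : 0 <= s -> s <= t -> t <= u ->
  Yint Y s u w = Yint Y s t w + Yint Y t u w.
Proof.
move=> s0 st tu; move: st; rewrite le_eqVlt => /predU1P[->|st].
  by rewrite Yint_refl add0r.
have su : s < u by exact: lt_le_trans tu.
have t0 : 0 <= t by rewrite (le_trans s0)// ltW.
have iY := Yint_integrable chainY w s0 su.
have := @Rintegral_itvB _ (Y ^~ w) (BLeft s) (BRight u) t iY.
rewrite !bnd_simp => /(_ (ltW st) tu) e.
rewrite /Yint -(Rintegral_itv_obnd_cbnd (r := t)).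
  by rewrite -e addrC subrK.
by apply: integrableS iY => //; apply: subset_itvr; rewrite bnd_simp ltW.
Qed.

Lemma past_Yint_comp (h : R -> R) (M : R) s t : 0 <= s -> s <= t ->
  continuous h -> (forall x, `|h x| <= M) -> past Y t (fun w => h (Yint Y s t w)).
Proof.
move=> s0 st ch hM; move: st; rewrite le_eqVlt => /predU1P[<-|st].
  apply: (past_comp (M := M) ch hM (u := fun _ _ => 0)) => [n|w]; first exact: finite_past_cst.
  by rewrite Yint_refl; exact: cvg_cst.
apply: (past_comp (M := M) ch hM (u := Yriemann Y s t)) => [n|w].
  by apply: Yriemann_past => //; exact: ltW.
exact: (Yriemann_cvg chainY).
Qed.

(* [b] is the jump rate; the last two terms come from the fourth moment, through
   the Taylor remainders of [cos] and [sin]. *)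
Definition trig_error (b delta k : R) : R :=
  k ^+ 2 / (4 * b ^+ 2) + `|k| / (2 * b) + 7 * k ^+ 4 * delta ^+ 2 / 24 +
  8 * `|k| ^+ 3 * (delta * Num.sqrt delta) / 6.

Lemma Yint_trig_step s t k f : 0 <= s -> s < t -> past Y (s * a) f -> (forall w, `|f w| <= 1) ->
  `|E (fun w => f w * cos (k * Yint Y (s * a) (t * a) w)) -
     (1 - k ^+ 2 * (t - s) / 2) * E f| <= trig_error a (t - s) k /\
  `|E (fun w => f w * sin (k * Yint Y (s * a) (t * a) w))| <= trig_error a (t - s) k.
Proof.
move=> s0 st pf f1.
have sa0 : 0 <= s * a by rewrite mulr_ge0// ltW.
have sta : s * a < t * a by rewrite ltr_pM2r.
have [m1 m2 m4] := Yint_moments a0 chainY sa0 sta pf f1.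
have bf := past_rv chainY sa0 pf.
have bD := Yint_rv chainY sa0 sta.
have ts : 0 < t - s by rewrite subr_gt0.
(* The threshold of [cube_le] is the square root of the duration delta, the typical size of the
   increment: eta^3 and 7 delta^2 / eta are then delta^(3/2) and 7 delta^(3/2), whence the 8 in
   [trig_error]. *)
have eta0 : 0 < Num.sqrt (t - s) by rewrite sqrtr_gt0.
have m1' : `|E (fun w => f w * Yint Y (s * a) (t * a) w)| <= 1 / (2 * a).
  by rewrite ler_pdivlMr ?mulr_gt0// mulrC.
have m2' : `|E (fun w => f w * Yint Y (s * a) (t * a) w ^+ 2) - (t - s) * E f| <= 1 / (2 * a ^+ 2).
  rewrite ler_pdivlMr ?mulr_gt0 ?exprn_gt0//.
  rewrite -(ler_pM2l (x := 2))//; apply: le_trans m2.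
  rewrite le_eqVlt; apply/orP; left; apply/eqP.
  have a2 : 0 <= 2 * (2 * a ^+ 2) by rewrite !mulr_ge0// ltW.
  rewrite mulrCA -[X in _ * X](ger0_norm a2) -normrM; congr `|_|; ring.
(* The fourth moment is at most 27/4 times the squared duration; 27/4 is rounded up to 7. *)
have m4' : E (fun w => Yint Y (s * a) (t * a) w ^+ 4) <= 7 * (t - s) ^+ 2.
  rewrite -(ler_pM2l (x := 4 * a ^+ 2)) ?mulr_gt0 ?exprn_gt0//; apply: (le_trans m4).
  have -> : 27 * (t * a - s * a) ^+ 2 = 27 * (a ^+ 2 * (t - s) ^+ 2) by ring.
  have -> : 4 * a ^+ 2 * (7 * (t - s) ^+ 2) = 28 * (a ^+ 2 * (t - s) ^+ 2) by ring.
  apply: ler_wpM2r; [by apply: mulr_ge0; exact: sqr_ge0|lra].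
have sq2 : Num.sqrt (t - s) ^+ 2 = t - s by rewrite sqr_sqrtr// ltW.
have eq3 : Num.sqrt (t - s) ^+ 3 + 7 * (t - s) ^+ 2 / Num.sqrt (t - s) =
    8 * ((t - s) * Num.sqrt (t - s)).
  by move: (Num.sqrt _) eta0 sq2 => eta eta_gt0 <-; field; exact: lt0r_neq0.
have p1 : 0 <= k ^+ 2 / (4 * a ^+ 2) by rewrite divr_ge0 ?sqr_ge0// mulr_ge0// sqr_ge0.
have p2 : 0 <= `|k| / (2 * a) by rewrite divr_ge0// mulr_ge0// ltW.
have p3 : 0 <= 7 * k ^+ 4 * (t - s) ^+ 2 / 24.
  by apply: divr_ge0 => //; apply: mulr_ge0; [apply: mulr_ge0 => //; exact: exprn_even_ge0|exact: sqr_ge0].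
have p4 : 0 <= 8 * `|k| ^+ 3 * ((t - s) * Num.sqrt (t - s)) / 6.
  apply: divr_ge0 => //; apply: mulr_ge0; [by rewrite mulr_ge0// exprn_ge0|by rewrite mulr_ge0// ltW].
have a00 : a != 0 by exact: lt0r_neq0.
have [hc hs] := trig_step k bf bD f1 eta0 m1' m2' m4'; split.
  apply: (le_trans hc).
  have -> : k ^+ 2 * (1 / (2 * a ^+ 2)) / 2 = k ^+ 2 / (4 * a ^+ 2) by field.
  have -> : k ^+ 4 * (7 * (t - s) ^+ 2) / 24 = 7 * k ^+ 4 * (t - s) ^+ 2 / 24 by field.
  by rewrite /trig_error; lra.
apply: (le_trans hs); rewrite eq3.
have -> : `|k| * (1 / (2 * a)) = `|k| / (2 * a) by field.
have -> : `|k| ^+ 3 * (8 * ((t - s) * Num.sqrt (t - s))) / 6 =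
  8 * `|k| ^+ 3 * ((t - s) * Num.sqrt (t - s)) / 6 by field.
by rewrite /trig_error; lra.
Qed.

(** The interval is cut into n + 1 equal pieces. The products of [f] with the cosine and the sine of
    the partial increment are still functions of the past bounded by 1, so the one-step estimate
    applies to each piece; the condition on [n] gives |rho| <= 1. *)
Lemma Yint_trig s t k f n : 0 <= s -> s < t -> past Y (s * a) f -> (forall w, `|f w| <= 1) ->
  k ^+ 2 * ((t - s) / n.+1%:R) / 2 <= 1 ->
  let rho := 1 - k ^+ 2 * ((t - s) / n.+1%:R) / 2 in
  let err := 2 * n.+1%:R * trig_error a ((t - s) / n.+1%:R) k in
  `|E (fun w => f w * cos (k * Yint Y (s * a) (t * a) w)) - rho ^+ n.+1 * E f| <= err /\
  `|E (fun w => f w * sin (k * Yint Y (s * a) (t * a) w))| <= err.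
Proof.
move=> s0 st pf f1 kn; set delta := (t - s) / n.+1%:R => rho err.
have delta0 : 0 < delta by rewrite divr_gt0// subr_gt0.
pose u i := s + i%:R * delta.
have us i : s <= u i by rewrite lerDl mulr_ge0// ltW.
have u0 i : 0 <= u i := le_trans s0 (us i).
have uS i : u i.+1 - u i = delta by rewrite /u -natr1; ring.
have ult i : u i < u i.+1 by rewrite -subr_gt0 uS.
have un : u n.+1 = t by rewrite /u /delta mulrC divfK ?pnatr_eq0// addrC subrK.
have sa0 : 0 <= s * a by rewrite mulr_ge0// ltW.
have usa i : s * a <= u i * a by rewrite ler_wpM2r// ltW.
pose Z i w := k * Yint Y (s * a) (u i * a) w.
have Z0 w : Z 0%N w = 0 by rewrite /Z /u mul0r addr0 Yint_refl mulr0.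
have pcos i : past Y (u i * a) (fun w => cos (Z i w)).
  apply: (@past_Yint_comp (fun x => cos (k * x)) 1) => //.
    move=> x; apply: continuous_comp; first by apply: continuousM => //; exact: cst_continuous.
    exact: continuous_cos.
  by move=> x; exact: cos_max.
have psin i : past Y (u i * a) (fun w => sin (Z i w)).
  apply: (@past_Yint_comp (fun x => sin (k * x)) 1) => //.
    move=> x; apply: continuous_comp; first by apply: continuousM => //; exact: cst_continuous.
    exact: continuous_sin.
  by move=> x; exact: sin_max.
have mZ i : measurable_fun setT (Z i).
  apply: measurable_funM => //; case: i => [|i].
    rewrite (_ : Yint _ _ _ = fun=> 0)//; apply/funext => w.
    by rewrite /u mul0r addr0 Yint_refl.
  apply: bounded_rv_measurable; apply: (Yint_rv chainY sa0).
  by rewrite ltr_pM2r// (le_lt_trans (us i)).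
have ZD i w : Z i.+1 w - Z i w = k * Yint Y (u i * a) (u i.+1 * a) w.
  rewrite /Z (Yint_add (s := s * a) (t := u i * a) (u := u i.+1 * a))//; first by ring.
  by rewrite ler_wpM2r ?ltW.
have rho1 : `|rho| <= 1.
  have : 0 <= k ^+ 2 * delta / 2 by rewrite divr_ge0// mulr_ge0 ?sqr_ge0// ltW.
  by rewrite -/delta in kn; rewrite ler_norml /rho => ?; apply/andP; split; lra.
have bf := past_rv chainY sa0 pf.
have [] := @trig_recursion _ _ _ P Z f rho (trig_error a delta k) n.+1 mZ bf Z0 rho1.
  move=> i _ g gE.
  have pg : past Y (u i * a) g.
    by case: gE => ->; apply: pastM => //; apply: past_le pf.
  have g1 w : `|g w| <= 1.
    by case: gE => ->; rewrite normrM -[leRHS]mul1r ler_pM// ?cos_max ?sin_max.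
  have := Yint_trig_step k (u0 i) (ult i) pg g1; rewrite uS.
  rewrite (eq_mean P (f := fun w => g w * cos (Z i.+1 w - Z i w))
    (g := fun w => g w * cos (k * Yint Y (u i * a) (u i.+1 * a) w))); last first.
    by move=> w; rewrite ZD.
  rewrite (eq_mean P (f := fun w => g w * sin (Z i.+1 w - Z i w))
    (g := fun w => g w * sin (k * Yint Y (u i * a) (u i.+1 * a) w)))//.
  by move=> w; rewrite ZD.
by rewrite /Z un.
Qed.

End sign_chain_trig.

(** * Characteristic function of the normal law *)

Section normal_characteristic_function.
Context {R : realType}.
Notation mu := (@lebesgue_measure R).
Variable sigma : R.
Hypothesis sigma0 : 0 < sigma.
Implicit Types k x theta : R.

Let g := normal_pdf 0 sigma.

Let gE x : g x = normal_peak sigma * expR (- (x ^+ 2 / (2 * sigma ^+ 2))).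
Proof.
rewrite /g normal_pdfE ?gt_eqF// /normal_fun subr0 mulNr; congr (_ * expR (- (_ / _))).
by rewrite mulr_natl.
Qed.

Let g_ge0 x : 0 <= g x. Proof. exact: normal_pdf_ge0. Qed.

Let peak0 : 0 < normal_peak sigma. Proof. by rewrite normal_peak_gt0 ?gt_eqF. Qed.

Let sigma' := Num.sqrt 2 * sigma.
Let sigma'0 : 0 < sigma'. Proof. by rewrite mulr_gt0// sqrtr_gt0. Qed.
(** An integrable majorant of |x| g(x). With y = x^2 / (4 sigma^2), g carries the square of exp(-y):
    one factor exp(-y) absorbs |x|, the other is a multiple of the normal density of standard
    deviation sqrt(2) sigma. *)
Let bound x := sigma * normal_peak sigma / normal_peak sigma' * normal_pdf 0 sigma' x.

Let boundE x : bound x = sigma * normal_peak sigma * expR (- (x ^+ 2 / (4 * sigma ^+ 2))).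
Proof.
rewrite /bound normal_pdfE ?gt_eqF// /normal_fun subr0 mulrA divfK; last first.
  by rewrite gt_eqF// normal_peak_gt0 ?gt_eqF.
rewrite mulNr; congr (_ * expR (- (_ / _))).
by rewrite /sigma' exprMn sqr_sqrtr// -mulr_natl mulrA -natrM.
Qed.

Let xg_le x : `|x| * g x <= bound x.
Proof.
rewrite gE boundE.
set y := x ^+ 2 / (4 * sigma ^+ 2).
have -> : x ^+ 2 / (2 * sigma ^+ 2) = y + y by rewrite /y; field; rewrite gt_eqF.
rewrite opprD expRD.
have xe : `|x| * expR (- y) <= sigma.
  rewrite expRN ler_pdivrMr ?expR_gt0//.
  (* Since 1 + y <= exp y, it suffices to compare with sigma (1 + y), by completing a square. *)
  apply: (@le_trans _ _ (sigma * (1 + y))); last by rewrite ler_pM2l// expR_ge1Dx.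
  rewrite -subr_ge0.
  have -> : sigma * (1 + y) - `|x| = (`|x| / 2 - sigma) ^+ 2 / sigma.
    have -> : y = `|x| ^+ 2 / (4 * sigma ^+ 2) by rewrite real_normK ?num_real.
    field.
    by rewrite gt_eqF.
  by rewrite divr_ge0 ?sqr_ge0 ?ltW.
have -> : `|x| * (normal_peak sigma * (expR (- y) * expR (- y))) =
   (`|x| * expR (- y)) * (normal_peak sigma * expR (- y)) by ring.
rewrite -[leRHS]mulrA; apply: ler_wpM2r xe.
by apply: mulr_ge0; [exact: ltW|exact: expR_ge0].
Qed.

Let bound_integrable : mu.-integrable setT (EFin \o bound).
Proof.
have -> : EFin \o bound = fun x => ((sigma * normal_peak sigma / normal_peak sigma')%:E *
   (normal_pdf 0 sigma' x)%:E)%E by apply/funext.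
by apply: integrableZl => //; exact: integrable_normal_pdf.
Qed.

Let dg x : is_derive x (1 : R) g (- (x / sigma ^+ 2) * g x).
Proof.
have -> : g = fun x => normal_peak sigma * expR (- (x ^+ 2 / (2 * sigma ^+ 2))).
  by apply/funext => y; rewrite gE.
apply: is_derive_eq.
rewrite /GRing.scale/=; field.
by rewrite gt_eqF.
Qed.

(** The phase treats both parts of the characteristic function at once: 0 gives the cosine and -pi/2
    the sine. *)
Variable theta : R.
Let F k x := sin (k * x + theta) * g x.
Let f k x := k * (cos (k * x + theta) * g x) - sigma ^- 2 * (x * sin (k * x + theta) * g x).

Let dF k x : is_derive x (1 : R) (F k) (f k x).
Proof.
have h := dg x.
apply: is_derive_eq.
rewrite /GRing.scale/= /f; field.
by rewrite gt_eqF.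
Qed.

Let cg : continuous g.
Proof. by apply: continuous_normal_pdf; rewrite gt_eqF. Qed.

Let affine_continuous k : continuous (fun x => k * x + theta).
Proof.
by move=> x; apply: cvgD; [apply: cvgM => //; exact: cvg_cst|exact: cvg_cst].
Qed.

Let csin k : continuous (fun x => sin (k * x + theta)).
Proof.
move=> x; apply: (@continuous_comp _ _ _ (fun x => k * x + theta) sin).
  exact: affine_continuous.
exact: continuous_sin.
Qed.

Let ccos k : continuous (fun x => cos (k * x + theta)).
Proof.
move=> x; apply: (@continuous_comp _ _ _ (fun x => k * x + theta) cos).
  exact: affine_continuous.
exact: continuous_cos.
Qed.

Let int_dominated (h : R -> R) : continuous h -> (forall x, `|h x| <= bound x) ->
  mu.-integrable setT (EFin \o h).
Proof.
move=> ch hb; apply: (le_integrable _ _ _ bound_integrable) => //.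
  by apply/measurable_EFinP; exact: continuous_measurable_fun.
by move=> x _ /=; rewrite lee_fin (le_trans (hb x))// ler_norm.
Qed.

Let int_xsin k : mu.-integrable setT (EFin \o (fun x => x * sin (k * x + theta) * g x)).
Proof.
apply: int_dominated.
  move=> x; apply: cvgM; last exact: cg.
  by apply: cvgM; [exact: cvg_id|exact: csin].
move=> x; rewrite !normrM (ger0_norm (g_ge0 x)) (le_trans _ (xg_le x))//.
by rewrite ler_wpM2r// -[leRHS]mulr1 ler_pM// sin_max.
Qed.

Let int_cos k : mu.-integrable setT (EFin \o (fun x => cos (k * x + theta) * g x)).
Proof.
apply: (le_integrable _ _ _ (integrable_normal_pdf 0 sigma)) => //.
  apply/measurable_EFinP; apply: continuous_measurable_fun => x.
  by apply: cvgM; [exact: ccos|exact: cg].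
by move=> x _ /=; rewrite lee_fin normrM -[leRHS]mul1r ler_pM// cos_max.
Qed.

Let int_f k : mu.-integrable setT (EFin \o f k).
Proof.
rewrite (_ : EFin \o f k = ((fun x => k%:E * (cos (k * x + theta) * g x)%:E) \-
  (fun x => (sigma ^- 2)%:E * (x * sin (k * x + theta) * g x)%:E))%E).
  by apply: integrableB => //; apply: integrableZl => //; [exact: int_cos|exact: int_xsin].
by apply/funext => x.
Qed.

Let F_bound k x : 0 < x -> `|F k x| <= sigma * normal_peak sigma / x /\
  `|F k (- x)| <= sigma * normal_peak sigma / x.
Proof.
move=> x0.
have gx : g x <= sigma * normal_peak sigma / x.
  rewrite ler_pdivlMr// mulrC -{1}(gtr0_norm x0) (le_trans (xg_le x))//.
  rewrite boundE; apply: ler_piMr; first by rewrite mulr_ge0// ltW.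
  rewrite -[leRHS]expR0 ler_expR.
  by rewrite oppr_le0 divr_ge0 ?sqr_ge0// mulr_ge0// sqr_ge0.
have gN : g (- x) = g x by rewrite !gE sqrrN.
by split; rewrite normrM ?gN (ger0_norm (g_ge0 _)) -[leRHS]mul1r ler_pM// sin_max.
Qed.

Let F_cvg k : F k n.+1%:R - F k (- n.+1%:R) @[n --> \oo] --> 0.
Proof.
apply/norm_cvg0P.
apply: (@squeeze_cvgr _ _ _ _ (fun=> 0) (fun n => 2 * (sigma * normal_peak sigma) * n.+1%:R^-1)).
- near=> n; rewrite normr_ge0/=.
  have [h1 h2] := F_bound k (ltr0Sn _ n).
  apply: (le_trans (ler_normB _ _)); rewrite -mulrA mulr2n mulrDl mul1r.
  exact: lerD.
- exact: cvg_cst.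
- rewrite -(mulr0 (2 * (sigma * normal_peak sigma))).
  by apply: cvgM; [exact: cvg_cst|exact: cvg_harmonic].
Unshelve. all: by end_near. Qed.

Let cf k : continuous (f k).
Proof.
move=> x; apply: cvgB.
  apply: cvgM; first exact: cvg_cst.
  by apply: cvgM; [exact: ccos|exact: cg].
apply: cvgM; first exact: cvg_cst.
apply: cvgM; last exact: cg.
by apply: cvgM; [exact: cvg_id|exact: csin].
Qed.

Let cF k : continuous (F k).
Proof. by move=> x; apply: cvgM; [exact: csin|exact: cg]. Qed.

(** [f k] is the derivative of [F k], which vanishes at infinity. The fundamental theorem of
    calculus on [-(n + 1), n + 1] and dominated convergence then give integration by parts on the
    whole line. *)
Let int_f0 k : (\int[mu]_x (f k x)%:E = 0)%E.
Proof.
pose u n := (f k) \_ (`[- n.+1%:R, n.+1%:R] : set R).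
have mf : measurable_fun setT (f k) by apply: continuous_measurable_fun; exact: cf.
have uE n : (\int[mu]_x (u n x)%:E)%E = (F k n.+1%:R - F k (- n.+1%:R))%:E.
  rewrite /u.
  have -> : (fun x => ((f k \_ `[- n.+1%:R, n.+1%:R]) x)%:E) = (EFin \o f k) \_ (`[- n.+1%:R, n.+1%:R] : set R).
    by rewrite restrict_EFin.
  rewrite -integral_mkcond.
  have nn : - n.+1%:R < n.+1%:R :> R by rewrite gtrN// ltr0n.
  rewrite (@continuous_FTC2 _ (f k) (F k) _ _ nn) ?EFinB//.
  - by apply: continuous_subspaceT; exact: cf.
  - split.
    + by move=> x _; have := dF k x => -[].
    + by apply: cvg_at_right_filter; exact: cF.
    + by apply: cvg_at_left_filter; exact: cF.
  - by move=> x _; rewrite derive1E; have := dF k x => -[].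
have muu n : measurable_fun setT (EFin \o u n).
  apply/measurable_EFinP; apply: (measurable_restrictT (f k) (measurable_itv _)).1.
  exact: measurable_funTS.
have ucv : {ae mu, forall x, setT x -> (EFin \o u n) x @[n --> \oo] --> (EFin \o f k) x}.
  apply: aeW => x _; apply: cvg_near_cst.
  near=> n; rewrite /u/= patchT// inE/= in_itv/= -ler_norml.
  have : `|x| < n%:R by near: n; exact: nbhs_infty_gtr.
  by move=> /ltW /le_trans; apply; rewrite ler_nat.
have ub : {ae mu, forall x n, setT x -> (`|(EFin \o u n) x| <= (EFin \o (fun x : R => `|f k x|%R)) x)%E}.
  apply: aeW => x n _ /=; rewrite lee_fin /u /patch; case: ifP => // _.
  by rewrite normr0.
have mEf : measurable_fun setT (EFin \o f k) by exact/measurable_EFinP.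
have int_abs : mu.-integrable setT (EFin \o (fun x : R => `|f k x|)).
  by have := integrable_abse (int_f k).
have [_ _] := @dominated_convergence _ _ R mu _ measurableT _ _ _ muu mEf ucv int_abs ub.
move=> dc.
have e : [sequence (\int[mu]_x (EFin \o u n) x)%E]_n = (fun n => (F k n.+1%:R - F k (- n.+1%:R))%:E).
  by apply/funext => n; rewrite -uE.
rewrite e in dc.
apply: (cvg_unique _ dc) => //.
by apply: cvg_EFin; [exact: nearW|exact: F_cvg].
Unshelve. all: by end_near. Qed.

(* [A] solves [A' k = - sigma ^ 2 * k * A k], by integration by parts. *)
Let A k := \int[mu]_x (cos (k * x + theta) * g x).

Let ibp k : \int[mu]_x (x * sin (k * x + theta) * g x) = sigma ^+ 2 * k * A k.
Proof.
have f0 : \int[mu]_x (f k x) = 0 by rewrite /Rintegral int_f0.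
have fE : \int[mu]_x (f k x) = \int[mu]_x (k * (cos (k * x + theta) * g x)) -
    \int[mu]_x (sigma ^- 2 * (x * sin (k * x + theta) * g x)).
  apply: RintegralB => //.
  - by have := integrableZl measurableT k (int_cos k).
  - by have := integrableZl measurableT (sigma ^- 2) (int_xsin k).
have e1 : \int[mu]_x (k * (cos (k * x + theta) * g x)) = k * A k.
  exact: RintegralZl (int_cos k).
have e2 : \int[mu]_x (sigma ^- 2 * (x * sin (k * x + theta) * g x)) =
    sigma ^- 2 * \int[mu]_x (x * sin (k * x + theta) * g x).
  exact: RintegralZl (int_xsin k).
move: fE; rewrite f0 e1 e2 => /esym/eqP; rewrite subr_eq0 => /eqP e.
by rewrite -mulrA e mulrA mulfV ?mul1r// expf_neq0// gt_eqF.
Qed.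

Let dcos k x : is_derive k (1 : R) (fun k => cos (k * x + theta) * g x)
  (- (x * sin (k * x + theta) * g x)).
Proof.
apply: is_derive_eq.
by rewrite /GRing.scale/=; ring.
Qed.

Let dA k : is_derive k (1 : R) A (- (sigma ^+ 2 * k * A k)).
Proof.
pose G (k x : R) := cos (k * x + theta) * g x.
have Ik : `]k - 1, k + 1[%classic k by rewrite /= in_itv/=; apply/andP; split; lra.
have intG y : `]k - 1, k + 1[%classic y -> mu.-integrable setT (EFin \o G y).
  by move=> _; exact: int_cos.
have derG y x : `]k - 1, k + 1[%classic y -> setT x -> derivable (G ^~ x) y 1.
  by move=> _ _; have := dcos y x => -[].
have pG y x : partial1of2 G y x = - (x * sin (y * x + theta) * g x).
  by rewrite partial1of2E; have := dcos y x => -[].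
have b0 x : 0 <= bound x by rewrite (le_trans _ (xg_le x))// mulr_ge0.
have Gub y x : `]k - 1, k + 1[%classic y -> setT x -> `|partial1of2 G y x| <= bound x.
  move=> _ _; rewrite pG normrN !normrM (ger0_norm (g_ge0 x)) (le_trans _ (xg_le x))//.
  by rewrite ler_wpM2r// -[leRHS]mulr1 ler_pM// sin_max.
have dA := derivable_under_integral measurableT Ik intG derG b0 bound_integrable Gub.
have dAE := differentiation_under_integral measurableT Ik intG derG b0 bound_integrable Gub.
apply: DeriveDef; first exact: dA.
rewrite -derive1E; apply: (etrans dAE).
rewrite -ibp; under eq_Rintegral do rewrite pG -mulN1r.
by rewrite RintegralZl ?mulN1r//; exact: int_xsin.
Qed.

(** The differential equation of [A] makes A(k) exp(k^2 sigma^2 / 2) constant in k, and A(0) is cos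
    theta because the density has mass 1. *)
Lemma normal_trig k :
  \int[mu]_x (cos (k * x + theta) * normal_pdf 0 sigma x) =
  cos theta * expR (- (k ^+ 2 * sigma ^+ 2 / 2)).
Proof.
pose H k := A k * expR (k ^+ 2 * sigma ^+ 2 / 2).
have dH y : is_derive y (1 : R) H 0.
  have h := dA y; apply: is_derive_eq.
  by rewrite /GRing.scale/=; field.
have H0 : H k = H 0 by exact: is_derive_0_is_cst.
have A0 : A 0 = cos theta.
  rewrite /A; under eq_Rintegral do rewrite mul0r add0r.
  rewrite RintegralZl//; last exact: integrable_normal_pdf.
  by rewrite /Rintegral integral_normal_pdf mulr1.
move: H0; rewrite /H A0 expr0n/= mul0r mul0r expR0 mulr1 => <-.
by rewrite -/(A k) expRN mulfK// gt_eqF// expR_gt0.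
Qed.

End normal_characteristic_function.

(** * Trigonometric approximation on the circle *)

Section trigonometric_partition.
Context {R : realType}.
Implicit Types (x y z u v k c : R).

(** Given by generators, so that a property linear in the polynomial has to be checked only on one
    cosine and one sine. The frequencies are arbitrary reals. *)
Inductive trig_poly : (R -> R) -> Prop :=
| trig_poly_cos k : trig_poly (fun x => cos (k * x))
| trig_poly_sin k : trig_poly (fun x => sin (k * x))
| trig_polyD f g : trig_poly f -> trig_poly g -> trig_poly (fun x => f x + g x)
| trig_polyZ c f : trig_poly f -> trig_poly (fun x => c * f x).

Lemma eq_trig_poly f g : f =1 g -> trig_poly f -> trig_poly g.
Proof. by move=> /funext ->. Qed.

Lemma trig_poly_cst c : trig_poly (fun=> c).
Proof.
apply: (eq_trig_poly _ (trig_polyZ c (trig_poly_cos 0))) => x.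
by rewrite mul0r cos0 mulr1.
Qed.

Lemma trig_polyM f g : trig_poly f -> trig_poly g -> trig_poly (fun x => f x * g x).
Proof.
move=> tf tg; elim: tf => {f} [k|k|f f' _ If _ If'|c f _ If].
- elim: tg => {g} [l|l|f f' _ If _ If'|c f _ If].
  + apply: (eq_trig_poly _ (trig_polyZ (1 / 2)
      (trig_polyD (trig_poly_cos (k + l)) (trig_poly_cos (k - l))))) => x.
    by rewrite !mulrDl !mulNr !(cosB, cosD); field.
  + apply: (eq_trig_poly _ (trig_polyZ (1 / 2)
      (trig_polyD (trig_poly_sin (k + l)) (trig_poly_sin (l - k))))) => x.
    by rewrite !mulrDl !mulNr !(sinB, sinD); field.
  + by apply: (eq_trig_poly _ (trig_polyD If If')) => x; rewrite mulrDr.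
  + by apply: (eq_trig_poly _ (trig_polyZ c If)) => x; rewrite mulrCA.
- elim: tg => {g} [l|l|f f' _ If _ If'|c f _ If].
  + apply: (eq_trig_poly _ (trig_polyZ (1 / 2)
      (trig_polyD (trig_poly_sin (k + l)) (trig_poly_sin (k - l))))) => x.
    by rewrite !mulrDl !mulNr !(sinB, sinD); field.
  + apply: (eq_trig_poly _ (trig_polyZ (1 / 2)
      (trig_polyD (trig_poly_cos (k - l)) (trig_polyZ (-1) (trig_poly_cos (k + l)))))) => x.
    by rewrite !mulrDl !mulNr !(cosB, cosD); field.
  + by apply: (eq_trig_poly _ (trig_polyD If If')) => x; rewrite mulrDr.
  + by apply: (eq_trig_poly _ (trig_polyZ c If)) => x; rewrite mulrCA.
- by apply: (eq_trig_poly _ (trig_polyD If If')) => x; rewrite mulrDl.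
- by apply: (eq_trig_poly _ (trig_polyZ c If)) => x; rewrite mulrA.
Qed.

Lemma trig_poly_continuous f : trig_poly f -> continuous f.
Proof.
elim=> {f} [k|k|f g _ cf _ cg|c f _ cf] x.
- apply: (@continuous_comp _ _ _ (fun x => k * x) cos); last exact: continuous_cos.
  by apply: cvgM; [exact: cvg_cst|exact: cvg_id].
- apply: (@continuous_comp _ _ _ (fun x => k * x) sin); last exact: continuous_sin.
  by apply: cvgM; [exact: cvg_cst|exact: cvg_id].
- by apply: cvgD; [exact: cf|exact: cg].
- by apply: cvgM; [exact: cvg_cst|exact: cf].
Qed.

(* [bernstein n p v] is the weight of [p] under the binomial law of parameters
   [n] and [v]. *)
Fixpoint bernstein (n p : nat) (v : R) : R :=
  match n, p with
  | 0, 0 => 1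
  | 0, _.+1 => 0
  | n.+1, 0 => (1 - v) * bernstein n 0 v
  | n.+1, p.+1 => v * bernstein n p v + (1 - v) * bernstein n p.+1 v
  end.

Lemma bernstein_ge0 n p v : 0 <= v <= 1 -> 0 <= bernstein n p v.
Proof.
move=> /andP[v0 v1]; elim: n p => [|n IH] [|p] //=.
  by rewrite mulr_ge0// subr_ge0.
by rewrite addr_ge0// mulr_ge0// subr_ge0.
Qed.

Lemma bernstein_gt n p v : (n < p)%N -> bernstein n p v = 0.
Proof.
elim: n p => [|n IH] [|p] //=; rewrite ltnS => np.
by rewrite !IH ?mulr0 ?addr0// ltnW.
Qed.

(** Conditioning on one of the n + 1 Bernoulli trials; the moments below follow from it by
    induction. *)
Lemma bernstein_sumS n v (phi : nat -> R) :
  \sum_(p < n.+2) bernstein n.+1 p v * phi p =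
  v * (\sum_(p < n.+1) bernstein n p v * phi p.+1) +
  (1 - v) * (\sum_(p < n.+1) bernstein n p v * phi p).
Proof.
rewrite big_ord_recl/=.
under eq_bigr do rewrite /bump leq0n add1n mulrDl.
rewrite big_split/= addrCA; congr (_ + _).
  by rewrite mulr_sumr; apply: eq_bigr => i _; rewrite mulrA.
rewrite big_ord_recr/= (bernstein_gt v (ltnSn n)) mulr0 mul0r addr0 [in RHS]big_ord_recl/=.
rewrite mulrDr mulrA; congr (_ + _).
by rewrite mulr_sumr; apply: eq_bigr => i _; rewrite /bump leq0n add1n mulrA.
Qed.

Arguments bernstein : simpl never.

Lemma bernstein_sum1 n v : \sum_(p < n.+1) bernstein n p v = 1.
Proof.
elim: n => [|n IH]; first by rewrite big_ord_recl big_ord0 addr0.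
have := bernstein_sumS n v (fun=> 1).
under eq_bigr do rewrite mulr1.
under [X in _ = _ * X + _]eq_bigr do rewrite mulr1.
under [X in _ = _ + _ * X]eq_bigr do rewrite mulr1.
by rewrite IH => ->; ring.
Qed.

Lemma bernstein_mean n v : \sum_(p < n.+1) bernstein n p v * p%:R = n%:R * v.
Proof.
elim: n => [|n IH]; first by rewrite big_ord_recl big_ord0 addr0 mulr0 mul0r.
rewrite bernstein_sumS.
under eq_bigr do rewrite -natr1 mulrDr mulr1.
by rewrite big_split/= IH bernstein_sum1 -natr1; ring.
Qed.

Lemma bernstein_mean2 n v :
  \sum_(p < n.+1) bernstein n p v * p%:R ^+ 2 = n%:R * v * (1 - v) + (n%:R * v) ^+ 2.
Proof.
elim: n => [|n IH].
  by rewrite big_ord_recl big_ord0 addr0 expr0n/= mulr0; ring.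
rewrite (bernstein_sumS n v (fun p => p%:R ^+ 2)).
have -> : \sum_(p < n.+1) bernstein n p v * p.+1%:R ^+ 2 =
    \sum_(p < n.+1) bernstein n p v * p%:R ^+ 2 +
    2 * (\sum_(p < n.+1) bernstein n p v * p%:R) + \sum_(p < n.+1) bernstein n p v.
  rewrite mulr_sumr -!big_split/=; apply: eq_bigr => p _.
  by rewrite -[p.+1%:R]natr1; ring.
by rewrite IH bernstein_mean bernstein_sum1 -[n.+1%:R]natr1; ring.
Qed.

(** The binomial variable is rescaled to a node of [-1, 1] with mean [u]; with v = (1 + u)/2 its
    variance is 4v(1 - v)/(n + 1), at most 1/(n + 1). *)
Lemma bernstein_variance n u : -1 <= u <= 1 ->
  \sum_(p < n.+2) bernstein n.+1 p ((1 + u) / 2) * (2 * p%:R / n.+1%:R - 1 - u) ^+ 2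
    <= n.+1%:R^-1.
Proof.
move=> /andP[u0 u1]; set v := (1 + u) / 2.
have n0 : n.+1%:R != 0 :> R by rewrite pnatr_eq0.
have uE : u = 2 * v - 1 by rewrite /v; field.
have -> : \sum_(p < n.+2) bernstein n.+1 p v * (2 * p%:R / n.+1%:R - 1 - u) ^+ 2 =
    4 / n.+1%:R ^+ 2 * (\sum_(p < n.+2) bernstein n.+1 p v * p%:R ^+ 2) -
    8 * v / n.+1%:R * (\sum_(p < n.+2) bernstein n.+1 p v * p%:R) +
    4 * v ^+ 2 * (\sum_(p < n.+2) bernstein n.+1 p v).
  rewrite !mulr_sumr -sumrB -big_split/=; apply: eq_bigr => p _.
  by rewrite uE; field.
rewrite bernstein_mean2 bernstein_mean bernstein_sum1.
have -> : 4 / n.+1%:R ^+ 2 * (n.+1%:R * v * (1 - v) + (n.+1%:R * v) ^+ 2) -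
  8 * v / n.+1%:R * (n.+1%:R * v) + 4 * v ^+ 2 * 1 = 4 * v * (1 - v) / n.+1%:R.
  by field.
rewrite -[leRHS]mul1r ler_wpM2r//.
have : 0 <= (1 - 2 * v) ^+ 2 by exact: sqr_ge0.
by lra.
Qed.

Lemma trig_poly_bernstein n p f : trig_poly f -> trig_poly (fun x => bernstein n p (f x)).
Proof.
move=> tf.
have tf' : trig_poly (fun x => 1 - f x).
  apply: (eq_trig_poly _ (trig_polyD (trig_poly_cst 1) (trig_polyZ (-1) tf))) => x.
  by rewrite mulN1r.
elim: n p => [|n IH] [|p]; rewrite /bernstein -/bernstein; try exact: trig_poly_cst.
  exact: trig_polyM.
by apply: trig_polyD; apply: trig_polyM.
Qed.

(** A pair of Bernstein nodes need not lie on the unit circle. An angle that minimizes the distance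
    to it up to [eta] is enough, and exists because the infimum is finite. *)
Lemma near_minimizer (D : R -> R) eta : (forall x, 0 <= D x) -> 0 < eta ->
  exists y, forall x, D y <= D x + eta.
Proof.
move=> D0 eta0.
have hi : has_inf (range D).
  by split; [exists (D 0), 0|exists 0 => _ [x _ <-]].
have [_ [y _ <-] Dy] := inf_adherent eta0 hi.
exists y => x; apply: (le_trans (ltW Dy)); rewrite lerD2r.
by apply: ge_inf; [exact: hi.2|exists x].
Qed.

Lemma cos_periodic_int x (j : int) : cos (x + j%:~R * (2 * pi)) = cos x.
Proof.
have cn (n : nat) (t : R) : cos (t + n%:R * (2 * pi)) = cos t.
  have -> : n%:R * (2 * pi) = pi *+ 2 *+ n :> R.
    by rewrite -[RHS]mulr_natl -[pi *+ 2]mulr_natl.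
  exact: (periodicn (@cosD2pi R)).
case: j => n; first exact: cn.
rewrite NegzE mulrNz mulNr -(cn n.+1 (x - _)); congr cos.
by rewrite subrK.
Qed.

(** Lipschitz bounds are measured along the line, whereas cosine and sine only see the circle: [y]
    is moved by a multiple of 2 pi to within [pi] of [x], where the chord controls the arc. *)
Lemma circle_lift_dist x y : exists2 z,
  circle_proj y = circle_proj (x + z) & z ^+ 2 <= 9 * (2 - 2 * cos (x - y)).
Proof.
have pi0 : 0 < 2 * pi :> R by rewrite mulr_gt0// pi_gt0.
pose j := Num.floor ((x - y + pi) / (2 * pi)).
pose z : R := y + j%:~R * (2 * pi) - x.
exists z.
  apply/circle_projP; rewrite /circle_rel /z addrCA subrr addr0 opprD addrA subrr sub0r.
  by rewrite mulNr mulfK ?gt_eqF// rpredN intr_int.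
have /andP[j1 j2] := floor_itv ((x - y + pi) / (2 * pi)).
have zpi : `|z| <= pi.
  move: j1 j2; rewrite -/j ler_pdivlMr// ltr_pdivrMr// intrD1 mulrDl mul1r => j1 j2.
  by rewrite ler_norml /z; apply/andP; split; lra.
apply: (le_trans (chord_ge zpi)).
have -> : z = y - x + j%:~R * (2 * pi) by rewrite /z; ring.
by rewrite cos_periodic_int -[y - x]opprB cosN.
Qed.

Definition lipschitz_periodic (L : R) (g : R -> R) :=
  (forall x y, `|g x - g y| <= L * `|x - y|) /\
  (forall x y, circle_proj x = circle_proj y -> g x = g y).

(* The weights are products of Bernstein weights in [(1 + cos x) / 2] and
   [(1 + sin x) / 2]; the nodes are angles whose cosine and sine are nearest to
   the Bernstein nodes. *)
Lemma trig_partition eps : 0 < eps -> exists (I : finType) (lam : I -> R -> R) (y : I -> R),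
  [/\ forall l, trig_poly (lam l), forall l x, 0 <= lam l x, forall x, \sum_l lam l x = 1 &
      forall g L, 0 <= L -> lipschitz_periodic L g ->
        forall x, `|g x - \sum_l lam l x * g (y l)| <= L * eps].
Proof.
move=> eps0; pose eta := eps / 2.
have eta0 : 0 < eta by rewrite divr_gt0.
(* The error will be eta + (18 + 72) / ((n + 1) eta), where 18 comes from the near minimality of the
   angles and 72 from the variance of the weights. *)
have [n nE] : exists n : nat, 90 / eta ^+ 2 <= n.+1%:R.
  exists (Num.truncn (90 / eta ^+ 2)).
  exact/ltW/truncnS_gt.
pose v x : R := (1 + cos x) / 2; pose u x : R := (1 + sin x) / 2.
pose I : finType := ('I_n.+2 * 'I_n.+2)%type.
pose c (p : 'I_n.+2) : R := 2 * p%:R / n.+1%:R - 1.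
pose D (l : I) x := (cos x - c l.1) ^+ 2 + (sin x - c l.2) ^+ 2.
have D0 l x : 0 <= D l x by rewrite addr_ge0// sqr_ge0.
have inv0 : 0 < n.+1%:R^-1 :> R by rewrite invr_gt0.
have [y yD] := choice (fun l => near_minimizer (D0 l) inv0).
pose lam (l : I) x := bernstein n.+1 l.1 (v x) * bernstein n.+1 l.2 (u x).
have v01 x : 0 <= v x <= 1.
  by have := cos_geN1 x; have := cos_le1 x; rewrite /v => ? ?; apply/andP; split; lra.
have u01 x : 0 <= u x <= 1.
  by have := sin_geN1 x; have := sin_le1 x; rewrite /u => ? ?; apply/andP; split; lra.
have sum1 x : \sum_l lam l x = 1.
  rewrite -(pair_bigA _ (fun p q : 'I_n.+2 => bernstein n.+1 p (v x) * bernstein n.+1 q (u x)))/=.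
  under eq_bigr do rewrite -mulr_sumr bernstein_sum1 mulr1.
  exact: bernstein_sum1.
have lam0 l x : 0 <= lam l x by rewrite mulr_ge0// bernstein_ge0.
have sumD x : \sum_l lam l x * D l x <= 2 / n.+1%:R.
  have -> : \sum_l lam l x * D l x =
    \sum_(p < n.+2) bernstein n.+1 p (v x) * (c p - cos x) ^+ 2 +
    \sum_(q < n.+2) bernstein n.+1 q (u x) * (c q - sin x) ^+ 2.
    rewrite -(pair_bigA _ (fun p q : 'I_n.+2 => bernstein n.+1 p (v x) * bernstein n.+1 q (u x) *
      ((cos x - c p) ^+ 2 + (sin x - c q) ^+ 2)))/=.
    transitivity (\sum_(p < n.+2) (bernstein n.+1 p (v x) * (c p - cos x) ^+ 2 +
       bernstein n.+1 p (v x) * \sum_(q < n.+2) bernstein n.+1 q (u x) * (c q - sin x) ^+ 2)).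
      apply: eq_bigr => p _.
      transitivity (bernstein n.+1 p (v x) * (c p - cos x) ^+ 2 *
          (\sum_(q < n.+2) bernstein n.+1 q (u x)) +
        bernstein n.+1 p (v x) *
          \sum_(q < n.+2) bernstein n.+1 q (u x) * (c q - sin x) ^+ 2).
        rewrite !mulr_sumr -big_split; apply: eq_bigr => q _ /=.
        move: (bernstein _ q _) (bernstein _ p _) (c p) (c q) => A A' C C'; ring.
      by rewrite bernstein_sum1 mulr1.
    by rewrite big_split/= -mulr_suml bernstein_sum1 mul1r.
  rewrite mulr_natl mulr2n lerD// bernstein_variance//.
    by rewrite cos_geN1 cos_le1.
  by rewrite sin_geN1 sin_le1.
exists I, lam, y; split => //.
  move=> l; apply: trig_polyM; apply: trig_poly_bernstein.
    apply: (eq_trig_poly _ (trig_polyZ (1 / 2) (trig_polyD (trig_poly_cst 1) (trig_poly_cos 1)))) => x.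
    by rewrite /v (mul1r x); field.
  apply: (eq_trig_poly _ (trig_polyZ (1 / 2) (trig_polyD (trig_poly_cst 1) (trig_poly_sin 1)))) => x.
  by rewrite /u (mul1r x); field.
move=> g L L0 [gL gP] x.
have gxy l : `|g x - g (y l)| <= L * (eta + 9 * (4 * D l x + 2 / n.+1%:R) / eta).
  have [z zy zD] := circle_lift_dist x (y l).
  rewrite (gP _ _ zy) (le_trans (gL _ _))// ler_wpM2l//.
  rewrite opprD addrA subrr sub0r normrN.
  (* The distance is traded for its square, whose mean under the weights is controlled by [sumD]. *)
  have zz : `|z| <= eta + z ^+ 2 / eta.
    have [ze|ze] := leP `|z| eta; first by rewrite ler_wpDr// divr_ge0 ?sqr_ge0// ltW.
    rewrite ler_wpDl ?ltW// ltr_pdivlMr// -real_normK ?num_real// expr2.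
    by rewrite ltr_pM2l// (lt_trans eta0).
  apply: (le_trans zz); rewrite lerD2l; apply: ler_wpM2r; first by rewrite invr_ge0 ltW.
  apply: (le_trans zD); rewrite ler_pM2l//.
  (* The squared chord is at most twice the sum of the squared distances of its ends to the node,
     and [D l (y l)] exceeds [D l x] by at most 1/(n + 1). *)
  apply: (@le_trans _ _ (2 * D l x + 2 * D l (y l))); last first.
    by have := yD l x; move: (n.+1%:R^-1) (D l x) (D l (y l)) => i D1 D2; lra.
  rewrite cosB; have := cos2Dsin2 x; have := cos2Dsin2 (y l).
  rewrite /D; set a := cos x; set b := sin x; set a' := cos (y l); set b' := sin (y l).
  set c1 := c _; set c2 := c _ => h h'.
  have : 0 <= (a + a' - 2 * c1) ^+ 2 by exact: sqr_ge0.
  have : 0 <= (b + b' - 2 * c2) ^+ 2 by exact: sqr_ge0.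
  nra.
rewrite -[g x]mul1r -(sum1 x) mulr_suml -sumrB.
apply: (le_trans (ler_norm_sum _ _ _)).
apply: (@le_trans _ _ (\sum_l lam l x * (L * (eta + 9 * (4 * D l x + 2 / n.+1%:R) / eta)))).
  apply: ler_sum => l _; rewrite -mulrBr normrM ger0_norm//.
  by rewrite ler_wpM2l.
have -> : \sum_l lam l x * (L * (eta + 9 * (4 * D l x + 2 / n.+1%:R) / eta)) =
   L * ((eta + 18 / n.+1%:R / eta) * \sum_l lam l x + 36 / eta * \sum_l lam l x * D l x).
  rewrite mulrDr !mulr_sumr -big_split/=; apply: eq_bigr => l _.
  by field; rewrite !gt_eqF ?ltr0n.
rewrite ler_wpM2l// sum1 mulr1.
have h1 : 36 / eta * (\sum_l lam l x * D l x) <= 36 / eta * (2 / n.+1%:R).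
  by rewrite ler_wpM2l// divr_ge0// ltW.
have h2 : 90 / n.+1%:R / eta <= eta.
  rewrite ler_pdivrMr// ler_pdivrMr ?ltr0n// mulrC.
  by move: nE; rewrite ler_pdivrMr ?exprn_gt0// expr2.
have -> : eps = eta + eta by rewrite /eta; field.
have e1 : 36 / eta * (2 / n.+1%:R) = 72 / n.+1%:R / eta.
  by field; rewrite !gt_eqF ?ltr0n.
rewrite {}e1 in h1; move: h1 h2.
have -> : 72 / n.+1%:R / eta = 72 * (n.+1%:R^-1 / eta) :> R by rewrite !mulrA.
have -> : 90 / n.+1%:R / eta = 90 * (n.+1%:R^-1 / eta) :> R by rewrite !mulrA.
have -> : 18 / n.+1%:R / eta = 18 * (n.+1%:R^-1 / eta) :> R by rewrite !mulrA.
by move: (n.+1%:R^-1 / eta) (36 / eta * _) => ? ?; lra.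
Qed.

End trigonometric_partition.

(** * Exponential limit of the one-step factors *)

Section exponential_limit.
Context {R : realType}.
Implicit Types x y k : R.

Lemma expRN_le y : 0 <= y -> `|expR (- y) - (1 - y)| <= y ^+ 2.
Proof.
move=> y0; rewrite ger0_norm; last by rewrite subr_ge0 expR_ge1Dx.
have y1 : 0 < 1 + y by lra.
have : expR (- y) <= (1 + y)^-1.
  by rewrite expRN lef_pV2 ?posrE ?expR_gt0// expR_ge1Dx.
have : (1 + y)^-1 <= 1 - y + y ^+ 2.
  rewrite -[leLHS]mul1r ler_pdivrMr//.
  have : 0 <= y ^+ 3 by rewrite exprn_ge0.
  move=> y3; have -> : (1 - y + y ^+ 2) * (1 + y) = 1 + y ^+ 3 by ring.
  by lra.
by lra.
Qed.

Lemma exprn_lipschitz x y n : `|x| <= 1 -> `|y| <= 1 ->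
  `|x ^+ n - y ^+ n| <= n%:R * `|x - y|.
Proof.
move=> x1 y1; elim: n => [|n IH]; first by rewrite subrr normr0 mul0r.
have -> : x ^+ n.+1 - y ^+ n.+1 = x * (x ^+ n - y ^+ n) + (x - y) * y ^+ n.
  by rewrite !exprS; ring.
apply: (le_trans (ler_normD _ _)).
rewrite -[n.+1%:R]natr1 [leRHS]mulrDl mul1r lerD//.
  by rewrite normrM -[leRHS]mul1r ler_pM.
by rewrite normrM -[leRHS]mulr1 ler_pM// normrX exprn_ile1.
Qed.

Lemma exp_product_limit x n : 0 <= x -> x / n.+1%:R <= 1 ->
  `|(1 - x / n.+1%:R) ^+ n.+1 - expR (- x)| <= x ^+ 2 / n.+1%:R.
Proof.
move=> x0 xn; have y0 : 0 <= x / n.+1%:R by rewrite divr_ge0.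
have n0 : n.+1%:R != 0 :> R by rewrite pnatr_eq0.
have -> : - x = n.+1%:R * (- (x / n.+1%:R)) by field.
rewrite expRM_natl.
apply: (le_trans (exprn_lipschitz _ _ _)).
- by move: (x / _) xn y0 => y ? ?; rewrite ger0_norm; lra.
- by rewrite ger0_norm ?expR_ge0// -[leRHS]expR0 ler_expR oppr_le0.
rewrite distrC.
apply: (@le_trans _ _ (n.+1%:R * (x / n.+1%:R) ^+ 2)).
  by rewrite ler_wpM2l// expRN_le.
by rewrite le_eqVlt; apply/orP; left; apply/eqP; field.
Qed.

(** Over n + 1 pieces of length h = tau/(n + 1), the Taylor remainders add up to terms of order tau
    h and tau sqrt(h). These and the error of the exponential limit are free of [a] and are made
    small by the choice of [n]; the rest is O(n/a), which fixes [A]. *)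
Lemma trig_error_small k tau eps : 0 < tau -> 0 < eps ->
  exists n (A : R), [/\ k ^+ 2 * (tau / n.+1%:R) / 2 <= 1, 0 < A &
    forall a, A <= a -> 2 * n.+1%:R * trig_error a (tau / n.+1%:R) k +
      (k ^+ 2 * tau / 2) ^+ 2 / n.+1%:R <= eps].
Proof.
move=> tau0 eps0; pose h n : R := tau / n.+1%:R.
have h0 n : 0 < h n by rewrite divr_gt0.
have hn n : n.+1%:R * h n = tau by rewrite /h mulrC divfK// pnatr_eq0.
have hcvg : h n @[n --> \oo] --> 0.
  rewrite -(mulr0 tau); apply: cvgM; first exact: cvg_cst.
  by apply: (@cvg_harmonic R).
have scvg : Num.sqrt (h n) @[n --> \oo] --> 0.
  rewrite -(@sqrtr0 R); apply: continuous_cvg => //; exact: sqrt_continuous.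
pose e n := 7 * k ^+ 4 * tau / 12 * h n + 8 / 3 * `|k| ^+ 3 * tau * Num.sqrt (h n) +
  k ^+ 4 * tau / 4 * h n.
have ecvg : e n @[n --> \oo] --> 0.
  have -> : 0 = 7 * k ^+ 4 * tau / 12 * 0 + 8 / 3 * `|k| ^+ 3 * tau * 0 + k ^+ 4 * tau / 4 * 0 :> R by ring.
  by apply: cvgD; [apply: cvgD|]; apply: cvgM => //; exact: cvg_cst.
have kcvg : k ^+ 2 / 2 * h n @[n --> \oo] --> 0.
  by rewrite -(mulr0 (k ^+ 2 / 2)); apply: cvgM => //; exact: cvg_cst.
have [n [ne nk]] : exists n, e n < eps / 2 /\ k ^+ 2 / 2 * h n < 1.
  have : \forall n \near \oo, e n < eps / 2 /\ k ^+ 2 / 2 * h n < 1.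
    near=> n; split; near: n.
      by apply: (cvgr_lt 0) => //; rewrite divr_gt0.
    by apply: (cvgr_lt 0).
  by case=> N _ /(_ N (leqnn N)); exists N.
pose C := 2 * n.+1%:R * (k ^+ 2 + `|k|).
have C0 : 0 <= C by rewrite !mulr_ge0// addr_ge0// sqr_ge0.
have Ceps : 0 <= 2 * C / eps by apply: divr_ge0; [rewrite mulr_ge0|exact: ltW].
exists n, (1 + 2 * C / eps); split.
- have -> : k ^+ 2 * (tau / n.+1%:R) / 2 = k ^+ 2 / 2 * h n.
    have n0 : n.+1%:R != 0 :> R by rewrite pnatr_eq0.
    by rewrite /h; field.
  exact: ltW.
- by move: Ceps; lra.
move=> a Aa.
have a1 : 1 <= a by lra.
have a0 : 0 < a by lra.
have Ca : C / a <= eps / 2.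
  rewrite ler_pdivrMr//.
  have : eps / 2 * (2 * C / eps) <= eps / 2 * a by rewrite ler_pM2l ?divr_gt0//; lra.
  have -> // : eps / 2 * (2 * C / eps) = C by field; exact: lt0r_neq0.
apply: (@le_trans _ _ (C / a + e n)); last by lra.
have -> : 2 * n.+1%:R * trig_error a (tau / n.+1%:R) k + (k ^+ 2 * tau / 2) ^+ 2 / n.+1%:R =
  2 * n.+1%:R * (k ^+ 2 / (4 * a ^+ 2) + `|k| / (2 * a)) + e n.
  rewrite /trig_error /e -/(h n) -[in LHS](hn n).
  have n0 : n.+1%:R != 0 :> R by rewrite pnatr_eq0.
  have -> : (k ^+ 2 * (n.+1%:R * h n) / 2) ^+ 2 / n.+1%:R = k ^+ 4 * (n.+1%:R * h n) / 4 * h n.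
    by field.
  by rewrite -(hn n); field; exact: lt0r_neq0.
rewrite lerD2r /C -[leRHS]mulrA; apply: ler_wpM2l; first by rewrite mulr_ge0.
rewrite [leRHS]mulrDl; apply: lerD.
  apply: ler_wpM2l; first exact: sqr_ge0.
  by rewrite lef_pV2 ?posrE ?mulr_gt0 ?exprn_gt0//; nra.
apply: ler_wpM2l => //.
by rewrite lef_pV2 ?posrE ?mulr_gt0//; lra.
Unshelve. all: by end_near. Qed.

(** In the limit an increment has the normal characteristic function and decouples from the past.
    The threshold [A] comes before the probability space, the chain and [f], because all three
    change with [a]. *)
Lemma Yint_decoupling s t k eps : 0 <= s -> s < t -> 0 < eps ->
  exists2 A : R, 0 < A &
  forall (a : R), A <= a -> forall d (T : measurableType d) (P : probability T R) (Y : R -> T -> R),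
    sign_chain P a Y -> forall f, past Y (s * a) f -> (forall w, `|f w| <= 1) ->
    `|mean P (fun w => f w * cos (k * Yint Y (s * a) (t * a) w)) -
      expR (- (k ^+ 2 * (t - s) / 2)) * mean P f| <= eps /\
    `|mean P (fun w => f w * sin (k * Yint Y (s * a) (t * a) w))| <= eps.
Proof.
move=> s0 st eps0; have ts : 0 < t - s by rewrite subr_gt0.
have [n [A [kn A0 HA]]] := trig_error_small k ts eps0.
exists A => // a Aa d T P Y chainY f pf f1.
have a0 : 0 < a := lt_le_trans A0 Aa.
have [hc hs] := Yint_trig a0 chainY s0 st pf f1 kn.
have herr := HA a Aa.
have x0 : 0 <= k ^+ 2 * (t - s) / 2 by rewrite divr_ge0// mulr_ge0 ?sqr_ge0// ltW.
have kn' : k ^+ 2 * (t - s) / 2 / n.+1%:R <= 1.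
  have -> // : k ^+ 2 * (t - s) / 2 / n.+1%:R = k ^+ 2 * ((t - s) / n.+1%:R) / 2.
  have n0 : n.+1%:R != 0 :> R by rewrite pnatr_eq0.
  by field.
have hx := exp_product_limit x0 kn'.
have n0 : n.+1%:R != 0 :> R by rewrite pnatr_eq0.
have E0 : 0 <= (k ^+ 2 * (t - s) / 2) ^+ 2 / n.+1%:R by rewrite divr_ge0// sqr_ge0.
have bf : bounded_rv f.
  by apply: (past_rv chainY _ pf); rewrite mulr_ge0// ltW.
split; last by apply: (le_trans hs); apply: le_trans herr; rewrite lerDl.
rewrite -[X in `|X|](subrKA ((1 - k ^+ 2 * ((t - s) / n.+1%:R) / 2) ^+ n.+1 * mean P f)).
apply: (le_trans (ler_normD _ _)).
apply: le_trans herr; rewrite lerD// -mulrBl normrM.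
rewrite -[leRHS]mulr1 ler_pM//; last exact: normr_mean_le_cst.
have -> : k ^+ 2 * ((t - s) / n.+1%:R) / 2 = k ^+ 2 * (t - s) / 2 / n.+1%:R by field.
exact: hx.
Qed.

End exponential_limit.

(** * Increments of Brownian motion *)

Section bounded_functionals.
Context {R : realType}.
Implicit Types (h : R -> R) (Phi : (R -> R) -> R).

(** Bounded linear functionals on the bounded Borel functions. Expectations with a bounded weight
    and integrals against a normal density are both of this kind, so that a single argument
    identifies two of them. *)
Definition bounded_functional (C : R) Phi :=
  [/\ forall h h', bounded_rv h -> bounded_rv h' ->
        Phi (fun x => h x + h' x) = Phi h + Phi h',
      forall c h, bounded_rv h -> Phi (fun x => c * h x) = c * Phi h &
      forall h M, bounded_rv h -> (forall x, `|h x| <= M) -> `|Phi h| <= C * M].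

Lemma bounded_functional_indic C Phi1 Phi2 : 0 <= C ->
  bounded_functional C Phi1 -> bounded_functional C Phi2 ->
  (forall A, measurable A -> Phi1 (\1_A) = Phi2 (\1_A)) ->
  forall h, bounded_rv h -> Phi1 h = Phi2 h.
Proof.
move=> C0 [D1 Z1 B1] [D2 Z2 B2] PhiE h bh; have [mh [M hM]] := bh.
apply/eqP; rewrite -subr_eq0 -normr_le0; apply/ler_addgt0Pr => e e0; rewrite add0r.
have [N NE] : exists N : nat, 2 * C / e <= N.+1%:R.
  by exists (Num.truncn (2 * C / e)); exact/ltW/truncnS_gt.
have N0 : 0 < N.+1%:R :> R by [].
pose j x := Num.truncn (N.+1%:R * (h x + M)).
have hM0 x : 0 <= h x + M.
  by have := hM x; rewrite ler_norml => /andP[? _]; lra.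
pose n := (Num.truncn (N.+1%:R * (M + M))).+1.
have jn x : (j x < n)%N.
  rewrite ltnS /j; apply: le_truncn; rewrite ler_pM2l// lerD2r.
  by rewrite (le_trans _ (hM x))// ler_norm.
have jE x : (j x)%:R <= N.+1%:R * (h x + M) < (j x).+1%:R.
  by apply: truncn_itv; rewrite mulr_ge0.
pose A i := [set x | j x = i].
have mA i : measurable (A i).
  rewrite (_ : A i = h @^-1` `[i%:R / N.+1%:R - M, i.+1%:R / N.+1%:R - M[).
    by rewrite -[X in measurable X]setTI; apply: mh.
  apply/seteqP; split => x /=; rewrite in_itv/= lerBlDr ltrBrDr ler_pdivrMr// ltr_pdivlMr// mulrC.
    by move=> <-; exact: jE.
  by move=> xi; exact: truncn_def.
pose c i : R := i%:R / N.+1%:R - M.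
pose s x := \sum_(i < n) c i * \1_(A i) x.
have bI i : bounded_rv (\1_(A i) : R -> R) by exact: bounded_rv_indic.
have bs : bounded_rv s.
  by apply: bounded_rv_sum => i _; apply: bounded_rvM => //; exact: bounded_rv_cst.
have sE x : s x = c (j x).
  rewrite /s (bigD1 (Ordinal (jn x)))//= big1 ?addr0.
    by rewrite indicE mem_set ?mulr1.
  move=> i; rewrite -val_eqE/= => ij; rewrite indicE memNset ?mulr0// => ji.
  by rewrite /A/= in ji; rewrite ji eqxx in ij.
have hs x : `|h x + (-1) * s x| <= N.+1%:R^-1.
  have /andP[j1 j2] := jE x.
  have l1 : (j x)%:R / N.+1%:R <= h x + M by rewrite ler_pdivrMr// mulrC.
  have l2 : h x + M < (j x).+1%:R / N.+1%:R by rewrite ltr_pdivlMr// mulrC.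
  have i0 : 0 < N.+1%:R^-1 :> R by rewrite invr_gt0.
  rewrite -natr1 mulrDl mul1r in l2; rewrite sE /c.
  move: (N.+1%:R^-1) ((j x)%:R / N.+1%:R) l1 l2 i0 => v u ? ? ?.
  by rewrite ler_norml; apply/andP; split; lra.
have bms : bounded_rv (fun x => (-1) * s x) by apply: bounded_rvM => //; exact: bounded_rv_cst.
have bhs : bounded_rv (fun x => h x + (-1) * s x) by exact: bounded_rvD.
have Phi_sum Phi : bounded_functional C Phi -> Phi s = \sum_(i < n) c i * Phi (\1_(A i)).
  move=> [D Z B]; rewrite /s; elim: n {jn bs s sE hs bms bhs} => [|m IH].
    rewrite big_ord0; apply/eqP; rewrite -normr_le0 -[leRHS](mulr0 C).
    apply: B => [|x]; last by rewrite big_ord0 normr0.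
    by apply: bounded_rv_sum => i _; apply: bounded_rvM => //; exact: bounded_rv_cst.
  rewrite big_ord_recr/= -IH -Z// -D; first by congr Phi; apply/funext => x; rewrite big_ord_recr.
    by apply: bounded_rv_sum => i _; apply: bounded_rvM => //; exact: bounded_rv_cst.
  by apply: bounded_rvM => //; exact: bounded_rv_cst.
have -> : Phi1 h - Phi2 h = Phi1 (fun x => h x + (-1) * s x) - Phi2 (fun x => h x + (-1) * s x).
  rewrite D1// D2// Z1// Z2// !Phi_sum//.
  under eq_bigr do rewrite PhiE//.
  by ring.
apply: (le_trans (ler_normB _ _)).
have := B1 _ _ bhs hs; have := B2 _ _ bhs hs.
have : 2 * (C * N.+1%:R^-1) <= e.
  by rewrite mulrA ler_pdivrMr// [e * _]mulrC -ler_pdivrMr.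
by move: (C * N.+1%:R^-1) `|Phi1 _| `|Phi2 _| => z z1 z2; lra.
Qed.

Lemma mean_bounded_functional d (T : measurableType d) (P : probability T R)
    (f : T -> R) (xi : T -> R) (M : R) :
  bounded_rv f -> (forall w, `|f w| <= M) -> measurable_fun setT xi ->
  bounded_functional M (fun h => mean P (fun w => f w * h (xi w))).
Proof.
move=> bf fM mxi.
have bh h : bounded_rv h -> bounded_rv (fun w => h (xi w)).
  move=> [mh [B hB]]; split; first exact: measurableT_comp.
  by exists B => w.
split => [h h' bh1 bh2|c h bh1|h B bh1 hB].
- rewrite -meanD; try by apply: bounded_rvM => //; exact: bh.
  by apply: eq_mean => w; rewrite mulrDr.
- rewrite -meanZ; last by apply: bounded_rvM => //; exact: bh.
  by apply: eq_mean => w; rewrite mulrCA.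
- apply: normr_mean_le_cst; first by apply: bounded_rvM => //; exact: bh.
  by move=> w; rewrite normrM ler_pM.
Qed.

Lemma scale_bounded_functional C Phi c : 0 <= C ->
  bounded_functional C Phi -> bounded_functional (`|c| * C) (fun h => c * Phi h).
Proof.
move=> C0 [D Z B]; split => [h h' bh bh'|b h bh|h M bh hM].
- by rewrite D// mulrDr.
- by rewrite Z// mulrCA.
- by rewrite normrM -mulrA ler_wpM2l// B.
Qed.

Lemma normal_bounded_functional sigma : bounded_functional 1
  (fun h => \int[lebesgue_measure]_x (h x * normal_pdf 0 sigma x)).
Proof.
have ih h : bounded_rv h ->
    lebesgue_measure.-integrable setT (EFin \o (fun x => h x * normal_pdf 0 sigma x)).
  move=> [mh [M hM]].
  have iM : lebesgue_measure.-integrable setT (fun x => (M%:E * (normal_pdf 0 sigma x)%:E)%E).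
    by apply: integrableZl => //; exact: integrable_normal_pdf.
  apply: (le_integrable _ _ _ iM) => //.
    apply/measurable_EFinP; apply: measurable_funM => //.
    exact: measurable_normal_pdf.
  move=> x _ /=; rewrite lee_fin !normrM ler_wpM2r// (le_trans (hM x))// ler_norm.
  done.
split => [h h' bh bh'|c h bh|h M bh hM].
- rewrite -RintegralD//; [|exact: ih|exact: ih].
  by apply: eq_Rintegral => x _; rewrite mulrDl.
- rewrite -RintegralZl//; last exact: ih.
  by apply: eq_Rintegral => x _; rewrite mulrA.
- rewrite mul1r (le_trans (le_normr_Rintegral _ (ih _ bh)))//.
  have -> : M = \int[lebesgue_measure]_x (M * normal_pdf 0 sigma x).
    rewrite RintegralZl//; last exact: integrable_normal_pdf.
    by rewrite /Rintegral integral_normal_pdf mulr1.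
  apply: le_Rintegral => //.
  + by have := integrable_abse (ih _ bh).
  + have := integrableZl measurableT M (integrable_normal_pdf 0 sigma).
    by [].
  + move=> x _; rewrite normrM (ger0_norm (normal_pdf_ge0 _ _ _)) ler_wpM2r//.
    exact: normal_pdf_ge0.
Qed.

Lemma normal_mean d (T : measurableType d) (P : probability T R) (xi : T -> R) sigma :
  measurable_fun setT xi ->
  (forall A, measurable A -> P [set w | A (xi w)] = normal_prob 0 sigma A) ->
  forall h, bounded_rv h ->
  mean P (fun w => h (xi w)) = \int[lebesgue_measure]_x (h x * normal_pdf 0 sigma x).
Proof.
move=> mxi PE h bh.
have b1 : bounded_rv ((fun=> 1) : T -> R) by exact: bounded_rv_cst.
have n1 (w : T) : `|1 : R| <= 1 by rewrite normr1.
rewrite -(eq_mean P (f := fun w => 1 * h (xi w))) => [|w]; last by rewrite mul1r.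
apply: (bounded_functional_indic ler01 (mean_bounded_functional P b1 n1 mxi)
  (normal_bounded_functional sigma)) => // A mA.
rewrite (eq_mean P (g := \1_[set w | A (xi w)])); last first.
  by move=> w; rewrite mul1r !indicE; congr ((nat_of_bool _)%:R); rewrite !inE.
rewrite mean_indic; last by rewrite -[X in measurable X]setTI; exact: mxi.
rewrite PE// /Rintegral /normal_prob; congr fine; rewrite [LHS]integral_mkcond.
apply: eq_integral => x _; rewrite restrict_EFin/= /patch indicE.
by case: (x \in A); rewrite ?mul1r ?mul0r.
Qed.

End bounded_functionals.

Section brownian_trig.
Context {R : realType} d (T : measurableType d) (Q : probability T R).
Variable W : R -> T -> R.
Hypothesis bmW : standard_brownian_motion Q W.

Lemma brownian_increment_measurable s t : 0 <= s -> 0 <= t ->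
  measurable_fun setT (fun w => W t w - W s w).
Proof. by case: bmW => mW _ _ _ _ s0 t0; apply: measurable_funB; exact: mW. Qed.

Lemma brownian_trig s t k : 0 <= s -> s < t ->
  mean Q (fun w => cos (k * (W t w - W s w))) = expR (- (k ^+ 2 * (t - s) / 2)) /\
  mean Q (fun w => sin (k * (W t w - W s w))) = 0.
Proof.
move=> s0 st; have ts : 0 < t - s by rewrite subr_gt0.
have sg : 0 < Num.sqrt (t - s) by rewrite sqrtr_gt0.
have mk : measurable_fun setT (fun x : R => k * x) by exact: mulrl_measurable.
have mD := brownian_increment_measurable s0 (ltW (le_lt_trans s0 st)).
have law A : measurable A -> Q [set w | A (W t w - W s w)] = normal_prob 0 (Num.sqrt (t - s)) A.
  by case: bmW => _ _ _ nW _ mA; exact: nW.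
have H := normal_mean mD law; split.
  rewrite (H (fun x => cos (k * x))); last exact: bounded_rv_cos.
  have := normal_trig sg 0 k; rewrite cos0 mul1r sqr_sqrtr ?ltW// => <-.
  by apply: eq_Rintegral => x _; rewrite addr0.
rewrite (H (fun x => sin (k * x))); last exact: bounded_rv_sin.
(* The sine is the cosine with phase -pi/2, and the factor cos theta vanishes there. *)
have := normal_trig sg (- (pi / 2)) k; rewrite cosN cos_pihalf mul0r => h; rewrite -[RHS]h.
by apply: eq_Rintegral => x _; rewrite cosBpihalf.
Qed.

End brownian_trig.

(** * Lipschitz functions of finitely many points of the circle *)

Section periodic_lipschitz_functions.
Context {R : realType}.
Implicit Types (m : nat) (L : R) (K : (nat -> R) -> R) (x y : nat -> R).

(** [K] reads an infinite sequence but depends only on the classes modulo 2 pi of its first [m]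
    terms. With sequences instead of tuples, an induction on [m] can freeze the last variable by
    [upd]. *)
Definition lip_periodic m L K :=
  (forall x y, `|K x - K y| <= L * \sum_(i < m) `|x i - y i|) /\
  (forall x y, (forall i, (i < m)%N -> circle_proj (x i) = circle_proj (y i)) -> K x = K y).

Definition upd x m (v : R) : nat -> R := fun i => if i == m then v else x i.

Lemma lip_periodic_last m L K x : lip_periodic m.+1 L K ->
  lipschitz_periodic L (fun v => K (upd x m v)).
Proof.
move=> [KL KP]; split => u v.
  apply: (le_trans (KL _ _)); rewrite big_ord_recr/= big1 ?add0r /upd ?eqxx// => i _.
  by rewrite ltn_eqF// subrr normr0.
by move=> uv; apply: KP => i _; rewrite /upd; case: ifP.
Qed.

Lemma lip_periodic_front m L K v : lip_periodic m.+1 L K ->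
  lip_periodic m L (fun x => K (upd x m v)).
Proof.
move=> [KL KP]; split => x y.
  apply: (le_trans (KL _ _)); rewrite big_ord_recr/= /upd eqxx subrr normr0 addr0.
  rewrite (eq_bigr (fun i : 'I_m => `|x i - y i|))// => i _.
  by rewrite ltn_eqF.
move=> xy; apply: KP => i im; rewrite /upd; case: ifPn => // ni; apply: xy.
by rewrite ltn_neqAle ni -ltnS.
Qed.

Lemma lip_periodic_upd m L K x : lip_periodic m L K -> forall n, K (upd x n (x n)) = K x.
Proof. by move=> [KL KP] n; apply: KP => i _; rewrite /upd; case: eqP => // ->. Qed.

Lemma lip_periodic0 L K x y : lip_periodic 0 L K -> K x = K y.
Proof. by move=> [_ KP]; apply: KP. Qed.

(** [trig_partition] in the last variable alone: up to a small error, [K] is a finite sum of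
    products of a function of the first [m] variables and a trigonometric polynomial of the last
    one. The inductions on [m] below rest on this. *)
Lemma lip_periodic_partition m (eps : R) : 0 < eps ->
  exists (I : finType) (lam : I -> R -> R) (y : I -> R),
  [/\ forall l, trig_poly (lam l), forall l (v : R), 0 <= lam l v, forall v, \sum_l lam l v = 1 &
      forall K L, 0 <= L -> lip_periodic m.+1 L K ->
        forall x, `|K x - \sum_l K (upd x m (y l)) * lam l (x m)| <= L * eps].
Proof.
move=> eps0; have [I [lam [y [tl l0 l1 H]]]] := @trig_partition R eps eps0.
exists I, lam, y; split => // K L L0 KL x.
have := H _ _ L0 (lip_periodic_last x KL) (x m).
rewrite (lip_periodic_upd x KL) (eq_bigr (fun l => K (upd x m (y l)) * lam l (x m)))// => l _.
exact: mulrC.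
Qed.

Lemma trig_poly_rv (f : R -> R) : trig_poly f -> bounded_rv f.
Proof.
move=> tf; split; first by apply: continuous_measurable_fun; exact: trig_poly_continuous.
elim: tf => {f} [k|k|f g _ [M fM] _ [N gN]|c f _ [M fM]].
- by exists 1 => x; exact: cos_max.
- by exists 1 => x; exact: sin_max.
- by exists (M + N) => x; rewrite (le_trans (ler_normD _ _))// lerD.
- by exists (`|c| * M) => x; rewrite normrM ler_wpM2l.
Qed.

Lemma bounded_rv_comp_rv d (T : measurableType d) (h : R -> R) (xi : T -> R) :
  bounded_rv h -> measurable_fun setT xi -> bounded_rv (fun w => h (xi w)).
Proof.
move=> [mh [B hB]] mxi; split; first exact: measurableT_comp.
by exists B => w.
Qed.

(** Measurability comes from the uniform approximation of [K] by sums of products, whose first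
    factors are measurable by induction. *)
Lemma lip_periodic_rv d (T : measurableType d) (xi : nat -> T -> R) m L K M :
  (forall i, measurable_fun setT (xi i)) -> 0 <= L -> lip_periodic m L K ->
  (forall x, `|K x| <= M) -> bounded_rv (fun w => K (xi ^~ w)).
Proof.
move=> mxi L0; elim: m K => [|m IH] K KL KM.
  apply: (@eq_bounded_rv _ _ _ (fun=> K (fun=> 0))) => [w|]; first exact: lip_periodic0 KL.
  exact: bounded_rv_cst.
have inv0 (n : nat) : 0 < n.+1%:R^-1 :> R by rewrite invr_gt0.
have approx (n : nat) : exists u : T -> R, [/\ bounded_rv u, forall w, `|u w| <= M &
    forall w, `|K (xi ^~ w) - u w| <= L * n.+1%:R^-1].
  have [I [lam [y [tl l0 l1 H]]]] := lip_periodic_partition m (inv0 n).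
  exists (fun w => \sum_l K (upd (xi ^~ w) m (y l)) * lam l (xi m w)); split.
  - apply: bounded_rv_sum => l _; apply: bounded_rvM.
      apply: (IH (fun x => K (upd x m (y l)))); first exact: lip_periodic_front.
      by move=> x; exact: KM.
    by apply: bounded_rv_comp_rv => //; exact: trig_poly_rv.
  - move=> w; apply: (le_trans (ler_norm_sum _ _ _)).
    rewrite -[leRHS]mulr1 -(l1 (xi m w)) mulr_sumr; apply: ler_sum => l _.
    by rewrite normrM (ger0_norm (l0 _ _)) ler_wpM2r.
  - by move=> w; have := H K L L0 KL (xi ^~ w).
have [u uP] := choice approx.
apply: (@bounded_rv_cvg _ _ _ u _ M).
- by move=> n; case: (uP n) => -[].
- by move=> n; case: (uP n).
- move=> w; apply/cvgrPdist_le => e e0.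
  have c : L * n.+1%:R^-1 @[n --> \oo] --> 0.
    rewrite -(mulr0 L); apply: cvgM; first exact: cvg_cst.
    exact: (@cvg_harmonic R).
  near=> n; have [_ _ /(_ w) h] := uP n; apply: (le_trans h).
  by near: n; apply: (cvgr_le 0).
Unshelve. all: by end_near. Qed.

End periodic_lipschitz_functions.

(** * Independence of the Brownian increments *)

Section brownian_independence.
Context {R : realType} d (T : measurableType d) (Q : probability T R).
Variables (W : R -> T -> R) (h : R).
Hypotheses (bmW : standard_brownian_motion Q W) (h0 : 0 < h).
Local Notation E := (mean Q).

Definition brownian_increment (i : nat) (w : T) : R := W (i.+1%:R * h) w - W (i%:R * h) w.
Local Notation eta := brownian_increment.

Lemma brownian_increment_rv i : measurable_fun setT (eta i).
Proof. by apply: (brownian_increment_measurable bmW); rewrite mulr_ge0// ltW. Qed.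

(** Independence is given for events on all of the first [N] increments; those of index below [m]
    are left free by the condition [setT]. *)
Let cyl N m (A : nat -> set R) : set T :=
  \bigcap_(i < N) [set w | (if (m <= i)%N then A i else setT) (eta i w)].

Let m_event i B : measurable B -> measurable [set w | B (eta i w)].
Proof.
by move=> mB; rewrite -[X in measurable X]setTI; apply: brownian_increment_rv.
Qed.

Let m_cyl N m A : (forall i, measurable (A i)) -> measurable (cyl N m A).
Proof.
by move=> mA; apply: bigcap_measurableType => i _; apply: m_event; case: ifP.
Qed.

Let q i B := fine (Q [set w | B (eta i w)]).

Let prob_cyl N m A : (forall i, measurable (A i)) ->
  fine (Q (cyl N m A)) = \prod_(i < N) q i (if (m <= i)%N then A i else setT).
Proof.
move=> mA; pose A' i := if (m <= i)%N then A i else setT.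
have mA' i : measurable (A' i) by rewrite /A'; case: ifP.
have tm i : i%:R * h <= i.+1%:R * h by rewrite ler_wpM2r ?ler_nat// ltW.
have t0 : 0 <= 0%:R * h by rewrite mul0r.
case: bmW => _ _ _ _ indep.
have -> : Q (cyl N m A) = (\prod_(i < N) Q [set w | A' i (eta i w)])%E.
  exact: (indep N (fun i => i%:R * h) A' t0 tm mA').
rewrite (eq_bigr (fun i : 'I_N => (q i (A' i))%:E)); last first.
  by move=> i _; rewrite /q fineK// fin_num_measure//; exact: m_event.
by rewrite -(big_morph EFin EFinM erefl).
Qed.

Let q_setT i : q i setT = 1.
Proof.
rewrite /q (_ : [set w | _] = setT); last by apply/seteqP.
by rewrite probability_setT.
Qed.

(** Passes from events to functions one increment at a time. Multiplied by an indicator of increment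
    [m], the event on the later increments becomes a cylinder starting at [m], to which the
    induction hypothesis applies. Then [bounded_functional_indic] allows any bounded factor in
    increment [m], and the partition in that variable reaches [K]. *)
Lemma brownian_cylinder_indep N m A L M (K : (nat -> R) -> R) : (m <= N)%N ->
  (forall i, measurable (A i)) -> 0 <= L -> lip_periodic m L K -> (forall x, `|K x| <= M) ->
  E (fun w => K (eta ^~ w) * \1_(cyl N m A) w) = E (fun w => K (eta ^~ w)) * fine (Q (cyl N m A)).
Proof.
move=> + mA L0; elim: m K A mA => [|m IH] K A mA mN KL KM.
  have KE w : K (eta ^~ w) = K (fun=> 0) by exact: lip_periodic0 KL.
  rewrite (eq_mean Q (f := fun w => K (eta ^~ w)) (g := fun=> K (fun=> 0)))// mean_cst.
  rewrite -mean_indic; last exact: m_cyl.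
  rewrite -meanZ; last by apply: bounded_rv_indic; exact: m_cyl.
  by apply: eq_mean => w; rewrite KE.
have bK : bounded_rv (fun w => K (eta ^~ w)).
  exact: (lip_periodic_rv brownian_increment_rv L0 KL KM).
have b1 n A' : (forall i, measurable (A' i)) -> bounded_rv (\1_(cyl N n A') : T -> R).
  by move=> mA'; apply: bounded_rv_indic; exact: m_cyl.
pose S := cyl N m.+1 A.
pose A_ B i := if i == m then B else A i.
have mA_ B : measurable B -> forall i, measurable (A_ B i).
  by move=> mB i; rewrite /A_; case: ifP.
have cylB B w : \1_B (eta m w) * \1_S w = \1_(cyl N m (A_ B)) w :> R.
  rewrite -[RHS](_ : \1_([set w | B (eta m w)] `&` S) w = _).
    by rewrite indicI/= !indicE; congr ((nat_of_bool _)%:R * _); rewrite !inE.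
  congr (\1_ _ w); apply/seteqP; split => [v [/= Bv Sv] i /= iN|v Sv].
    rewrite /A_; have [->|im] := eqVneq i m; first by rewrite leqnn.
    have := Sv i iN; rewrite /= ltn_neqAle eq_sym im/=.
    by case: ifP.
  split => /=; first by have := Sv m mN; rewrite /= leqnn /A_ eqxx.
  move=> i iN /=; have := Sv i iN; rewrite /= /A_.
  have [->|im] := eqVneq i m; first by rewrite ltnn.
  by rewrite ltn_neqAle eq_sym im.
have qB B : measurable B -> fine (Q (cyl N m (A_ B))) = q m B * fine (Q S).
  move=> mB; rewrite !prob_cyl//; last exact: mA_.
  rewrite (bigD1 (Ordinal mN))//= leqnn {1}/A_ eqxx; congr (_ * _).
  rewrite [RHS](bigD1 (Ordinal mN))//= ltnn q_setT mul1r.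
  apply: eq_bigr => i; rewrite -val_eqE/= => im.
  by rewrite ltn_neqAle eq_sym im/= /A_ (negbTE im).
have key l v (lam : R -> R) : bounded_rv lam -> l = (fun x => K (upd x m v)) ->
    E (fun w => l (eta ^~ w) * lam (eta m w) * \1_S w) =
    E (fun w => l (eta ^~ w) * lam (eta m w)) * fine (Q S).
  move=> blam lE.
  have lL : lip_periodic m L l by rewrite lE; exact: lip_periodic_front.
  have lM x : `|l x| <= M by rewrite lE; exact: KM.
  have M0 : 0 <= M by rewrite (le_trans _ (KM (fun=> 0))).
  have bl : bounded_rv (fun w => l (eta ^~ w)).
    exact: (lip_periodic_rv brownian_increment_rv L0 lL lM).
  have bS := b1 m.+1 A mA.
  have bl1 : bounded_rv (fun w => l (eta ^~ w) * \1_S w) by exact: bounded_rvM.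
  have lM1 w : `|l (eta ^~ w) * \1_S w| <= M.
    rewrite normrM -[leRHS]mulr1 ler_pM// indicE.
    by case: (_ \in _); rewrite ?normr1 ?normr0.
  have bf1 := mean_bounded_functional Q bl1 lM1 (brownian_increment_rv m).
  have bf2 := scale_bounded_functional (fine (Q S)) M0
    (mean_bounded_functional Q bl (fun w => lM _) (brownian_increment_rv m)).
  have QS1 : `|fine (Q S)| * M <= M.
    have QSf : Q S \is a fin_num by rewrite fin_num_measure//; exact: m_cyl.
    rewrite ler_piMl// ger0_norm ?fine_ge0// -lee_fin fineK//.
    by apply: probability_le1; exact: m_cyl.
  have bf2' : bounded_functional M (fun h => fine (Q S) * E (fun w => l (eta ^~ w) * h (eta m w))).
    case: bf2 => D Z B; split => // g B' bg gB.
    apply: (le_trans (B _ _ bg gB)); rewrite ler_wpM2r//.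
    exact: le_trans (gB 0).
  have := bounded_functional_indic M0 bf1 bf2' _ blam.
  rewrite (eq_mean Q (f := fun w => l (eta ^~ w) * \1_S w * lam (eta m w))
    (g := fun w => l (eta ^~ w) * lam (eta m w) * \1_S w)); last by move=> w; rewrite mulrAC.
  rewrite mulrC; apply => B mB.
  rewrite (eq_mean Q (f := fun w => l (eta ^~ w) * \1_S w * \1_B (eta m w))
    (g := fun w => l (eta ^~ w) * \1_(cyl N m (A_ B)) w)); last first.
    by move=> w; rewrite -cylB; ring.
  rewrite (IH l (A_ B))//; [|exact: mA_|exact: ltnW].
  rewrite qB//.
  have -> : E (fun w => l (eta ^~ w) * \1_B (eta m w)) = E (fun w => l (eta ^~ w)) * q m B.
    pose A' := A_ B.
    pose C i := if i == m then B else setT : set R.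
    have mC i : measurable (C i) by rewrite /C; case: ifP.
    have CE w : \1_(cyl N m C) w = \1_B (eta m w) :> R.
      rewrite !indicE; congr ((nat_of_bool _)%:R); apply/idP/idP; rewrite !inE => h1.
        by have := h1 m mN; rewrite /= leqnn /C eqxx.
      by move=> i iN /=; rewrite /C; case: ifP => // _; have [->|] := eqVneq i m.
    rewrite (eq_mean Q (f := fun w => l (eta ^~ w) * \1_B (eta m w))
      (g := fun w => l (eta ^~ w) * \1_(cyl N m C) w)); last by move=> w; rewrite CE.
    rewrite (IH l C)//; last exact: ltnW.
    congr (_ * _); rewrite -mean_indic; last exact: m_cyl.
    rewrite /q -mean_indic; last exact: m_event.
    apply: eq_mean => w; rewrite CE !indicE; congr ((nat_of_bool _)%:R).
  by ring.
apply/eqP; rewrite -subr_eq0 -normr_le0; apply/ler_addgt0Pr => e e0; rewrite add0r.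
have M0 : 0 <= M by rewrite (le_trans _ (KM (fun=> 0))).
(* Two errors of at most L d0 have to fit in [e]; L + 1 replaces L in the denominator because L may
   be zero. *)
pose d0 := e / (2 * (L + 1)).
have L1 : 0 < 2 * (L + 1) by rewrite mulr_gt0// ltr_pwDr.
have d00 : 0 < d0 by rewrite divr_gt0.
have [I [lam [y [tl l0 l1 H]]]] := lip_periodic_partition m d00.
pose A0 w := \sum_l K (upd (eta ^~ w) m (y l)) * lam l (eta m w).
have bl l : bounded_rv (fun w => K (upd (eta ^~ w) m (y l)) * lam l (eta m w)).
  apply: bounded_rvM; last by apply: bounded_rv_comp_rv; [exact: trig_poly_rv|exact: brownian_increment_rv].
  have lL := lip_periodic_front (y l) KL.
  exact: (lip_periodic_rv brownian_increment_rv L0 lL (fun x => KM _)).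
have bA : bounded_rv A0 by apply: bounded_rv_sum.
have bS : bounded_rv (\1_S : T -> R) by exact: b1.
have HA w : `|K (eta ^~ w) - A0 w| <= L * d0 by exact: (H K L L0 KL (eta ^~ w)).
have EA : E (fun w => A0 w * \1_S w) = E A0 * fine (Q S).
  rewrite mean_sum// mulr_suml.
  rewrite (eq_mean Q (g := fun w => \sum_l K (upd (eta ^~ w) m (y l)) * lam l (eta m w) * \1_S w)); last first.
    by move=> w; rewrite mulr_suml.
  rewrite mean_sum; last by move=> l _; exact: bounded_rvM.
  apply: eq_bigr => l _; apply: (key (fun x => K (upd x m (y l))) (y l)) => //.
  exact: trig_poly_rv.
have -> : E (fun w => K (eta ^~ w) * \1_S w) - E (fun w => K (eta ^~ w)) * fine (Q S) =
   E (fun w => (K (eta ^~ w) - A0 w) * \1_S w) - E (fun w => K (eta ^~ w) - A0 w) * fine (Q S).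
  rewrite (eq_mean Q (f := fun w => (K (eta ^~ w) - A0 w) * \1_S w)
    (g := fun w => K (eta ^~ w) * \1_S w - A0 w * \1_S w)); last by move=> w; rewrite mulrBl.
  rewrite meanB; try bounded_rv_tac.
  by rewrite meanB; try bounded_rv_tac; rewrite EA; ring.
have QS1 : `|fine (Q S)| <= 1.
  have QSf : Q S \is a fin_num by rewrite fin_num_measure//; exact: m_cyl.
  rewrite ger0_norm ?fine_ge0// -lee_fin fineK//.
  by apply: probability_le1; exact: m_cyl.
have Ld : 0 <= L * d0 by rewrite mulr_ge0// ltW.
apply: (le_trans (ler_normB _ _)).
have -> : e = (L + 1) * d0 + (L + 1) * d0.
  by rewrite /d0; field; rewrite gt_eqF//; lra.
have Ld1 : L * d0 <= (L + 1) * d0 by rewrite ler_wpM2r ?lerDl// ltW.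
apply: lerD; apply: le_trans Ld1.
  apply: normr_mean_le_cst => [|w]; first by bounded_rv_tac.
  rewrite normrM -[leRHS]mulr1 ler_pM// indicE.
  by case: (_ \in _); rewrite ?normr1 ?normr0.
rewrite normrM -[leRHS]mulr1 ler_pM//.
by apply: normr_mean_le_cst => //; bounded_rv_tac.
Qed.

(** The case N = m + 1 of the preceding result constrains the single increment [m]; the passage from
    indicators to bounded functions is again [bounded_functional_indic]. *)
Lemma brownian_increment_indep m L M (K : (nat -> R) -> R) (lam : R -> R) :
  0 <= L -> lip_periodic m L K -> (forall x, `|K x| <= M) -> bounded_rv lam ->
  E (fun w => K (eta ^~ w) * lam (eta m w)) = E (fun w => K (eta ^~ w)) * E (fun w => lam (eta m w)).
Proof.
move=> L0 KL KM blam.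
have M0 : 0 <= M by rewrite (le_trans _ (KM (fun=> 0))).
have bK : bounded_rv (fun w => K (eta ^~ w)).
  exact: (lip_periodic_rv brownian_increment_rv L0 KL KM).
have b1 : bounded_rv ((fun=> 1) : T -> R) by exact: bounded_rv_cst.
have n1 (w : T) : `|1 : R| <= 1 by rewrite normr1.
have bf1 := mean_bounded_functional Q bK (fun w => KM _) (brownian_increment_rv m).
have bf2 := scale_bounded_functional (E (fun w => K (eta ^~ w))) ler01
  (mean_bounded_functional Q b1 n1 (brownian_increment_rv m)).
have bf2' : bounded_functional M (fun h => E (fun w => K (eta ^~ w)) * E (fun w => 1 * h (eta m w))).
  case: bf2 => D Z B; split => // g B' bg gB.
  apply: (le_trans (B _ _ bg gB)); rewrite mulr1 ler_wpM2r//; first exact: le_trans (gB 0).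
  exact: normr_mean_le_cst.
rewrite (eq_mean Q (f := fun w => lam (eta m w)) (g := fun w => 1 * lam (eta m w))); last first.
  by move=> w; rewrite mul1r.
apply: (bounded_functional_indic M0 bf1 bf2') => // B mB.
pose C i := if i == m then B else setT : set R.
have mC i : measurable (C i) by rewrite /C; case: ifP.
have CE w : \1_(cyl m.+1 m C) w = \1_B (eta m w) :> R.
  rewrite !indicE; congr ((nat_of_bool _)%:R); apply/idP/idP; rewrite !inE => h1.
    by have := h1 m (ltnSn m); rewrite /= leqnn /C eqxx.
  by move=> i iN /=; rewrite /C; case: ifP => // _; have [->|] := eqVneq i m.
rewrite (eq_mean Q (f := fun w => K (eta ^~ w) * \1_B (eta m w))
  (g := fun w => K (eta ^~ w) * \1_(cyl m.+1 m C) w)); last by move=> w; rewrite CE.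
rewrite (brownian_cylinder_indep (leqnSn m) mC L0 KL KM); congr (_ * _).
rewrite -mean_indic; last exact: m_cyl.
by apply: eq_mean => w; rewrite CE mul1r.
Qed.

End brownian_independence.

(** * Convergence of functionals of the increments *)

Lemma cvg_finsum {R : realType} (I J : Type) (F : set_system I) {FF : ProperFilter F}
    (s : seq J) (f : J -> I -> R) (l : J -> R) :
  (forall j, f j x @[x --> F] --> l j) ->
  \sum_(j <- s) f j x @[x --> F] --> \sum_(j <- s) l j.
Proof.
move=> fl; elim: s => [|j s IH].
  rewrite big_nil (_ : (fun x => _) = fun=> 0); first exact: cvg_cst.
  by apply/funext => x; rewrite big_nil.
rewrite big_cons (_ : (fun x => _) = (fun x => f j x + \sum_(j <- s) f j x)).
  by apply: cvgD => //; exact: fl.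
by apply/funext => x; rewrite big_cons.
Qed.

Section telegraph_increments.
Context {R : realType} d (T : measurableType d) (P : probability T R).
Variables (a : R) (Y : R -> T -> R) (h : R).
Hypotheses (a0 : 0 < a) (chainY : sign_chain P a Y) (h0 : 0 < h).

Definition telegraph_increment (i : nat) (w : T) : R :=
  Yint Y (i%:R * h * a) (i.+1%:R * h * a) w.
Local Notation xi := telegraph_increment.

Let time_ge0 i : 0 <= i%:R * h * a.
Proof. by rewrite !mulr_ge0 ?ler0n ?(ltW h0) ?(ltW a0). Qed.

Let time_lt i : i%:R * h * a < i.+1%:R * h * a.
Proof. by rewrite !ltr_pM2r// ltr_nat. Qed.

Let time_le i j : (i <= j)%N -> i%:R * h * a <= j%:R * h * a.
Proof. by move=> ij; rewrite !ler_pM2r// ler_nat. Qed.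

Lemma telegraph_increment_rv i : measurable_fun setT (xi i).
Proof. by apply: bounded_rv_measurable; apply: (Yint_rv chainY). Qed.

Lemma finite_past_seq s m (g : nat -> T -> R) (K : (nat -> R) -> R) :
  (forall i, (i < m)%N -> finite_past Y s (g i)) ->
  (forall x y, (forall i, (i < m)%N -> x i = y i) -> K x = K y) ->
  finite_past Y s (fun w => K (g ^~ w)).
Proof.
move=> gp KE.
have /choice[F FP] (i : nat) : exists tp : seq R * ((R -> R) -> R), (i < m)%N ->
  [/\ {in tp.1, forall u, 0 <= u <= s},
      (forall y y', {in tp.1, y =1 y'} -> tp.2 y = tp.2 y') &
      forall w, g i w = tp.2 (Y ^~ w)].
  have [im|mi] := ltnP i m; last by exists ([::], fun=> 0).
  by have [ts [phi H]] := gp i im; exists (ts, phi).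
exists (flatten [seq (F i).1 | i <- iota 0 m]), (fun y => K (fun i => (F i).2 y)); split.
- move=> u /flatten_mapP[i]; rewrite mem_iota add0n => /andP[_ im] ui.
  by have [h1 _ _] := FP i im; exact: h1.
- move=> y y' yy'; apply: KE => i im; have [_ h2 _] := FP i im.
  apply: h2 => u ui; apply: yy'; apply/flatten_mapP; exists i => //.
  by rewrite mem_iota.
- by move=> w; apply: KE => i im; have [_ _ h3] := FP i im.
Qed.

(** The approximants required by [past] replace each integral by its Riemann sums; the Lipschitz
    bound on [K] makes them converge. *)
Lemma telegraph_past m L M (K : (nat -> R) -> R) : 0 <= L -> lip_periodic m L K ->
  (forall x, `|K x| <= M) -> past Y (m%:R * h * a) (fun w => K (xi ^~ w)).
Proof.
move=> L0 KL KM.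
pose v n i := Yriemann Y (i%:R * h * a) (i.+1%:R * h * a) n.
exists (fun n w => K (fun i => v n i w)), M; split => //.
- move=> n; apply: (@finite_past_seq _ m (v n)) => [i im|x y xy].
    apply: (finite_past_le (time_le im)); apply: Yriemann_past => //.
    exact: ltW.
  by case: KL => _ KP; apply: KP => i im; rewrite xy.
- move=> w; apply/cvgrPdist_le => e e0.
  have c : L * \sum_(i < m) `|xi i w - v n i w| @[n --> \oo] --> 0.
    rewrite -[X in _ --> X](mulr0 L); apply: cvgM; first exact: cvg_cst.
    rewrite [X in _ --> X](_ : 0 = \sum_(i < m) 0 :> R); last by rewrite big1.
    apply: (cvg_finsum (f := fun (i : 'I_m) n => `|xi i w - v n i w|) (l := fun=> 0)) => i; rewrite -[X in _ --> X](@normr0 _ R) -(subrr (xi i w)).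
    apply: cvg_norm; apply: cvgB; first exact: cvg_cst.
    exact: (Yriemann_cvg chainY).
  near=> n; case: KL => KL _; apply: (le_trans (KL _ _)).
  by near: n; apply: (cvgr_le 0).
Unshelve. all: by end_near. Qed.

End telegraph_increments.

Section increments_convergence.
Context {R : realType}.
Variables (d : R -> measure_display) (Om : forall a : R, measurableType (d a))
  (P : forall a : R, probability (Om a) R) (Y : forall a : R, R -> Om a -> R).
Arguments Y : clear implicits.
Hypothesis chainY : forall a : R, 0 < a -> sign_chain (P a) a (Y a).
Variables (d' : measure_display) (Om' : measurableType d') (Q : probability Om' R)
  (W : R -> Om' -> R).
Hypothesis bmW : standard_brownian_motion Q W.
Variable h : R.
Hypothesis h0 : 0 < h.
Local Notation xi a := (telegraph_increment a (Y a) h).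
Local Notation eta := (brownian_increment W h).

(** By linearity it is enough to treat one cosine and one sine, for which the factors given by
    [Yint_decoupling] and [brownian_trig] agree. *)
Lemma trig_decoupling m L M (K : (nat -> R) -> R) (lam : R -> R) : trig_poly lam ->
  0 <= L -> lip_periodic m L K -> (forall x, `|K x| <= M) ->
  mean (P a) (fun w => K (fun i => xi a i w) * lam (xi a m w)) -
  mean (P a) (fun w => K (fun i => xi a i w)) * mean Q (fun w => lam (eta m w))
  @[a --> +oo%R] --> 0.
Proof.
move=> tlam L0 KL KM.
have M0 : 0 <= M by rewrite (le_trans _ (KM (fun=> 0))).
have M1 : 0 < M + 1 by rewrite ltr_pwDr.
have bK a : 0 < a -> bounded_rv (fun w => K (fun i => xi a i w)).
  move=> a0; apply: (lip_periodic_rv (fun i => telegraph_increment_rv a0 (chainY a0) h0 i) L0 KL KM).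
have bxi a f : 0 < a -> trig_poly f -> bounded_rv (fun w => f (xi a m w)).
  move=> a0 tf; apply: bounded_rv_comp_rv; first exact: trig_poly_rv.
  exact: (telegraph_increment_rv a0 (chainY a0) h0).
have beta f : trig_poly f -> bounded_rv (fun w => f (eta m w)).
  move=> tf; apply: bounded_rv_comp_rv; first exact: trig_poly_rv.
  exact: (brownian_increment_rv bmW h0).
have s0 : 0 <= m%:R * h by rewrite mulr_ge0 ?ler0n ?(ltW h0).
have st : m%:R * h < m.+1%:R * h by rewrite ltr_pM2r// ltr_nat.
have base k e : 0 < e -> \forall a \near +oo%R, [/\ 0 < a,
    `|mean (P a) (fun w => K (fun i => xi a i w) * cos (k * xi a m w)) -
      mean (P a) (fun w => K (fun i => xi a i w)) * mean Q (fun w => cos (k * eta m w))| <= e &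
    `|mean (P a) (fun w => K (fun i => xi a i w) * sin (k * xi a m w))| <= e].
  move=> e0; have e1 : 0 < e / (M + 1) by rewrite divr_gt0.
  have [A A0 HA] := Yint_decoupling k s0 st e1.
  near=> a; have Aa : A <= a by near: a; apply: nbhs_pinfty_ge; exact: num_real.
  have a0 : 0 < a by exact: lt_le_trans Aa.
  (* [Yint_decoupling] asks for |f| <= 1; the divisor M + 1 is positive even when M = 0. *)
  pose f w := (M + 1)^-1 * K (fun i => xi a i w).
  have pf : past (Y a) (m%:R * h * a) f.
    apply: pastM; last exact: (telegraph_past a0 (chainY a0) h0 L0 KL KM).
    apply: (past_finite (chainY a0)); last exact: finite_past_cst.
    by rewrite mulr_ge0// ltW.
  have f1 w : `|f w| <= 1.
    rewrite /f normrM ger0_norm ?invr_ge0 ?(ltW M1)// mulrC ler_pdivrMr// mul1r.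
    by rewrite (le_trans (KM _))// lerDl.
  have [hc hs] := HA a Aa _ _ (P a) (Y a) (chainY a0) f pf f1.
  have bc : bounded_rv (fun w => cos (k * xi a m w)) := bxi a _ a0 (trig_poly_cos k).
  have bs : bounded_rv (fun w => sin (k * xi a m w)) := bxi a _ a0 (trig_poly_sin k).
  have bKa := bK a a0.
  have [-> _] := brownian_trig bmW k s0 st.
  split => //.
    move: hc; rewrite (eq_mean (P a) (f := fun w => f w * cos (k * Yint (Y a) (m%:R * h * a) (m.+1%:R * h * a) w))
       (g := fun w => (M + 1)^-1 * (K (fun i => xi a i w) * cos (k * xi a m w)))); last first.
      by move=> w; rewrite /f mulrA.
    rewrite meanZ; last exact: bounded_rvM.
    rewrite /f meanZ// [X in _ - X]mulrCA -mulrBr normrM ger0_norm ?invr_ge0 ?(ltW M1)//.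
    by rewrite mulrC ler_pM2r ?invr_gt0// [expR _ * _]mulrC.
  move: hs; rewrite (eq_mean (P a) (f := fun w => f w * sin (k * Yint (Y a) (m%:R * h * a) (m.+1%:R * h * a) w))
     (g := fun w => (M + 1)^-1 * (K (fun i => xi a i w) * sin (k * xi a m w)))); last first.
    by move=> w; rewrite /f mulrA.
  rewrite meanZ; last exact: bounded_rvM.
  rewrite normrM ger0_norm ?invr_ge0 ?(ltW M1)//.
  by rewrite mulrC ler_pM2r ?invr_gt0.
elim: tlam => {lam} [k|k|f g tf IHf tg IHg|c f tf IHf].
- apply/cvgrPdist_le => e e0; have := base k e e0.
  by apply: filterS => a [_ + _]; rewrite sub0r normrN.
- apply/cvgrPdist_le => e e0; have := base k e e0.
  have [_ ->] := brownian_trig bmW k s0 st.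
  by apply: filterS => a [_ _]; rewrite mulr0 subr0 sub0r normrN.
- rewrite -(addr0 0); apply: cvg_trans (cvgD IHf IHg); apply: near_eq_cvg; near=> a.
  have a0 : 0 < a by near: a; apply: nbhs_pinfty_gt; exact: num_real.
  have bKa := bK a a0; have bf := bxi a f a0 tf; have bg := bxi a g a0 tg.
  have bf' := beta f tf; have bg' := beta g tg.
  rewrite [X in _ = _ - _ * X]meanD//.
  rewrite (eq_mean (P a) (f := fun w => K (fun i => xi a i w) * (f (xi a m w) + g (xi a m w)))
    (g := fun w => K (fun i => xi a i w) * f (xi a m w) + K (fun i => xi a i w) * g (xi a m w))).
    by rewrite meanD; [rewrite !fctE /=; ring|exact: bounded_rvM|exact: bounded_rvM].
  by move=> w; rewrite mulrDr.
- rewrite -(mulr0 c); apply: cvg_trans (cvgM (cvg_cst c) IHf); apply: near_eq_cvg; near=> a.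
  have a0 : 0 < a by near: a; apply: nbhs_pinfty_gt; exact: num_real.
  have bKa := bK a a0; have bf := bxi a f a0 tf; have bf' := beta f tf.
  rewrite [X in _ = _ - _ * X]meanZ//.
  rewrite (eq_mean (P a) (f := fun w => K (fun i => xi a i w) * (c * f (xi a m w)))
    (g := fun w => c * (K (fun i => xi a i w) * f (xi a m w)))).
    by rewrite meanZ; [rewrite /= mulrBr [X in _ - X]mulrCA|exact: bounded_rvM].
  by move=> w; rewrite mulrCA.
Unshelve. all: by end_near. Qed.

(** The partition splits off the last increment. Its trigonometric weight decouples from the others
    in the limit on the telegraph side and is independent of them on the Brownian side; the
    induction hypothesis treats the other factor. The approximation error is at most L e' for all
    [a]. *)
Lemma increments_cvg m L M (K : (nat -> R) -> R) :
  0 <= L -> lip_periodic m L K -> (forall x, `|K x| <= M) ->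
  mean (P a) (fun w => K (fun i => xi a i w)) @[a --> +oo%R] --> mean Q (fun w => K (eta ^~ w)).
Proof.
move=> L0; elim: m K => [|m IH] K KL KM.
  have KE x : K x = K (fun=> 0) by exact: lip_periodic0 KL.
  rewrite (eq_mean Q (g := fun=> K (fun=> 0)))// mean_cst.
  apply: cvg_near_cst; near=> a.
  by rewrite (eq_mean (P a) (g := fun=> K (fun=> 0)))// mean_cst.
have bK a : 0 < a -> bounded_rv (fun w => K (fun i => xi a i w)).
  move=> a0; apply: (lip_periodic_rv (fun i => telegraph_increment_rv a0 (chainY a0) h0 i) L0 KL KM).
have bK' : bounded_rv (fun w => K (eta ^~ w)).
  exact: (lip_periodic_rv (brownian_increment_rv bmW h0) L0 KL KM).
apply/cvgrPdist_le => e e0.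
pose e' := e / (3 * (L + 1)).
have L1 : 0 < L + 1 by rewrite ltr_pwDr.
have e'0 : 0 < e' by rewrite divr_gt0// mulr_gt0.
have Le : L * e' <= e / 3.
  apply: (@le_trans _ _ ((L + 1) * e')); first by rewrite ler_wpM2r ?lerDl// ltW.
  by rewrite le_eqVlt; apply/orP; left; apply/eqP; rewrite /e'; field; rewrite gt_eqF.
have [I [lam [y [tl l0 l1 H]]]] := lip_periodic_partition m e'0.
pose Kl l x := K (upd x m (y l)).
have KlL l : lip_periodic m L (Kl l) := lip_periodic_front (y l) KL.
have KlM l x : `|Kl l x| <= M := KM _.
have bl a l : 0 < a -> bounded_rv (fun w => Kl l (fun i => xi a i w) * lam l (xi a m w)).
  move=> a0; apply: bounded_rvM.
    exact: (lip_periodic_rv (fun i => telegraph_increment_rv a0 (chainY a0) h0 i) L0 (KlL l) (KlM l)).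
  apply: bounded_rv_comp_rv; first exact: trig_poly_rv.
  exact: (telegraph_increment_rv a0 (chainY a0) h0).
have bl' l : bounded_rv (fun w => Kl l (eta ^~ w) * lam l (eta m w)).
  apply: bounded_rvM.
    exact: (lip_periodic_rv (brownian_increment_rv bmW h0) L0 (KlL l) (KlM l)).
  apply: bounded_rv_comp_rv; first exact: trig_poly_rv.
  exact: (brownian_increment_rv bmW h0).
pose S a := \sum_l mean (P a) (fun w => Kl l (fun i => xi a i w) * lam l (xi a m w)).
pose S' := \sum_l mean Q (fun w => Kl l (eta ^~ w) * lam l (eta m w)).
have cS : S a @[a --> +oo%R] --> S'.
  apply: (cvg_finsum (f := fun l a => mean (P a) (fun w => Kl l (fun i => xi a i w) * lam l (xi a m w)))) => l.
  rewrite (brownian_increment_indep bmW h0 L0 (KlL l) (KlM l) (trig_poly_rv (tl l))).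
  have c1 := trig_decoupling (tl l) L0 (KlL l) (KlM l).
  have c2 : mean (P a) (fun w => Kl l (fun i => xi a i w)) * mean Q (fun w => lam l (eta m w))
     @[a --> +oo%R] --> mean Q (fun w => Kl l (eta ^~ w)) * mean Q (fun w => lam l (eta m w)).
    by apply: cvgM; [exact: (IH _ (KlL l) (KlM l))|exact: cvg_cst].
  rewrite -[X in _ --> X]add0r; apply: cvg_trans (cvgD c1 c2).
  apply: near_eq_cvg; near=> a.
  by rewrite !fctE /= subrK.
have hS' : `|mean Q (fun w => K (eta ^~ w)) - S'| <= e / 3.
  rewrite /S' -mean_sum// -meanB//; last exact: bounded_rv_sum.
  apply: le_trans Le; apply: normr_mean_le_cst.
    by apply: bounded_rvB => //; exact: bounded_rv_sum.
  by move=> w; exact: (H K L L0 KL (eta ^~ w)).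
near=> a.
have a0 : 0 < a by near: a; apply: nbhs_pinfty_gt; exact: num_real.
have hS : `|mean (P a) (fun w => K (fun i => xi a i w)) - S a| <= e / 3.
  have bla l := bl a l a0; have bKa := bK a a0.
  rewrite /S -mean_sum// -meanB//; last exact: bounded_rv_sum.
  apply: le_trans Le; apply: normr_mean_le_cst.
    by apply: bounded_rvB => //; exact: bounded_rv_sum.
  by move=> w; exact: (H K L L0 KL (fun i => xi a i w)).
have hSS : `|S' - S a| <= e / 3.
  by near: a; move/cvgrPdist_le : cS; apply; rewrite divr_gt0.
move: hS hS' hSS; rewrite (distrC _ (S a)).
set u := mean Q _; set v := mean (P a) _ => hv hu huv.
have -> : u - v = (u - S') + (S' - S a) + (S a - v) by ring.
apply: (le_trans (ler_normD _ _)); apply: (@le_trans _ _ (e / 3 + e / 3 + e / 3)).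
  by rewrite lerD// (le_trans (ler_normD _ _))// lerD.
by rewrite le_eqVlt; apply/orP; left; apply/eqP; field.
Unshelve. all: by end_near. Qed.

End increments_convergence.

(** * Semicontinuous approximation on path space *)

Section path_space_topology.
Context {R : realType}.
Implicit Types (f g : path_space R) (t : pos_time R).

Definition window (k : nat) : set (pos_time R) :=
  [set t | k.+1%:R^-1 <= \val t <= k.+1%:R].

Lemma pos_timeP t : 0 < \val t.
Proof. by case: t => x /= /set_mem. Qed.

(** Both t and 1/t are continuous on the positive times, hence bounded on a compact set. *)
Lemma compact_window (A : set (pos_time R)) : compact A ->
  exists k0, forall k, (k0 <= k)%N -> A `<=` window k.
Proof.
move=> cA.
have cv : continuous (\val : pos_time R -> R) by exact: initial_continuous.
have ci : continuous (fun t : pos_time R => (\val t)^-1).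
  move=> t; apply: (@continuous_comp _ _ _ (\val : pos_time R -> R) GRing.inv); first exact: cv.
  by apply: inv_continuous; rewrite gt_eqF// pos_timeP.
have bnd (h : pos_time R -> R) : continuous h -> exists k0 : nat, forall t, A t -> h t <= k0%:R.
  move=> ch.
  have : compact (h @` A) by apply: continuous_compact => //; exact: continuous_subspaceT.
  move=> /compact_bounded[M [_ /(_ (M + 1))]].
  rewrite ltrDl ltr01 => /(_ isT) hM.
  exists (Num.truncn (M + 1)).+1 => t At.
  apply: (le_trans (ler_norm _)); apply: (@le_trans _ _ (M + 1)); last exact/ltW/truncnS_gt.
  by apply: hM; exists t.
have [k1 H1] := bnd _ cv; have [k2 H2] := bnd _ ci.
exists (maxn k1 k2) => k; rewrite geq_max => /andP[k1k k2k] t At; apply/andP; split.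
  rewrite -[leRHS]invrK lef_pV2 ?posrE ?invr_gt0 ?pos_timeP//.
  by rewrite (le_trans (H2 _ At))// ler_nat leqW.
by rewrite (le_trans (H1 _ At))// ler_nat leqW.
Qed.

(** The index [k] sets both the window and the precision, since the windows end up containing any
    given compact set of times. *)
Lemma path_space_cvg (g : nat -> path_space R) f :
  (forall k t, window k t -> circle_ball (f t) k.+1%:R^-1 (g k t)) ->
  g k @[k --> \oo] --> f.
Proof.
move=> gf.
have fam : ((fun k => (g k : pos_time R -> circle R)) @ \oo --> (f : {family compact, pos_time R -> circle R})).
  apply/fam_cvgP => A cA P /uniform_nbhs[E [entE EP]].
  have [e /= e0 eE] : exists2 e : R, 0 < e & [set xy : circle R * circle R | circle_ball xy.1 e xy.2] `<=` E.
    by case: entE => e e0 eE; exists e.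
  have [k0 Hk] := compact_window cA.
  suff h : \forall k \near \oo, P (g k : pos_time R -> circle R) by exact: h.
  near=> k; apply: EP => t At; apply: eE => /=.
  have ke : k.+1%:R^-1 <= e.
    rewrite -[e]invrK lef_pV2 ?posrE ?invr_gt0//.
    have : e^-1 < k%:R by near: k; exact: nbhs_infty_gtr.
    by move=> /ltW /le_trans; apply; rewrite ler_nat.
  have kt : window k t by apply: Hk At; near: k; exact: nbhs_infty_ge.
  have [x [y [xf yg xy]]] := gf k t kt.
  by exists x, y; split => //; exact: lt_le_trans ke.
move=> U hU; case: hU => V hV; case: hV => hO Vf VU; case: hO => O oO OV.
have {Vf} Of : O (f : pos_time R -> circle R) by move: Vf; rewrite /= -OV.
have : nbhs (f : {family compact, pos_time R -> circle R}) O.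
  by rewrite nbhsE; exists O.
move=> /fam h.
have {}h : \forall k \near \oo, O (g k : pos_time R -> circle R) by exact: h.
suff h' : \forall k \near \oo, U (g k) by exact: h'.
by apply: filterS h => k Ok; apply: VU; rewrite -OV.
Unshelve. all: by end_near. Qed.

(** By contradiction: if every [k] failed, the paths witnessing the failures would form a sequence
    converging to [f] whose images by [F] stay at distance [eta] from [F f]. *)
Lemma continuous_modulus (F : path_space R -> R) f eta : continuous F -> 0 < eta ->
  exists k, forall g, (forall t, window k t -> circle_ball (f t) k.+1%:R^-1 (g t)) ->
    `|F f - F g| < eta.
Proof.
move=> cF eta0; apply: contrapT => /forallNP h.
have /choice[g gP] (k : nat) : exists g : path_space R,
    (forall t, window k t -> circle_ball (f t) k.+1%:R^-1 (g t)) /\ eta <= `|F f - F g|.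
  have /existsNP[g /not_implyP[h1 /negP]] := h k.
  by rewrite -leNgt => h2; exists g.
have : F (g k) @[k --> \oo] --> F f.
  by apply: continuous_cvg; [exact: cF|apply: path_space_cvg => k; case: (gP k)].
move=> /cvgrPdist_lt/(_ eta eta0)[N _ /(_ N (leqnn N))] /=.
by rewrite ltNge; case: (gP N) => _ ->.
Qed.

End path_space_topology.

(** * Uniform continuity on bounded time intervals *)

Section heine.
Context {R : realType}.

(** Heine's theorem with [y] allowed beyond [b], because the dyadic time following [x] may exceed
    [b]. Bolzano-Weierstrass is applied to the first points of the bad pairs; the second points have
    the same limit. *)
Lemma continuous_uniform (f : R -> R) (b e : R) : {within `[0, +oo[, continuous f} -> 0 < e ->
  exists N : nat, forall x y : R, 0 <= x <= b -> 0 <= y -> `|x - y| <= N.+1%:R^-1 -> `|f x - f y| < e.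
Proof.
move=> cf e0; apply: contrapT => /forallNP h.
have /choice[u uP] (n : nat) : exists p : R * R,
    [/\ 0 <= p.1 <= b, 0 <= p.2, `|p.1 - p.2| <= n.+1%:R^-1 & e <= `|f p.1 - f p.2|].
  have /existsNP[x /existsNP[y /not_implyP[xb /not_implyP[y0 /not_implyP[xy /negP]]]]] := h n.
  by rewrite -leNgt => exy; exists (x, y).
have [phi iphi cphi] : exists2 phi : nat -> nat, increasing_seq phi & cvgn ((fun n => (u n).1) \o phi).
  apply: bolzano_weierstrass; exists b; split; first exact: num_real.
  move=> M bM n _ /=; have [/andP[u0 ub] _ _ _] := uP n.
  by rewrite ger0_norm// (le_trans ub)// ltW.
have phi_ge n : (n <= phi n)%N.
  elim: n => // n IH; apply: (leq_ltn_trans IH).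
  by move/increasing_seqP : iphi; exact.
pose c := limn ((fun n => (u n).1) \o phi).
have cc : (u (phi n)).1 @[n --> \oo] --> c by exact: cphi.
have c0 : 0 <= c.
  by apply: (cvgr_to_ge cc); near=> n; have [/andP[]] := uP (phi n).
have e2 : 0 < e / 2 by rewrite divr_gt0.
have /subspace_continuousP/(_ c) := cf.
rewrite /= in_itv/= c0 => /(_ isT)/cvgrPdist_lt/(_ _ e2).
rewrite /prop_near1/= withinE => hc.
case: hc => V Vc VE; move: Vc => /nbhs_ballP[delta /= d0 dV].
have near_c (y : R) : 0 <= y -> `|c - y| < delta -> `|f c - f y| < e / 2.
  move=> y0 cy; have : (V `&` `[0, +oo[) y.
    by split; [exact: dV|rewrite /= in_itv/= y0].
  by rewrite -VE => -[].
have d2 : 0 < delta / 2 by rewrite divr_gt0.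
suff hF : \forall n \near \oo, False by have /= [N _ /(_ N (leqnn N))] := hF.
near=> n.
have [/andP[u0 _] v0 uv euv] := uP (phi n).
have cu : `|c - (u (phi n)).1| < delta / 2.
  by near: n; move/cvgrPdist_lt: cc => /(_ _ d2).
have nd : (phi n).+1%:R^-1 < delta / 2.
  apply: (@le_lt_trans _ _ n.+1%:R^-1).
    by rewrite lef_pV2 ?posrE// ler_nat ltnS.
  by near: n; exact: (near_infty_natSinv_lt (PosNum d2)).
have fu : `|f c - f (u (phi n)).1| < e / 2.
  by apply: near_c => //; move: cu d0; lra.
have fv : `|f c - f (u (phi n)).2| < e / 2.
  apply: near_c => //.
  have := ler_distD (u (phi n)).1 c (u (phi n)).2.
  by move: cu uv nd; move: (phi n).+1%:R^-1 => z; lra.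
have := ler_distD (f c) (f (u (phi n)).1) (f (u (phi n)).2).
by rewrite [`|f (u (phi n)).1 - f c|]distrC; move: fu fv euv; lra.
Unshelve. all: by end_near. Qed.
End heine.

(** * Inf-convolutions of a functional *)

Section lower_envelope.
Context {R : realType}.
Variables (F : path_space R -> R) (M : R).
Hypothesis FM : forall f, `|F f| <= M.
Implicit Types (x y : pos_time R -> circle R) (k : nat).

(* [M] is put in the set because a discontinuous [x] may have no continuous path
   close to it. *)
Definition envelope_set k x : set R :=
  [set r | r = M \/ exists (g : path_space R) (e : R),
    [/\ 0 < e, forall t, window k t -> circle_ball (x t) e (g t) & r = F g + k.+1%:R * e]].

Definition envelope k x : R := inf (envelope_set k x).

Let F_ge f : - M <= F f. Proof. by have := FM f; rewrite ler_norml => /andP[]. Qed.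
Let F_le f : F f <= M. Proof. by have := FM f; rewrite ler_norml => /andP[]. Qed.

Let path0 : path_space R := cst (circle_proj 0).

Lemma envelope_setM k x : envelope_set k x M. Proof. by left. Qed.

Lemma envelope_ge_lbound k x (r : R) : r <= M ->
  (forall (g : path_space R) (e : R), 0 < e ->
    (forall t, window k t -> circle_ball (x t) e (g t)) -> r <= F g + k.+1%:R * e) ->
  r <= envelope k x.
Proof.
move=> rM h; apply: lb_le_inf; first by exists M; exact: envelope_setM.
by move=> _ [->//|[g [e [e0 xg ->]]]]; exact: h.
Qed.

Lemma envelope_lbound k x : has_lbound (envelope_set k x).
Proof.
exists (- M) => _ [->|[g [e [e0 _ ->]]]].
  by rewrite (le_trans (F_ge path0)).
by rewrite (le_trans (F_ge g))// lerDl mulr_ge0// ltW.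
Qed.

Lemma envelope_le_path (f : path_space R) k : envelope k f <= F f.
Proof.
apply/ler_addgt0Pr => e e0.
have k0 : k.+1%:R != 0 :> R by rewrite gt_eqF// ltr0n.
have -> : F f + e = F f + k.+1%:R * (e / k.+1%:R) by field.
apply: ge_inf; first exact: (envelope_lbound k f).
right; exists f, (e / k.+1%:R); split => //; first by rewrite divr_gt0.
by move=> t _; apply: circle_ball_center; rewrite divr_gt0.
Qed.

Lemma envelope_bound k x : `|envelope k x| <= M.
Proof.
rewrite ler_norml; apply/andP; split; last first.
  by apply: ge_inf; [exact: (envelope_lbound k x)|exact: envelope_setM].
apply: envelope_ge_lbound; first exact: (le_trans (F_ge path0) (F_le path0)).
by move=> g e e0 _; rewrite (le_trans (F_ge g))// lerDl mulr_ge0// ltW.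
Qed.

(** A competitor at distance [e] from [x] is a competitor at distance e + s from [y], so its penalty
    grows by (k + 1)s. The case s = 0 is included: it shows that only the values on the window
    matter. *)
Let envelope_lip1 k x y (s : R) : 0 <= s ->
  (forall t, window k t -> exists u v : R,
    [/\ circle_proj u = x t, circle_proj v = y t & `|u - v| <= s]) ->
  envelope k y <= envelope k x + k.+1%:R * s.
Proof.
move=> s0 xy; rewrite -lerBlDr; apply: envelope_ge_lbound.
  have := envelope_bound k y; rewrite ler_norml => /andP[_ /le_trans]; rewrite lerBlDr; apply.
  by rewrite lerDl mulr_ge0.
move=> g e e0 xg; rewrite lerBlDr -addrA -mulrDr.
apply: ge_inf; first exact: (envelope_lbound k y).
right; exists g, (e + s); split => //; first exact: ltr_wpDr.
move=> t kt; have [u [v [ux vy uv]]] := xy t kt; have [p [q [px qg pq]]] := xg t kt.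
exists (v + (p - u)), q; split => //.
  rewrite -vy; apply/circle_projP; rewrite /circle_rel addrAC subrr add0r.
  by apply/circle_projP; rewrite ux px.
have -> : v + (p - u) - q = (p - q) + (v - u) by ring.
by rewrite (le_lt_trans (ler_normD _ _))// [`|v - u|]distrC ltr_leD.
Qed.

Lemma envelope_lip k x y (s : R) : 0 <= s ->
  (forall t, window k t -> exists u v : R,
    [/\ circle_proj u = x t, circle_proj v = y t & `|u - v| <= s]) ->
  `|envelope k x - envelope k y| <= k.+1%:R * s.
Proof.
move=> s0 xy; rewrite ler_distl; apply/andP; split; last first.
  apply: envelope_lip1 => // t /xy[u [v [ux vy uv]]].
  by exists v, u; rewrite distrC.
by rewrite lerBlDr; exact: envelope_lip1.
Qed.

Lemma window_mono k j (t : pos_time R) : (k <= j)%N -> window k t -> window j t.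
Proof.
move=> kj /andP[h1 h2]; apply/andP; split.
  by rewrite (le_trans _ h1)// lef_pV2 ?posrE ?ltr0n// ler_nat.
by rewrite (le_trans h2)// ler_nat.
Qed.

(** A competitor within the modulus of continuity of [F] at [f] changes [F] by less than [e]. Any
    other one pays a penalty of at least 2M once [k] is large, and F g + 2M >= M >= F f. *)
Lemma envelope_cvg (f : path_space R) : continuous F -> envelope k f @[k --> \oo] --> F f.
Proof.
move=> cF; apply/cvgrPdist_le => e e0.
have [k0 k0P] := continuous_modulus f cF e0.
near=> k.
have k0k : (k0 <= k)%N by near: k; exact: nbhs_infty_ge.
rewrite ger0_norm ?subr_ge0 ?envelope_le_path// lerBlDr -lerBlDl.
apply: envelope_ge_lbound; first by rewrite (le_trans _ (F_le f))// gerBl ltW.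
move=> g s s0 fg.
have [sk|ks] := leP s k0.+1%:R^-1.
  have : `|F f - F g| < e.
    apply: k0P => t k0t; have [p [q [pf qg pq]]] := fg t (window_mono k0k k0t).
    by exists p, q; split => //; exact: lt_le_trans sk.
  rewrite ltr_norml => /andP[_ h]; apply: (@le_trans _ _ (F g)).
    by rewrite lerBlDr -lerBlDl ltW.
  by rewrite lerDl mulr_ge0// ltW.
have kM : 2 * M <= k.+1%:R * s.
  apply: (@le_trans _ _ (k.+1%:R * k0.+1%:R^-1)); last by rewrite ler_wpM2l// ltW.
  rewrite ler_pdivlMr ?ltr0n//.
  have : 2 * M * k0.+1%:R < k%:R by near: k; exact: nbhs_infty_gtr.
  by move=> /ltW /le_trans; apply; rewrite ler_nat.
move: (F_ge g) (F_le f) kM e0; move: (k.+1%:R * s) => z; lra.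
Unshelve. all: by end_near. Qed.

End lower_envelope.

(** * Chaining *)

Section dyadic_times.
Context {R : realType}.
Implicit Types (t : R) (n : nat).

(* The least integer above [2 ^ n * t], strictly, so that [dyadic_above n] is a
   grid time after [t]. *)
Definition dyadic_index n t : nat := (Num.truncn (2 ^+ n * t)).+1.

Definition dyadic_above n t : R := (dyadic_index n t)%:R * 2 ^- n.

Lemma dyadic_index_bounds n t : 0 <= t ->
  2 ^+ n * t < (dyadic_index n t)%:R <= 2 ^+ n * t + 1.
Proof.
move=> t0; have nt : 0 <= 2 ^+ n * t by rewrite mulr_ge0// exprn_ge0.
have /andP[h1 h2] := truncn_itv nt.
by rewrite /dyadic_index h2/= -natr1 lerD2r.
Qed.

Lemma dyadic_above_bounds n t : 0 <= t -> t < dyadic_above n t <= t + 2 ^- n.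
Proof.
move=> t0; have /andP[h1 h2] := dyadic_index_bounds n t0.
have p0 : (0 : R) < 2 ^+ n by rewrite exprn_gt0.
apply/andP; split; first by rewrite ltr_pdivlMr// mulrC.
by rewrite ler_pdivrMr// mulrDl mulVf ?gt_eqF// mulrC.
Qed.

(** Hence the dyadic times of levels n and n + 1 following [t] coincide or differ by exactly one
    mesh of level n + 1. *)
Lemma dyadic_index_succ n t : 0 <= t ->
  dyadic_index n.+1 t = (dyadic_index n t).*2 \/
  (dyadic_index n.+1 t).+1 = (dyadic_index n t).*2.
Proof.
move=> t0; have nt : 0 <= 2 ^+ n * t by rewrite mulr_ge0// exprn_ge0.
have /andP[h1 h2] := truncn_itv nt.
rewrite /dyadic_index exprS -mulrA; set z := 2 ^+ n * t in nt h1 h2 *.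
have [h|h] := ltP (2 * z) (Num.truncn z).*2.+1%:R; [right|left].
  by rewrite (@truncn_def _ _ (Num.truncn z).*2)// h andbT -muln2 natrM mulrC ler_pM2l.
rewrite (@truncn_def _ _ (Num.truncn z).*2.+1)// h/=.
by rewrite -doubleS -muln2 natrM mulrC ltr_pM2r.
Qed.

Lemma dyadic_index_lt n t k : 0 <= t -> t <= k%:R -> (dyadic_index n t < k.+2 * 2 ^ n)%N.
Proof.
move=> t0 tk; have /andP[_ h] := dyadic_index_bounds n t0.
have p1 : (1 : R) <= 2 ^+ n by rewrite exprn_ege1// ler1n.
have : 2 ^+ n * t <= 2 ^+ n * k%:R by rewrite ler_pM2l// exprn_gt0.
move=> h'; rewrite -(ltr_nat R) natrM natrX -addn2 natrD.
move: h h' p1; move: (2 ^+ n) => p h h' p1.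
have -> : (k%:R + 2%:R) * p = p * k%:R + 2 * p by ring.
lra.
Qed.

End dyadic_times.

(** Bounds one increment by a fixed quantity plus a multiple of its fourth power, so that the
    maximum over a level is controlled by a sum of fourth powers. *)
Lemma le_add_quartic {R : realFieldType} (u eta : R) : 0 <= u -> 0 < eta ->
  u <= eta + u ^+ 4 / eta ^+ 3.
Proof.
move=> u0 e0; have [ue|eu] := leP u eta.
  by rewrite (le_trans ue)// lerDl divr_ge0// exprn_ge0// ltW.
apply: (@le_trans _ _ (u ^+ 4 / eta ^+ 3)); last by rewrite lerDr ltW.
rewrite ler_pdivlMr ?exprn_gt0// [u ^+ 4]exprS ler_wpM2l//.
by rewrite lerXn2r// ?nnegrE ltW.
Qed.

Section chaining.
Context {R : realType} d (T : measurableType d) (P : probability T R).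
Variables (a : R) (Y : R -> T -> R).
Hypotheses (a0 : 0 < a) (chainY : sign_chain P a Y).
Local Notation E := (mean P).
Local Notation V t := (Yint Y 0 (t * a)).
Local Notation D l := (telegraph_increment a Y (2 ^- l)).
Implicit Types (s t : R) (w : T).

(** This bound degrades as [a] grows; it serves only at fixed [a], with a mesh tending to 0. *)
Lemma Yint_lip s t w : 0 <= s -> s <= t -> `|V t w - V s w| <= a * (t - s).
Proof.
move=> s0 st; have sa0 : 0 <= s * a by rewrite mulr_ge0// ltW.
have sta : s * a <= t * a by rewrite ler_pM2r.
rewrite (Yint_add chainY w (lexx 0) sa0 sta) addrAC subrr add0r.
move: st; rewrite le_eqVlt => /predU1P[<-|st].
  by rewrite Yint_refl normr0 subrr mulr0.
apply: (le_trans (Yint_bound chainY _ _ _)) => //; first by rewrite ltr_pM2r.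
by rewrite -mulrBl mulrC.
Qed.

Lemma telegraph_increment_moment l i : E (fun w => D l i w ^+ 4) <= 7 * 4 ^- l.
Proof.
have p0 : (0 : R) < 2 ^- l by rewrite invr_gt0 exprn_gt0.
have h0 : 0 <= i%:R * 2 ^- l * a by rewrite !mulr_ge0// ltW.
have h1 : i%:R * 2 ^- l * a < i.+1%:R * 2 ^- l * a by rewrite !ltr_pM2r// ltr_nat.
have pc : past Y (i%:R * 2 ^- l * a) (fun=> 1) by apply: (past_finite chainY) => //; exact: finite_past_cst.
have n1 (w : T) : `|1 : R| <= 1 by rewrite normr1.
have [_ _] := Yint_moments a0 chainY h0 h1 pc n1.
have -> : i.+1%:R * 2 ^- l * a - i%:R * 2 ^- l * a = a * 2 ^- l by rewrite -natr1; ring.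
rewrite -/(D l i).
have -> : (a * 2 ^- l) ^+ 2 = a ^+ 2 * 4 ^- l.
  rewrite exprMn; congr (_ * _); rewrite exprVn -exprM mulnC exprM.
  by congr ((_ ^+ _)^-1); rewrite expr2 -natrM.
have a2 : 0 < a ^+ 2 by rewrite exprn_gt0.
have q0 : (0 : R) < 4 ^- l by rewrite invr_gt0 exprn_gt0.
suff aux (q b m : R) : 0 < q -> 0 < b -> 4 * b * m <= 27 * (b * q) -> m <= 7 * q by exact: aux.
clear n1; move=> q1 b0 h; have : b * (4 * m) <= b * (27 * q) by move: h; lra.
by rewrite ler_pM2l// => h'; move: q1 h'; lra.
Qed.

(* [le_add_quartic] with [eta = (9 / 10) ^ l]; the mean is summable over [l] since
   there are [q * 2 ^ l] terms of mean [O(4 ^- l)] and [(10 / 9) ^ 3 / 2 < 9 / 10]. *)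
Definition oscillation_bound (q l : nat) (w : T) : R :=
  (9 / 10) ^+ l + (\sum_(i < q * 2 ^ l) D l i w ^+ 4) / ((9 / 10) ^+ l) ^+ 3.

Lemma oscillation_bound_rv q l : bounded_rv (oscillation_bound q l).
Proof.
apply: bounded_rvD; first exact: bounded_rv_cst.
apply: bounded_rvM; last exact: bounded_rv_cst.
apply: bounded_rv_sum => i _; apply: bounded_rvX; apply: (Yint_rv chainY).
  by rewrite !mulr_ge0// ?invr_ge0 ?exprn_ge0// ltW.
by rewrite !ltr_pM2r// ?invr_gt0 ?exprn_gt0// ltr_nat.
Qed.

Lemma mean_oscillation_bound q l : E (oscillation_bound q l) <= (1 + 7 * q%:R) * (9 / 10) ^+ l.
Proof.
have brD i : bounded_rv (fun w => D l i w ^+ 4).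
  apply: bounded_rvX; apply: (Yint_rv chainY).
    by rewrite !mulr_ge0// ?invr_ge0 ?exprn_ge0// ltW.
  by rewrite !ltr_pM2r// ?invr_gt0 ?exprn_gt0// ltr_nat.
have brS : bounded_rv (fun w => \sum_(i < q * 2 ^ l) D l i w ^+ 4).
  by apply: bounded_rv_sum => i _.
have th0 : (0 : R) < (9 / 10) ^+ l by rewrite exprn_gt0.
rewrite meanD; [|exact: bounded_rv_cst|apply: bounded_rvM => //; exact: bounded_rv_cst].
rewrite mean_cst meanZr// mean_sum; last by move=> i _.
rewrite [leRHS]mulrDl mul1r lerD2l.
apply: (@le_trans _ _ ((\sum_(i < q * 2 ^ l) 7 * 4 ^- l) / ((9 / 10) ^+ l) ^+ 3)).
  rewrite ler_pM2r ?invr_gt0 ?exprn_gt0//.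
  by apply: ler_sum => i _; exact: telegraph_increment_moment.
rewrite sumr_const card_ord -[_ *+ (q * 2 ^ l)]mulr_natl natrM natrX.
rewrite ler_pdivrMr ?exprn_gt0//.
have -> : q%:R * 2 ^+ l * (7 * 4 ^- l) = 7 * q%:R * (2 / 4) ^+ l :> R.
  by rewrite expr_div_n; ring.
(* What remains is 2/4 <= (9/10)^4 = 0.6561, raised to the power [l]. *)
rewrite -[leRHS]mulrA ler_wpM2l ?mulr_ge0// -exprS -exprM mulnC exprM.
by rewrite lerXn2r ?nnegrE//; lra.
Qed.

(** The two dyadic times differ by at most one mesh of level n + 1, and the factor k + 2 guarantees
    that this mesh is among those summed in the oscillation bound. *)
Lemma dyadic_step k n t w : 0 <= t -> t <= k%:R ->
  `|V (dyadic_above n t) w - V (dyadic_above n.+1 t) w| <= oscillation_bound k.+2 n.+1 w.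
Proof.
move=> t0 tk; set B := oscillation_bound _ _ w.
have th0 : (0 : R) < (9 / 10) ^+ n.+1 by rewrite exprn_gt0.
have pos (u : R) : 0 <= u ^+ 4 by rewrite exprn_even_ge0.
have p0 : (0 : R) < 2 ^- n.+1 by rewrite invr_gt0 exprn_gt0.
have E1 : dyadic_above n t = (dyadic_index n t).*2%:R * 2 ^- n.+1.
  rewrite /dyadic_above -mul2n natrM exprS invfM; field.
  by rewrite gt_eqF// exprn_gt0.
have [e|e] := dyadic_index_succ n t0.
  rewrite E1 -e -/(dyadic_above n.+1 t) subrr normr0.
  by rewrite addr_ge0 ?(ltW th0)// divr_ge0 ?exprn_ge0 ?(ltW th0)// sumr_ge0.
have ilt := dyadic_index_lt n.+1 t0 tk.
rewrite E1 -e /dyadic_above.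
set i := dyadic_index n.+1 t in ilt e *.
have ia : 0 <= i%:R * 2 ^- n.+1 * a by rewrite !mulr_ge0// ltW.
have iai : i%:R * 2 ^- n.+1 * a <= i.+1%:R * 2 ^- n.+1 * a by rewrite !ler_pM2r// ler_nat.
rewrite (Yint_add chainY w (lexx 0) ia iai) addrAC subrr add0r.
apply: (le_trans (le_add_quartic (normr_ge0 _) th0)).
rewrite lerD2l ler_pM2r ?invr_gt0 ?exprn_gt0//.
rewrite -normrX ger0_norm ?pos// -/(D n.+1 i w).
rewrite (bigD1 (Ordinal ilt))//= lerDl sumr_ge0//.
Qed.

(** The right-hand side does not involve [t]: one random variable controls all times up to [k]. The
    chain stops at level n + J, where the Lipschitz bound takes over. *)
Lemma dyadic_chaining k n J t w : 0 <= t -> t <= k%:R ->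
  `|V t w - V (dyadic_above n t) w| <=
  \sum_(j < J) oscillation_bound k.+2 (n + j).+1 w + a * 2 ^- (n + J).
Proof.
move=> t0 tk.
have H : `|V (dyadic_above n t) w - V (dyadic_above (n + J) t) w| <=
    \sum_(j < J) oscillation_bound k.+2 (n + j).+1 w.
  elim: J => [|J IH]; first by rewrite addn0 subrr normr0 big_ord0.
  rewrite big_ord_recr addnS.
  apply: (le_trans (ler_distD (V (dyadic_above (n + J) t) w) _ _)).
  by apply: lerD => //; exact: dyadic_step.
rewrite distrC; apply: (le_trans (ler_distD (V (dyadic_above (n + J) t) w) _ _)).
apply: lerD => //; have /andP[h1 h2] := dyadic_above_bounds (n + J) t0.
apply: (le_trans (Yint_lip _ t0 (ltW h1))).
by rewrite ler_pM2l// lerBlDl.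
Qed.

Lemma mean_chaining k n J :
  E (fun w => \sum_(j < J) oscillation_bound k.+2 (n + j).+1 w + a * 2 ^- (n + J)) <=
  (1 + 7 * k.+2%:R) * 9 * (9 / 10) ^+ n + a * 2 ^- (n + J).
Proof.
have br j : bounded_rv (oscillation_bound k.+2 (n + j).+1) by exact: oscillation_bound_rv.
rewrite meanD; [|by apply: bounded_rv_sum => i _|exact: bounded_rv_cst].
rewrite mean_cst lerD2r mean_sum; last by move=> i _.
apply: (@le_trans _ _ (\sum_(j < J) (1 + 7 * k.+2%:R) * (9 / 10) ^+ (n + j).+1)).
  by apply: ler_sum => j _; exact: mean_oscillation_bound.
rewrite -mulr_sumr -mulrA ler_wpM2l ?addr_ge0// ?mulr_ge0//.
(* The constant is 9 = (9/10) / (1 - 9/10). *)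
have -> : \sum_(j < J) (9 / 10) ^+ (n + j).+1 = 9 * (9 / 10) ^+ n * (1 - (9 / 10) ^+ J) :> R.
  elim: J => [|J IH]; first by rewrite big_ord0 expr0 subrr mulr0.
  by rewrite big_ord_recr IH /= exprS exprD [(9 / 10) ^+ J.+1]exprS; field.
rewrite -[leRHS]mulr1 ler_wpM2l ?mulr_ge0 ?exprn_ge0//.
Qed.

End chaining.

Section dyadic_sampling.
Context {R : realType}.
Variables (F : path_space R -> R) (M : R).
Hypothesis FM : forall f, `|F f| <= M.
Implicit Types (k n : nat) (x : nat -> R).

(** Written for an arbitrary sequence of increments, so as to fall under [increments_cvg]. The path
    handed to the envelope is a step function. *)
Definition sampled_envelope k n x : R :=
  envelope F M k (fun t => circle_proj (\sum_(j < dyadic_index n (\val t)) x j)).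

Lemma circle_proj_sum (x y : nat -> R) m i : (i <= m)%N ->
  (forall j, (j < m)%N -> circle_proj (x j) = circle_proj (y j)) ->
  circle_proj (\sum_(j < i) x j) = circle_proj (\sum_(j < i) y j).
Proof.
move=> im xy; elim: i im => [_|i IH im]; first by rewrite !big_ord0.
rewrite !big_ord_recr /=; apply/circle_projP.
rewrite /circle_rel opprD addrACA mulrDl rpredD//; apply/circle_projP; last exact: xy.
by apply: IH; exact: ltnW.
Qed.

Lemma sampled_envelope_lip k n :
  lip_periodic (k.+3 * 2 ^ n) k.+1%:R (sampled_envelope k n).
Proof.
have idx t : window k t -> (dyadic_index n (\val t) < k.+3 * 2 ^ n)%N.
  by move=> /andP[_ tk]; apply: dyadic_index_lt => //; exact/ltW/pos_timeP.
split=> x y.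
  apply: envelope_lip => // [|t /idx it]; first exact: sumr_ge0.
  exists (\sum_(j < dyadic_index n (\val t)) x j), (\sum_(j < dyadic_index n (\val t)) y j).
  split => //; rewrite -sumrB; apply: (le_trans (ler_norm_sum _ _ _)).
  rewrite -!(big_mkord xpredT (fun j => `|x j - y j|)) [leRHS](big_cat_nat (n := dyadic_index n (\val t)))//=; last exact: ltnW.
  by rewrite lerDl sumr_ge0.
move=> xy; apply/eqP; rewrite -subr_eq0 -normr_le0 -[leRHS](mulr0 k.+1%:R).
apply: envelope_lip => // t /idx it.
exists (\sum_(j < dyadic_index n (\val t)) x j), (\sum_(j < dyadic_index n (\val t)) x j).
rewrite subrr normr0; split => //.
by apply: (circle_proj_sum (ltnW it)).
Qed.

Lemma sampled_envelope_bound k n x : `|sampled_envelope k n x| <= M.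
Proof. exact: envelope_bound. Qed.

(** * Circle-valued processes with a real lift *)

Section lifted_process.
Context d (T : measurableType d) (P : probability T R).
Variables (V : R -> T -> R) (Z : T -> path_space R).
Hypotheses (V0 : forall w, V 0 w = 0)
  (Vm : forall t, 0 <= t -> measurable_fun setT (V t))
  (V_dyadic : forall k w (e : R), 0 < e -> \forall n \near \oo,
    forall t, 0 <= t <= k.+1%:R -> `|V t w - V (dyadic_above n t) w| <= e)
  (ZV : forall w t, Z w t = circle_proj (V (\val t) w))
  (cF : continuous F).
Local Notation E := (mean P).

Definition dyadic_increment n i w : R := V (i.+1%:R * 2 ^- n) w - V (i%:R * 2 ^- n) w.

Definition lifted_envelope k w : R := envelope F M k (fun t => circle_proj (V (\val t) w)).

Lemma sampled_envelopeE k n w :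
  sampled_envelope k n (dyadic_increment n ^~ w) =
  envelope F M k (fun t => circle_proj (V (dyadic_above n (\val t)) w)).
Proof.
congr (envelope _ _ _ _); apply/funext => t; congr circle_proj.
have tel i : \sum_(j < i) dyadic_increment n j w = V (i%:R * 2 ^- n) w.
  elim: i => [|i IH]; first by rewrite big_ord0 mul0r V0.
  by rewrite big_ord_recr IH /= addrC subrK.
by rewrite tel.
Qed.

Lemma sampled_envelope_rv k n :
  bounded_rv (fun w => sampled_envelope k n (dyadic_increment n ^~ w)).
Proof.
apply: (lip_periodic_rv _ _ (sampled_envelope_lip k n) (sampled_envelope_bound k n)) => // i.
by apply: measurable_funB; apply: Vm; rewrite mulr_ge0// invr_ge0 exprn_ge0.
Qed.

Lemma sampled_envelope_cvg k w :
  sampled_envelope k n (dyadic_increment n ^~ w) @[n --> \oo] --> lifted_envelope k w.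
Proof.
apply/cvgrPdist_le => e e0.
have k0 : 0 < k.+1%:R :> R by [].
near=> n; rewrite sampled_envelopeE.
have -> : e = k.+1%:R * (e / k.+1%:R) by field; rewrite gt_eqF.
apply: envelope_lip => [//||t tk]; first by rewrite divr_ge0// ltW.
exists (V (\val t) w), (V (dyadic_above n (\val t)) w); split => //.
have : 0 <= \val t <= k.+1%:R by case/andP: tk => _ ->; rewrite ltW// pos_timeP.
by move: (\val t); near: n; apply: V_dyadic; rewrite divr_gt0.
Unshelve. all: by end_near. Qed.

Lemma mean_sampled_envelope_cvg k :
  E (fun w => sampled_envelope k n (dyadic_increment n ^~ w)) @[n --> \oo] -->
  E (lifted_envelope k).
Proof.
apply: (mean_cvg (M := M)) => [n|n w|w]; last exact: sampled_envelope_cvg.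
  exact: bounded_rv_measurable (sampled_envelope_rv k n).
exact: sampled_envelope_bound.
Qed.

Lemma lifted_envelope_rv k : bounded_rv (lifted_envelope k).
Proof.
apply: (bounded_rv_cvg (M := M)
  (u := fun n w => sampled_envelope k n (dyadic_increment n ^~ w))) => [n|n w|w].
- exact: bounded_rv_measurable (sampled_envelope_rv k n).
- exact: sampled_envelope_bound.
- exact: sampled_envelope_cvg.
Qed.

Let Zfun w : (Z w : pos_time R -> circle R) = fun t => circle_proj (V (\val t) w).
Proof. by apply/funext => t; exact: ZV. Qed.

Lemma lifted_envelope_cvg w : lifted_envelope k w @[k --> \oo] --> F (Z w).
Proof. by rewrite /lifted_envelope -Zfun; exact: envelope_cvg. Qed.

Lemma lifted_envelope_le k w : lifted_envelope k w <= F (Z w).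
Proof. by rewrite /lifted_envelope -Zfun; exact: envelope_le_path. Qed.

(** Along the process, [F] is a limit of envelopes, themselves limits of functions of finitely many
    increments. The measurability of [F \o Z] comes from this, with no sigma-algebra put on
    [path_space]. *)
Lemma path_functional_rv : bounded_rv (F \o Z).
Proof.
apply: (bounded_rv_cvg (M := M) (u := lifted_envelope)) => [k|k w|w].
- exact: bounded_rv_measurable (lifted_envelope_rv k).
- exact: envelope_bound.
- exact: lifted_envelope_cvg.
Qed.

Lemma mean_lifted_envelope_cvg : E (lifted_envelope k) @[k --> \oo] --> E (F \o Z).
Proof.
apply: (mean_cvg (M := M)) => [k|k w|w]; last exact: lifted_envelope_cvg.
  exact: bounded_rv_measurable (lifted_envelope_rv k).
exact: envelope_bound.
Qed.

Lemma mean_lifted_envelope_le k : E (lifted_envelope k) <= E (F \o Z).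
Proof.
apply: le_mean; [exact: lifted_envelope_rv|exact: path_functional_rv|].
exact: lifted_envelope_le.
Qed.

End lifted_process.

End dyadic_sampling.

Lemma cvg_dyadic_mesh {R : realType} : 2 ^- n @[n --> \oo] --> (0 : R).
Proof.
rewrite (_ : (fun n => _) = (fun n => (2^-1) ^+ n)); last by apply/funext => n; rewrite exprVn.
by apply: cvg_expr; rewrite ger0_norm ?invr_ge0// invf_lt1// ltr1n.
Qed.

Lemma near_dyadic_mesh {R : realType} (e : R) : 0 < e -> \forall n \near \oo, 2 ^- n <= e.
Proof.
move=> e0; have /cvgrPdist_le/(_ _ e0) := @cvg_dyadic_mesh R.
by apply: filterS => n; rewrite sub0r normrN ger0_norm// invr_ge0 exprn_ge0.
Qed.

(** * Sampling error for the telegraph process *)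

Section telegraph_envelope.
Context {R : realType} d (T : measurableType d) (P : probability T R).
Variables (a : R) (Y : R -> T -> R) (F : path_space R -> R) (M : R).
Hypotheses (a0 : 0 < a) (chainY : sign_chain P a Y).
Hypothesis FM : forall f, `|F f| <= M.
Local Notation E := (mean P).

Definition telegraph_lift (t : R) (w : T) : R := Yint Y 0 (t * a) w.
Local Notation V := telegraph_lift.

Lemma telegraph_lift0 w : V 0 w = 0.
Proof. by rewrite /V mul0r Yint_refl. Qed.

Lemma telegraph_lift_rv (t : R) : 0 <= t -> measurable_fun setT (V t).
Proof.
rewrite le_eqVlt => /predU1P[<-|t0].
  by rewrite (_ : V 0 = cst 0)//; apply/funext => w; exact: telegraph_lift0.
by apply: bounded_rv_measurable; apply: (Yint_rv chainY) => //; rewrite mulr_gt0.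
Qed.

Lemma telegraph_lift_dyadic k w (e : R) : 0 < e -> \forall n \near \oo,
  forall t, 0 <= t <= k.+1%:R -> `|V t w - V (dyadic_above n t) w| <= e.
Proof.
move=> e0; near=> n => t /andP[t0 _].
have /andP[h1 h2] := dyadic_above_bounds n t0.
rewrite distrC; apply: (le_trans (Yint_lip a0 chainY w t0 (ltW h1))).
apply: (@le_trans _ _ (a * 2 ^- n)); first by rewrite ler_pM2l// lerBlDl.
rewrite mulrC -ler_pdivlMr//.
by near: n; apply: near_dyadic_mesh; rewrite divr_gt0.
Unshelve. all: by end_near. Qed.

Lemma telegraph_lift_increment n i w :
  dyadic_increment V n i w = telegraph_increment a Y (2 ^- n) i w.
Proof.
have i0 : 0 <= i%:R * 2 ^- n * a by rewrite !mulr_ge0 ?invr_ge0 ?exprn_ge0// ltW.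
have ii : i%:R * 2 ^- n * a <= i.+1%:R * 2 ^- n * a.
  by rewrite !ler_pM2r ?invr_gt0 ?exprn_gt0// ler_nat.
by rewrite /dyadic_increment /V (Yint_add chainY w (lexx 0) i0 ii) addrAC subrr add0r.
Qed.

(** The bound is the same for all a > 0: the depth [J] of the chaining tends to infinity at fixed
    [a], which removes the only term where [a] appears. *)
Lemma telegraph_envelope_dist k n :
  `|E (lifted_envelope F M V k) -
    E (fun w => sampled_envelope F M k n (telegraph_increment a Y (2 ^- n) ^~ w))| <=
  k.+1%:R * ((1 + 7 * k.+3%:R) * 9 * (9 / 10) ^+ n).
Proof.
have -> : E (fun w => sampled_envelope F M k n (telegraph_increment a Y (2 ^- n) ^~ w)) =
    E (fun w => sampled_envelope F M k n (dyadic_increment V n ^~ w)).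
  apply: eq_mean => w; congr sampled_envelope; apply/funext => i.
  by rewrite telegraph_lift_increment.
have bl := lifted_envelope_rv FM telegraph_lift0 telegraph_lift_rv telegraph_lift_dyadic k.
have bs := sampled_envelope_rv FM telegraph_lift_rv k n.
rewrite -meanB//.
set c := _ * (9 / 10) ^+ n.
have lim : k.+1%:R * (c + a * 2 ^- (n + J)) @[J --> \oo] --> k.+1%:R * (c + a * 0).
  apply: cvgMr; apply: cvgD; first exact: cvg_cst.
  apply: cvgMr; rewrite (_ : (fun J => _) = (fun J => 2 ^- (J + n))).
    by have := @cvg_dyadic_mesh R; rewrite -(cvg_shiftn n).
  by apply/funext => J; rewrite addnC.
rewrite mulr0 addr0 in lim; apply: (cvgr_to_ge lim); near=> J.
have bo j : bounded_rv (oscillation_bound a Y k.+3 (n + j).+1) by exact: (oscillation_bound_rv a0 chainY).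
have bb : bounded_rv (fun w => \sum_(j < J) oscillation_bound a Y k.+3 (n + j).+1 w + a * 2 ^- (n + J)).
  by apply: bounded_rvD; [apply: bounded_rv_sum => j _|exact: bounded_rv_cst].
apply: (@le_trans _ _ (k.+1%:R * E (fun w => \sum_(j < J) oscillation_bound a Y k.+3 (n + j).+1 w + a * 2 ^- (n + J)))); last first.
  by rewrite ler_pM2l//; exact: (mean_chaining a0 chainY k.+1).
rewrite -meanZ//; apply: normr_mean_le => [||w].
- exact: bounded_rvB.
- by apply: bounded_rvM => //; exact: bounded_rv_cst.
rewrite sampled_envelopeE; last exact: telegraph_lift0.
apply: (envelope_lip FM) => [|t tk].
  rewrite addr_ge0//; last by rewrite mulr_ge0 ?invr_ge0 ?exprn_ge0// ltW.
  apply: sumr_ge0 => j _; rewrite addr_ge0 ?exprn_ge0// divr_ge0 ?exprn_ge0//.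
  by apply: sumr_ge0 => i _; rewrite exprn_even_ge0.
exists (V (\val t) w), (V (dyadic_above n (\val t)) w); split => //.
apply: (dyadic_chaining a0 chainY) => //; first exact/ltW/pos_timeP.
by case/andP: tk.
Unshelve. all: by end_near. Qed.

End telegraph_envelope.

Lemma brownian_lift_dyadic {R : realType} d (T : measurableType d) (Q : probability T R)
    (W : R -> T -> R) k w (e : R) : standard_brownian_motion Q W ->
  0 < e -> \forall n \near \oo,
  forall t, 0 <= t <= k.+1%:R -> `|W t w - W (dyadic_above n t) w| <= e.
Proof.
move=> bmW e0.
have [N HN] := continuous_uniform k.+1%:R (@brownian_continuous _ _ _ _ _ bmW w) e0.
near=> n => t /andP[t0 tk]; apply/ltW/HN; first by rewrite t0.
  by have /andP[/ltW h1 _] := dyadic_above_bounds n t0; exact: le_trans h1.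
have /andP[h1 h2] := dyadic_above_bounds n t0.
rewrite distrC ger0_norm ?subr_ge0 ?(ltW h1)//.
apply: (@le_trans _ _ (2 ^- n)); first by rewrite lerBlDl.
by near: n; apply: near_dyadic_mesh; rewrite invr_gt0.
Unshelve. all: by end_near. Qed.

(** * Convergence in law *)

Section telegraph_cvg_in_law.
Context {R : realType} {d : R -> measure_display} {Om : forall a : R, measurableType (d a)}
  {P : forall a : R, probability (Om a) R} {Y : forall a : R, R -> Om a -> R}
  {X : forall a : R, Om a -> path_space R}
  {d' : measure_display} {Om' : measurableType d'} {Q : probability Om' R}
  {B : Om' -> path_space R} {W : R -> Om' -> R}.
Hypotheses (chainY : forall a : R, 0 < a -> sign_chain (P a) a (@Y a))
  (XE : forall (a : R) (w : Om a) (t : pos_time R), 0 < a ->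
     X w t = circle_integral (@Y a) (\val t * a) w)
  (bmW : standard_brownian_motion Q W)
  (BE : forall w t, B w t = circle_proj (W (\val t) w)).

Section bounded_functional.
Variables (F : path_space R -> R) (M : R).
Hypotheses (cF : continuous F) (FM : forall f, `|F f| <= M).

Let XV a : 0 < a -> forall (w : Om a) t, X w t = circle_proj (telegraph_lift a (@Y a) (\val t) w).
Proof. by move=> a0 w t; rewrite XE. Qed.

Lemma telegraph_functional_rv a : 0 < a -> bounded_rv (F \o @X a).
Proof.
move=> a0; have Ya := chainY a0.
exact: (path_functional_rv FM (@telegraph_lift0 _ _ _ a (@Y a))
  (telegraph_lift_rv a0 Ya) (telegraph_lift_dyadic a0 Ya) (XV a0) cF).
Qed.

Let W0 := brownian0 bmW.
Let Wm := brownian_measurable bmW.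
Let Wc k w (e : R) := @brownian_lift_dyadic _ _ _ _ _ k w e bmW.

Lemma brownian_functional_rv : bounded_rv (F \o B).
Proof. exact: (path_functional_rv FM W0 Wm Wc BE cF). Qed.

(** [k] and then [n] are chosen before [a]. There are four errors of e/4: the envelope and its
    sampling for [B], the convergence of the sampled functionals, and the sampling for [X], uniform
    in [a]. The last passage, from the envelope to [F] under the law of [X], is an inequality and
    costs nothing, whatever [a]. *)
Lemma telegraph_functional_lower (e : R) : 0 < e ->
  \forall a \near +oo%R, mean Q (F \o B) - e <= mean (P a) (F \o @X a).
Proof.
move=> e0; have e4 : 0 < e / 4 by rewrite divr_gt0.
have [k hk] : exists k, `|mean Q (F \o B) - mean Q (lifted_envelope F M W k)| <= e / 4.
  have /cvgrPdist_le/(_ _ e4)[N _ /(_ N (leqnn N)) h] :=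
    mean_lifted_envelope_cvg (P := Q) FM W0 Wm Wc BE cF.
  by exists N.
have [n hn1 hn2] : exists2 n,
    `|mean Q (lifted_envelope F M W k) -
      mean Q (fun w => sampled_envelope F M k n (dyadic_increment W n ^~ w))| <= e / 4 &
    k.+1%:R * ((1 + 7 * k.+3%:R) * 9 * (9 / 10) ^+ n) <= e / 4.
  have /cvgrPdist_le/(_ _ e4) h1 := mean_sampled_envelope_cvg (P := Q) (k := k) FM W0 Wm Wc.
  have : k.+1%:R * ((1 + 7 * k.+3%:R) * 9 * (9 / 10) ^+ n) @[n --> \oo] -->
      k.+1%:R * ((1 + 7 * k.+3%:R) * 9 * (0 : R)).
    by apply: cvgMr; apply: cvgMr; apply: cvg_expr; rewrite ger0_norm// ltr_pdivrMr// mul1r ltr_nat.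
  rewrite !mulr0 => /cvgrPdist_le/(_ _ e4) h2.
  have [N _ H] := filterI h1 h2; have [/= H1 H2] := H N (leqnn N).
  exists N => //; apply: le_trans H2; rewrite sub0r normrN; exact: ler_norm.
have h0 : 0 < 2 ^- n :> R by rewrite invr_gt0 exprn_gt0.
have /cvgrPdist_le/(_ _ e4) h3 := increments_cvg chainY bmW h0 (ler0n R k.+1)
  (sampled_envelope_lip FM k n) (sampled_envelope_bound FM k n).
near=> a.
have a0 : 0 < a by near: a; apply: nbhs_pinfty_gt; exact: num_real.
have Ya := chainY a0.
have ha := telegraph_envelope_dist a0 Ya FM k n.
have hb : `|mean Q (fun w => sampled_envelope F M k n (dyadic_increment W n ^~ w)) -
    mean (P a) (fun w => sampled_envelope F M k n (telegraph_increment a (@Y a) (2 ^- n) ^~ w))| <= e / 4.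
  by near: a; exact: h3.
have hle := (mean_lifted_envelope_le FM (P a) (@telegraph_lift0 _ _ _ a (@Y a))
  (telegraph_lift_rv a0 Ya) (telegraph_lift_dyadic a0 Ya) (XV a0) cF k). apply: le_trans hle.
have {}ha := le_trans ha hn2.
move: hk hn1 hb ha; rewrite !ler_norml => /andP[_ hk] /andP[_ hn1] /andP[_ hb] /andP[ha _].
move: hk hn1 hb ha; lra.
Unshelve. all: by end_near. Qed.

End bounded_functional.

Lemma telegraph_functional_cvg (F : path_space R -> R) (M : R) :
  continuous F -> (forall f, `|F f| <= M) ->
  mean (P a) (F \o @X a) @[a --> +oo%R] --> mean Q (F \o B).
Proof.
move=> cF FM; apply/cvgrPdist_le => e e0.
have cNF : continuous (fun f => - F f) by move=> f; apply: continuousN; exact: cF.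
have NFM f : `|- F f| <= M by rewrite normrN.
have h1 := telegraph_functional_lower cF FM e0.
have h2 := telegraph_functional_lower cNF NFM e0.
near=> a.
have a0 : 0 < a by near: a; apply: nbhs_pinfty_gt; exact: num_real.
have k1 : mean Q (F \o B) - e <= mean (P a) (F \o @X a) by near: a; exact: h1.
have k2 : mean Q ((fun f => - F f) \o B) - e <= mean (P a) ((fun f => - F f) \o @X a).
  by near: a; exact: h2.
have bX := telegraph_functional_rv cF FM a0.
have bB := brownian_functional_rv cF FM.
have eX : mean (P a) ((fun f => - F f) \o @X a) = - mean (P a) (F \o @X a) by rewrite -meanN.
have eB : mean Q ((fun f => - F f) \o B) = - mean Q (F \o B) by rewrite -meanN.
move: k2; rewrite eX eB ler_norml => k2; apply/andP; split; move: k1 k2; lra.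
Unshelve. all: by end_near. Qed.

End telegraph_cvg_in_law.

Theorem mainTheorem13 (R : realType)
    (d : R -> measure_display) (Om : forall a : R, measurableType (d a))
    (P : forall a : R, probability (Om a) R)
    (Y : forall a : R, R -> Om a -> R)
    (X : forall a : R, Om a -> path_space R)
    (d' : measure_display) (Om' : measurableType d') (Q : probability Om' R)
    (B : Om' -> path_space R) :
  (forall a : R, 0 < a -> sign_chain (P a) a (Y a)) ->
  (forall (a : R) (w : Om a) (t : pos_time R), 0 < a ->
     X a w t = circle_integral (Y a) (\val t * a) w) ->
  circle_brownian_motion Q B ->
  cvg_in_law P X Q B.
Proof.
move=> chainY XE [W bmW BE] F cF [M FM].
rewrite -(EFin_mean _ (brownian_functional_rv bmW BE cF FM)).
have h : (mean (P a) (F \o X a))%:E @[a --> +oo%R] --> (mean Q (F \o B))%:E.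
  by apply: cvg_EFin; [exact: nearW|exact: (telegraph_functional_cvg chainY XE bmW BE cF FM)].
(* Real means and extended expectations are compared only for a > 0, where the hypotheses on the
   chain and on [X] make [F \o X a] a bounded random variable. *)
apply: cvg_trans h; apply: near_eq_cvg; near=> a.
have a0 : 0 < a by near: a; apply: nbhs_pinfty_gt; exact: num_real.
by rewrite -(EFin_mean _ (telegraph_functional_rv chainY XE cF FM a0)).
Unshelve. all: by end_near. Qed.
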